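(* Let $L>0$ be fixed and let $b\in[-L,L]$. As $t\to0^+$, uniformly with respect to $b \in [-L,L]$, $$ \begin{aligned} \mathrm{Tr}\big(e^{-t\Lambda(b)}-e^{-t\Lambda(0)}\big) =\;&\Big(\big(1-\tfrac{\pi^2}{3}+7\zeta(3)\big)b^2-\lambda_0(b)-\sum_{n=1}^{+\infty}(\lambda_n(b)-\mu_n(b))-\sum_{n=1}^{+\infty}(\lambda_n(-b)-\mu_n(-b))\Big)\,t\\ &+\Big(\tfrac{1}{3780}\Big[\big(5670-2520\pi^2+126\pi^4+4\pi^6-15120\,\zeta(3)-7560\,\zeta(5)\big)b^2\\ &\qquad+\big(126\pi^4+57\pi^6-7560\,\zeta(3)-34020\,\zeta(5)\big)b^4+4\pi^6b^6\Big]\\ &\qquad+\tfrac12\lambda_0(b)^2+\tfrac12\sum_{n=1}^{+\infty}\big(\lambda_n(b)^2-\mu_n(b)^2\big)+\tfrac12\sum_{n=1}^{+\infty}\big(\lambda_n(-b)^2-\mu_n(-b)^2\big)\Big)\,t^2\\ &-\tfrac{b^2}{2}\,t^3\log t+\mathcal O(|b|\,t^3). \end{aligned} $$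
   Context: Let $D(0,1)\subset\mathbb R^2$ be the open unit disk, with boundary $S^1$. For $b\in\mathbb R$ let $A=b(-y\,dx+x\,dy)$, so that $dA=2b\,dx\wedge dy$ is a constant magnetic field. With $D=-i\nabla$, let $\Delta_A=(D-A)^2$ be the magnetic Laplacian. The magnetic Dirichlet-to-Neumann operator $\Lambda(b):H^{1/2}(S^1)\to H^{-1/2}(S^1)$ is $\Lambda(b)\Psi=\partial_r v|_{r=1}$ (in the weak sense), where $v$ is the unique solution of $\Delta_A v=0$ in $D(0,1)$, $v=\Psi$ on $S^1$. Kummer's function is $M(a,c,z)=\sum_{k\ge0}\frac{(a)_k}{(c)_k}\frac{z^k}{k!}$, where $(a)_k=\Gamma(a+k)/\Gamma(a)$. For $n\ge0$ put $$\lambda_n(b)=n-b+2b\,\frac{\partial_zM(\frac12,n+1,b)}{M(\frac12,n+1,b)} .$$ In particular $\lambda_0(b)=b\,I_0'(b/2)/I_0(b/2)$, with $I_0(z)=\sum_{k\ge0}\frac{z^{2k}}{2^{2k}(k!)^2}$, is even in $b$. The eigenvalues of $\Lambda(b)$ (counted with multiplicity, with eigenfunctions $e^{in\theta}$, $n\in\mathbb Z$) are $\lambda_0(b)$ together with $\lambda_n(b)$ and $\lambda_n(-b)$ for $n\ge1$. For $n\ge1$ put $$\mu_n(b)=n-b+2b\Big(\frac1{2n}+\frac{b-1}{2n^2}+\frac{2b^2-7b+2}{4n^3}\Big);$$ one has $\lambda_n(b)-\mu_n(b)=\mathcal O(|b|/n^4)$ as $n\to+\infty$, so the series in the claim converge.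 $\zeta$ denotes the Riemann zeta function. *)

(* Defs.v *)
From Stdlib Require Import Reals ZArith ClassicalEpsilon.
From Coquelicot Require Import Coquelicot.

Open Scope R_scope.

(** * Sums over Z, splitting Z into n >= 0 and n <= -1 *)

Definition ex_sumZ (a : Z -> R) : Prop :=
  ex_series (fun k : nat => a (Z.of_nat k)) /\
  ex_series (fun k : nat => a (- Z.of_nat (S k))%Z).

Definition sumZ (a : Z -> R) : R :=
  Series (fun k : nat => a (Z.of_nat k)) +
  Series (fun k : nat => a (- Z.of_nat (S k))%Z).

(** * Distributions on S^1 and the Sobolev spaces H^s(S^1)

    A distribution on the circle is represented by the family of its Fourier
    coefficients, [u n] being the coefficient of e^{i n theta}.  L^2(S^1) is
    H^0, with the normalized measure d theta / (2 pi), for which the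
    e^{i n theta} form an orthonormal basis. *)

Definition distr : Type := Z -> C.

Definition distr0 : distr := fun _ => RtoC 0.

Definition expi (n : Z) : distr :=
  fun m => if Z.eq_dec m n then RtoC 1 else RtoC 0.

Definition Hs_term (s : R) (u : distr) (n : Z) : R :=
  Rpower (1 + IZR n ^ 2) s * Cmod (u n) ^ 2.

Definition in_Hs (s : R) (u : distr) : Prop := ex_sumZ (Hs_term s u).

Definition Hs_dist2 (s : R) (u w : distr) : R :=
  sumZ (Hs_term s (fun n => (u n - w n)%C)).

Definition cvg_Hs (s : R) (f : R -> distr) (F : (R -> Prop) -> Prop)
    (u : distr) : Prop :=
  in_Hs s u /\ F (fun x => in_Hs s (f x)) /\
  filterlim (fun x => Hs_dist2 s (f x) u) F (locally 0).

Definition fourier (g : R -> C) : distr := fun n =>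
  let h theta :=
    Cmult (g theta) (cos (IZR n * theta), - sin (IZR n * theta)) in
  (RInt (fun theta => Re (h theta)) 0 (2 * PI) / (2 * PI),
   RInt (fun theta => Im (h theta)) 0 (2 * PI) / (2 * PI)).

(** * The magnetic Laplacian (D - A)^2 with D = - i grad and
      A = b (- y dx + x dy) *)

Definition DeriveC (g : R -> C) (x : R) : C :=
  (Derive (fun z => Re (g z)) x, Derive (fun z => Im (g z)) x).

Definition DmA1 (b : R) (v : R -> R -> C) (x y : R) : C :=
  (- Ci * DeriveC (fun z => v z y) x - RtoC (- b * y) * v x y)%C.

Definition DmA2 (b : R) (v : R -> R -> C) (x y : R) : C :=
  (- Ci * DeriveC (fun z => v x z) y - RtoC (b * x) * v x y)%C.

Definition mag_laplacian (b : R) (v : R -> R -> C) (x y : R) : C :=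
  (DmA1 b (DmA1 b v) x y + DmA2 b (DmA2 b v) x y)%C.

Definition in_disk (x y : R) : Prop := x ^ 2 + y ^ 2 < 1.

Definition C2_disk (v : R -> R -> C) : Prop :=
  forall x y, in_disk x y ->
    ex_diff_n (fun x y => Re (v x y)) 2 x y /\
    ex_diff_n (fun x y => Im (v x y)) 2 x y.

(** * The magnetic Dirichlet-to-Neumann operator *)

Definition on_circle (v : R -> R -> C) (r theta : R) : C :=
  v (r * cos theta) (r * sin theta).

Definition radial_deriv (v : R -> R -> C) (r theta : R) : C :=
  DeriveC (fun rho => on_circle v rho theta) r.

(** [DN b] is the graph of Lambda(b) : H^{1/2} -> H^{-1/2}.  By interior
    elliptic regularity the solution v is smooth in the open disk; the
    boundary value and the weak normal derivative are the limits, in H^{1/2}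
    and H^{-1/2} respectively, of the traces on the circles of radius
    r -> 1-. *)
Definition DN (b : R) (Psi Phi : distr) : Prop :=
  exists v : R -> R -> C,
    C2_disk v /\
    (forall x y, in_disk x y -> mag_laplacian b v x y = RtoC 0) /\
    cvg_Hs (1 / 2) (fun r => fourier (on_circle v r)) (at_left 1) Psi /\
    cvg_Hs (- (1 / 2)) (fun r => fourier (radial_deriv v r)) (at_left 1) Phi.

(** * Heat semigroup of an operator on L^2(S^1) given by its graph *)

(** u is continuous on [0, +oo) and differentiable on (0, +oo) with values in
    L^2(S^1), u(0) = Psi, and for t > 0, u(t) lies in the domain of the part
    of Lam in L^2(S^1) and u'(t) = - Lam u(t).  (Continuity at t > 0 follows
    from differentiability.) *)
Definition heat_flow (Lam : distr -> distr -> Prop) (Psi : distr)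
    (u : R -> distr) : Prop :=
  (forall n, u 0 n = Psi n) /\
  (forall t, 0 <= t -> in_Hs 0 (u t)) /\
  cvg_Hs 0 u (at_right 0) Psi /\
  (forall t, 0 < t -> exists Phi : distr,
     Lam (u t) Phi /\
     cvg_Hs 0 (fun s n => ((u s n - u t n) / RtoC (s - t))%C)
       (locally' t) (fun n => (- Phi n)%C)).

(** e^{- t Lam}, for t >= 0; the choice is harmless when the heat flow of Lam
    is unique, e.g. for Lam self-adjoint and bounded below. *)
Definition exp_op (Lam : distr -> distr -> Prop) (t : R) (Psi : distr)
    : distr :=
  epsilon (inhabits distr0)
    (fun Phi => exists u, heat_flow Lam Psi u /\ Phi = u t).

Definition op_sub (S T : distr -> distr) : distr -> distr :=
  fun Psi n => (S Psi n - T Psi n)%C.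

(** * Trace, computed in the orthonormal basis e^{i n theta} of L^2(S^1);
      [T (expi n) n] is the inner product < T e_n , e_n >. *)

Definition ex_trace (T : distr -> distr) : Prop :=
  ex_sumZ (fun n => Cmod (T (expi n) n)).

Definition trace (T : distr -> distr) : C :=
  (sumZ (fun n => Re (T (expi n) n)), sumZ (fun n => Im (T (expi n) n))).

(** * Special functions *)

(** (a)_k = a (a + 1) ... (a + k - 1) = Gamma (a + k) / Gamma a *)
Fixpoint pochhammer (a : R) (k : nat) : R :=
  match k with
  | O => 1
  | S j => pochhammer a j * (a + INR j)
  end.

Definition kummer (a c z : R) : R :=
  Series (fun k =>
    pochhammer a k / pochhammer c k * (z ^ k / INR (fact k))).

Definition lambda (n : nat) (b : R) : R :=
  INR n - b +
  2 * b * (Derive (fun z => kummer (1 / 2) (INR n + 1) z) b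
           / kummer (1 / 2) (INR n + 1) b).

Definition mu (n : nat) (b : R) : R :=
  INR n - b +
  2 * b * (1 / (2 * INR n) + (b - 1) / (2 * INR n ^ 2)
           + (2 * b ^ 2 - 7 * b + 2) / (4 * INR n ^ 3)).

(** The Riemann zeta function at the integers s >= 2. *)
Definition zeta (s : nat) : R := Series (fun k => 1 / INR (S k) ^ s).

(** Sums over n >= 1. *)
Definition sum_diff1 (b : R) : R :=
  Series (fun k => lambda (S k) b - mu (S k) b).

Definition sum_diff2 (b : R) : R :=
  Series (fun k => lambda (S k) b ^ 2 - mu (S k) b ^ 2).

Definition coef_t (b : R) : R :=
  (1 - PI ^ 2 / 3 + 7 * zeta 3) * b ^ 2
  - lambda 0 b - sum_diff1 b - sum_diff1 (- b).

Definition coef_t2 (b : R) : R :=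
  1 / 3780 *
    ((5670 - 2520 * PI ^ 2 + 126 * PI ^ 4 + 4 * PI ^ 6
      - 15120 * zeta 3 - 7560 * zeta 5) * b ^ 2
     + (126 * PI ^ 4 + 57 * PI ^ 6 - 7560 * zeta 3 - 34020 * zeta 5) * b ^ 4
     + 4 * PI ^ 6 * b ^ 6)
  + 1 / 2 * lambda 0 b ^ 2
  + 1 / 2 * sum_diff2 b + 1 / 2 * sum_diff2 (- b).

(* Main.v *)
Require Import Defs.
From Stdlib Require Import Reals ZArith Lra Lia Psatz FunctionalExtensionality ClassicalEpsilon.
From Coquelicot Require Import Coquelicot.
Open Scope R_scope.

(* The rotation symmetry makes Lambda(b) diagonal in the Fourier basis. If v solves the magnetic
   equation and f is a radial solution of mode m, regular at 0, the Wronskian of f and of the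
   m-th Fourier mode of v is constant (its derivative integrates a theta-derivative over the
   circle) and vanishes as r -> 0; letting r -> 1 gives the eigenvalue f'(1) / f(1), and each
   heat flow is then forced coefficient by coefficient.

   For the trace, replace lambda_n by mu_n: the Taylor terms in t and t^2 of the exponentials
   give the two convergent series, with a remainder O(|b| t^3 / n^2) as
   lambda_n - mu_n = O(|b| / n^4). Write mu_n(+-b) = n +- o + e with o odd and e even in b,
   e = O(b^2 / n^2). In exp(-t mu_n(b)) + exp(-t mu_n(-b)) - 2 exp(-t n) the cubic Taylor term
   is then summable, so that only polylogarithms Li_j(exp(-t)), j = 0, ..., 6, remain; the t^2 log t
   terms of Li_1 and Li_2 cancel, and those of Li_2 and Li_3 give - b^2 / 2 t^3 log t. *)


(** * Kummer's function *)

(** Two definitions shape the argument. [DN] controls a solution only through limits of its traces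
    on circles, so nothing may be differentiated up to the boundary: every identity is established
    on a circle of radius [r < 1], and only scalar equalities between Fourier coefficients pass to
    the limit. [exp_op] picks an arbitrary heat flow, so two facts are needed: all flows agree,
    which uses the eigenvalue relation for every pair in the graph, and one flow starts from each
    [expi m], which uses single modes only.

    In the trace, the Taylor expansion of [exp (- t * mu)] around [exp (- t * n)] has to be carried
    through order three, because the sum over n of [t ^ 4 * exp (- t * n)] is already of size
    [t ^ 3]. The factor [Rabs b] in the error survives because each estimate keeps it:
    [lambda n b - mu n b] has the prefactor [2 * b], [lambda 0 b] the prefactor [b], and both parts
    of [mu n b - n] vanish with [b]. The powers of pi in the coefficients are zeta(2), zeta(4) and
    zeta(6), so these values have to be computed; zeta(3) and zeta(5) stay as they are. *)

Definition kummer_coef (a c : R) (k : nat) : R :=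
  pochhammer a k / pochhammer c k / INR (fact k).

Lemma pochhammer_pos (a : R) (k : nat) : 0 < a -> 0 < pochhammer a k.
Proof.
intros ha; induction k as [|k IH]; simpl; [lra|].
apply Rmult_lt_0_compat; [assumption|]. pose proof (pos_INR k); lra.
Qed.

Lemma kummer_coef_pos (a c : R) (k : nat) : 0 < a -> 0 < c -> 0 < kummer_coef a c k.
Proof.
intros ha hc; unfold kummer_coef.
apply Rdiv_lt_0_compat; [apply Rdiv_lt_0_compat|]; try (apply pochhammer_pos; lra).
apply INR_fact_lt_0.
Qed.

(** This two-term recurrence is Kummer's equation read coefficient by coefficient. *)
Lemma kummer_coef_S (a c : R) (k : nat) : 0 < c ->
  kummer_coef a c (S k) * (INR k + 1) * (c + INR k) = kummer_coef a c k * (a + INR k).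
Proof.
intros hc; unfold kummer_coef; simpl pochhammer.
rewrite fact_simpl, mult_INR, S_INR.
pose proof (pochhammer_pos c k hc); pose proof (INR_fact_lt_0 k); pose proof (pos_INR k).
field; repeat split; lra.
Qed.

Lemma kummer_PSeries (a c z : R) : kummer a c z = PSeries (kummer_coef a c) z.
Proof.
unfold kummer, PSeries; apply Series_ext; intros k; unfold kummer_coef, Rdiv; ring.
Qed.

Lemma CV_radius_kummer (a c : R) : 0 < a -> 0 < c -> CV_radius (kummer_coef a c) = p_infty.
Proof.
intros ha hc; apply CV_radius_infinite_DAlembert.
- intros n; pose proof (kummer_coef_pos a c n ha hc); lra.
(* The ratio of consecutive coefficients is [(a + n) / ((c + n) * (n + 1))], and [(a + n) / (c + n)]
   stays below [1 + a / c] whichever of [a] and [c] is larger. *)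
- apply is_lim_seq_le_le with (u := fun _ => 0) (w := fun n => (1 + a / c) * / INR (S n)).
  + intros n; split; [apply Rabs_pos|].
    pose proof (kummer_coef_pos a c n ha hc); pose proof (kummer_coef_pos a c (S n) ha hc).
    pose proof (kummer_coef_S a c n hc) as E; pose proof (pos_INR n).
    rewrite Rabs_pos_eq by (apply Rlt_le, Rdiv_lt_0_compat; lra).
    rewrite S_INR.
    replace (kummer_coef a c (S n) / kummer_coef a c n)
      with ((a + INR n) / (c + INR n) * / (INR n + 1)).
    * apply Rmult_le_compat_r; [left; apply Rinv_0_lt_compat; lra|].
      apply Rle_div_l; [lra|].
      replace ((1 + a / c) * (c + INR n)) with (a + INR n + (c + a / c * INR n)) by (field; lra).
      assert (0 <= a / c * INR n) by (apply Rmult_le_pos; [left; apply Rdiv_lt_0_compat|]; lra).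
      lra.
    * apply Rmult_eq_reg_r with (kummer_coef a c n * (INR n + 1) * (c + INR n)).
      2: assert (0 < kummer_coef a c n * (INR n + 1) * (c + INR n)) by (apply Rmult_lt_0_compat; [apply Rmult_lt_0_compat|]; lra); lra.
      transitivity (kummer_coef a c n * (a + INR n)); [|rewrite <- E]; field; lra.
  + apply is_lim_seq_const.
  + evar_last.
    * apply is_lim_seq_scal_l.
      apply (is_lim_seq_incr_1 (fun n => / INR n)).
      apply is_lim_seq_inv with (l := p_infty); [apply is_lim_seq_INR|discriminate].
    * simpl; f_equal; ring.
Qed.

Definition kummer1 (a c z : R) : R := PSeries (PS_derive (kummer_coef a c)) z.
Definition kummer2 (a c z : R) : R := PSeries (PS_derive (PS_derive (kummer_coef a c))) z.

Lemma is_derive_kummer (a c z : R) : 0 < a -> 0 < c ->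
  is_derive (kummer a c) z (kummer1 a c z).
Proof.
intros ha hc; apply (is_derive_ext (PSeries (kummer_coef a c))).
- intros t; symmetry; apply kummer_PSeries.
- apply is_derive_PSeries; rewrite CV_radius_kummer; simpl; auto.
Qed.

Lemma is_derive_kummer1 (a c z : R) : 0 < a -> 0 < c ->
  is_derive (kummer1 a c) z (kummer2 a c z).
Proof.
intros ha hc; apply is_derive_PSeries.
rewrite CV_radius_derive, CV_radius_kummer; simpl; auto.
Qed.

Lemma ex_pseries_infinite (u : nat -> R) (z : R) : CV_radius u = p_infty -> ex_pseries u z.
Proof. intros h; apply CV_radius_inside; rewrite h; simpl; auto. Qed.

Lemma continuous_kummer2 (a c z : R) : 0 < a -> 0 < c -> continuous (kummer2 a c) z.
Proof.
intros ha hc; apply (ex_derive_continuous (kummer2 a c) z).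
eexists; apply is_derive_PSeries.
rewrite !CV_radius_derive, CV_radius_kummer; simpl; auto.
Qed.

(** Multiplication by [z] is the shift [PS_incr_1], so each coefficient of the equation is one
    instance of [kummer_coef_S]. Index 0 is treated apart because the shift puts a zero there. *)
Lemma kummer_ode (a c z : R) : 0 < a -> 0 < c ->
  z * kummer2 a c z + (c - z) * kummer1 a c z = a * kummer a c z.
Proof.
intros ha hc; rewrite kummer_PSeries; unfold kummer2, kummer1.
set (m := kummer_coef a c).
assert (h0 : CV_radius m = p_infty) by (apply CV_radius_kummer; auto).
assert (h1 : CV_radius (PS_derive m) = p_infty) by (rewrite CV_radius_derive; auto).
assert (h2 : CV_radius (PS_derive (PS_derive m)) = p_infty) by (rewrite CV_radius_derive; auto).
rewrite Rmult_minus_distr_r.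
rewrite <- !PSeries_incr_1, <- !PSeries_scal.
unfold Rminus; rewrite <- Rplus_assoc, Rplus_comm, <- Rplus_assoc.
rewrite <- PSeries_opp.
assert (i1 : ex_pseries (PS_incr_1 (PS_derive m)) z) by (apply ex_pseries_incr_1, ex_pseries_infinite, h1).
assert (i2 : ex_pseries (PS_incr_1 (PS_derive (PS_derive m))) z) by (apply ex_pseries_incr_1, ex_pseries_infinite, h2).
assert (i3 : ex_pseries (PS_scal c (PS_derive m)) z).
{ apply ex_pseries_scal; [apply Rmult_comm|apply ex_pseries_infinite, h1]. }
rewrite <- PSeries_plus; [|apply ex_pseries_opp, i1|apply i2].
rewrite <- PSeries_plus; [|apply ex_pseries_plus; [apply ex_pseries_opp, i1|apply i2]|apply i3].
apply PSeries_ext; intros k.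
unfold PS_plus, PS_opp, PS_scal, PS_incr_1, PS_derive, plus, opp, scal, mult; simpl.
unfold mult; simpl.
destruct k as [|k]; unfold zero; simpl.
- pose proof (kummer_coef_S a c 0 hc) as E; simpl in E; fold m in E. lra.
- pose proof (kummer_coef_S a c (S k) hc) as E; rewrite S_INR in E; fold m in E.
  rewrite Rmult_assoc in E. fold (INR (S k)). 
  assert (E2 : forall j, INR (S j) = INR j + 1) by apply S_INR.
  simpl in E2. rewrite !E2. nra.
Qed.

(** * Radial solutions regular at the origin *)

Ltac split_all := repeat match goal with |- _ /\ _ => split end.

Lemma derive_nonneg_le (f df : R -> R) (a b : R) : a <= b ->
  (forall x, a <= x <= b -> is_derive f x (df x)) ->
  (forall x, a < x < b -> 0 <= df x) -> f a <= f b.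
Proof.
intros hab hd hp.
destruct (Req_dec a b) as [->|hne]; [lra|].
destruct (MVT_cor2 f df a b) as [c [hc hc']]; [lra| |].
- intros c hc; apply is_derive_Reals, hd, hc.
- pose proof (hp c hc'); nra.
Qed.

Lemma INR_S_pos (N : nat) : 0 < INR N + 1.
Proof. pose proof (pos_INR N); lra. Qed.

(** The non-polynomial factor of the radial solution, as a function of [s = r ^ 2]. Being smooth in
    [s] on the whole line, it composes with [x ^ 2 + y ^ 2] without any singularity at the
    origin. *)
Definition radial (b : R) (N : nat) (s : R) : R :=
  exp (- b * s / 2) * kummer (1 / 2) (INR N + 1) (b * s).
Definition radial1 (b : R) (N : nat) (s : R) : R :=
  exp (- b * s / 2) * (- b / 2 * kummer (1 / 2) (INR N + 1) (b * s)
                       + b * kummer1 (1 / 2) (INR N + 1) (b * s)).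
Definition radial2 (b : R) (N : nat) (s : R) : R :=
  exp (- b * s / 2) * (b ^ 2 / 4 * kummer (1 / 2) (INR N + 1) (b * s)
                       - b ^ 2 * kummer1 (1 / 2) (INR N + 1) (b * s)
                       + b ^ 2 * kummer2 (1 / 2) (INR N + 1) (b * s)).

Lemma is_derive_kummer_lin (b : R) (N : nat) (s : R) :
  is_derive (fun s => kummer (1 / 2) (INR N + 1) (b * s)) s
    (b * kummer1 (1 / 2) (INR N + 1) (b * s)).
Proof.
pose proof (INR_S_pos N).
evar_last.
- apply (is_derive_comp (kummer (1/2) (INR N + 1)) (fun s => b * s)).
  + apply is_derive_kummer; lra.
  + apply (is_derive_scal (fun s => s)), is_derive_id.
- unfold scal, one; simpl; unfold mult; simpl; ring.
Qed.

Lemma is_derive_kummer1_lin (b : R) (N : nat) (s : R) :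
  is_derive (fun s => kummer1 (1 / 2) (INR N + 1) (b * s)) s
    (b * kummer2 (1 / 2) (INR N + 1) (b * s)).
Proof.
pose proof (INR_S_pos N).
evar_last.
- apply (is_derive_comp (kummer1 (1/2) (INR N + 1)) (fun s => b * s)).
  + apply is_derive_kummer1; lra.
  + apply (is_derive_scal (fun s => s)), is_derive_id.
- unfold scal, one; simpl; unfold mult; simpl; ring.
Qed.

Lemma is_derive_radial (b : R) (N : nat) (s : R) :
  is_derive (radial b N) s (radial1 b N s).
Proof.
pose proof (is_derive_kummer_lin b N s) as D.
unfold radial, radial1.
evar_last.
- apply (is_derive_mult (fun s => exp (- b * s / 2))); [|apply D|apply Rmult_comm].
  auto_derive; [auto|reflexivity].
- unfold plus, mult; simpl. unfold Rdiv. ring.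
Qed.

Lemma is_derive_radial1 (b : R) (N : nat) (s : R) :
  is_derive (radial1 b N) s (radial2 b N s).
Proof.
pose proof (is_derive_kummer_lin b N s) as D.
pose proof (is_derive_kummer1_lin b N s) as D1.
unfold radial1, radial2.
evar_last.
- apply (is_derive_mult (fun s => exp (- b * s / 2))); [| |apply Rmult_comm].
  + auto_derive; [auto|reflexivity].
  + apply (is_derive_plus (fun s => - b / 2 * kummer (1 / 2) (INR N + 1) (b * s))).
    * apply is_derive_scal, D.
    * apply is_derive_scal, D1.
- unfold plus, mult; simpl. change (- b * s * / 2) with (- b * s / 2); generalize (exp (- b * s / 2)); intros; field.
Qed.

Lemma continuous_radial2 (b : R) (N : nat) (s : R) : continuous (radial2 b N) s.
Proof.
pose proof (INR_S_pos N).
assert (cl : continuous (fun s => b * s) s) by (apply (ex_derive_continuous (fun s => b * s)); auto_derive; auto).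
unfold radial2.
apply (continuous_mult (fun s => exp (- b * s / 2))).
- apply (ex_derive_continuous (fun s => exp (- b * s / 2))); auto_derive; auto.
- apply (continuous_plus (fun s => b ^ 2 / 4 * kummer (1 / 2) (INR N + 1) (b * s)
      - b ^ 2 * kummer1 (1 / 2) (INR N + 1) (b * s))).
  + apply (ex_derive_continuous (fun s => b ^ 2 / 4 * kummer (1 / 2) (INR N + 1) (b * s)
      - b ^ 2 * kummer1 (1 / 2) (INR N + 1) (b * s))).
    apply (ex_derive_minus (fun s => b ^ 2 / 4 * kummer (1 / 2) (INR N + 1) (b * s)));
      apply ex_derive_scal; eexists; [apply is_derive_kummer_lin|apply is_derive_kummer1_lin].
  + apply (continuous_mult (fun _ => b ^ 2)); [apply continuous_const|].
    apply (continuous_comp (fun s => b * s)); [apply cl|apply continuous_kummer2; lra].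
Qed.

(* With [f r = r ^ N * radial b N (r ^ 2)] this is [f'' + f' / r = (N / r - b r) ^ 2 f]. *)
Lemma radial_ode (b : R) (N : nat) (s : R) :
  4 * s * radial2 b N s + 4 * (INR N + 1) * radial1 b N s
  = (b ^ 2 * s - 2 * INR N * b) * radial b N s.
Proof.
pose proof (INR_S_pos N).
pose proof (kummer_ode (1/2) (INR N + 1) (b * s) ltac:(lra) ltac:(lra)) as E.
unfold radial2, radial1, radial.
set (K2 := kummer2 _ _ _) in *; set (K1 := kummer1 _ _ _) in *; set (K := kummer _ _ _) in *.
set (e := exp _).
assert (E' : b * s * K2 = 1/2 * K - (INR N + 1 - b * s) * K1) by lra; clear E.
assert (E2 : s * b ^ 2 * K2 = b * (1/2 * K - (INR N + 1 - b * s) * K1)) by (rewrite <- E'; ring).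
transitivity (e * (4 * s * (b ^ 2 / 4 * K - b ^ 2 * K1) + 4 * (s * b ^ 2 * K2)
  + 4 * (INR N + 1) * (- b / 2 * K + b * K1))); [field|].
rewrite E2; field.
Qed.

Lemma kummer_0 (a c : R) : kummer a c 0 = 1.
Proof. rewrite kummer_PSeries, PSeries_0; unfold kummer_coef; simpl; field. Qed.

Lemma radial_0 (b : R) (N : nat) : radial b N 0 = 1.
Proof.
unfold radial; replace (- b * 0 / 2) with 0 by field.
rewrite exp_0, Rmult_0_r, kummer_0; ring.
Qed.

(* With [h = radial b N], [s^N h^2] and [s (s^N h^2)'] both increase on [s > 0], as
   [s (s (s^N h^2)')'] is a sum of squares. *)
Lemma radial_neq_0 (b : R) (N : nat) (s : R) : 0 < s -> radial b N s <> 0.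
Proof.
intros hs h0.
set (h := radial b N) in *; set (h1 := radial1 b N); set (h2 := radial2 b N).
assert (dh : forall x, is_derive h x (h1 x)) by (intros; apply is_derive_radial).
assert (dh1 : forall x, is_derive h1 x (h2 x)) by (intros; apply is_derive_radial1).
assert (ode : forall y, 4 * y * h2 y + 4 * (INR N + 1) * h1 y = (b ^ 2 * y - 2 * INR N * b) * h y)
  by apply radial_ode.
assert (h00 : h 0 = 1) by apply radial_0.
clearbody h h1 h2.
set (n := INR N).
set (w := fun x => x ^ N * (n * h x ^ 2 + 2 * x * h x * h1 x)).
assert (hw : forall x, 0 < x -> 0 <= w x).
{ intros x hx.
  replace 0 with (w 0) by (unfold w, n; destruct N; simpl; ring).
  apply derive_nonneg_le with
    (df := fun x => n * x ^ pred N * (n * h x ^ 2 + 2 * x * h x * h1 x)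
       + x ^ N * (2 * n * h x * h1 x + 2 * h x * h1 x + 2 * x * h1 x ^ 2 + 2 * x * h x * h2 x)).
  - lra.
  - intros y _; unfold w.
    auto_derive.
    + split_all; auto; match goal with |- ex_derive (fun x => h x) _ => eexists; apply dh | |- ex_derive (fun x => h1 x) _ => eexists; apply dh1 end.
    + rewrite (is_derive_unique (fun x : R => h x) _ _ (dh y)), (is_derive_unique (fun x : R => h1 x) _ _ (dh1 y)); unfold n; ring.
  - intros y hy.
    assert (E : y * (n * y ^ pred N) = n * y ^ N) by (unfold n; destruct N; simpl; ring).
    pose proof (ode y) as O; fold n in O.
    apply Rmult_le_reg_l with y; [lra|].
    rewrite Rmult_0_r, Rmult_plus_distr_l.
    rewrite <- (Rmult_assoc y (n * _)), E.
    replace (n * y ^ N * (n * h y ^ 2 + 2 * y * h y * h1 y) +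
      y * (y ^ N * (2 * n * h y * h1 y + 2 * h y * h1 y + 2 * y * h1 y ^ 2 + 2 * y * h y * h2 y)))
    with (y ^ N * (n * (n * h y ^ 2 + 2 * y * h y * h1 y) + y *
      (2 * n * h y * h1 y + 2 * h y * h1 y + 2 * y * h1 y ^ 2)
      + y / 2 * h y * ((4 * y * h2 y + 4 * (n + 1) * h1 y) - 4 * (n + 1) * h1 y))) by field.
    rewrite O.
    apply Rmult_le_pos; [apply pow_le; lra|].
    apply Rle_trans with (/2 * (n * h y + 2 * y * h1 y) ^ 2 + /2 * ((n - b * y) * h y) ^ 2); [pose proof (pow2_ge_0 (n * h y + 2 * y * h1 y)); pose proof (pow2_ge_0 ((n - b * y) * h y)); lra|].
    right; field. }
set (q := fun x => x ^ N * h x ^ 2).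
assert (hq : forall x, 0 < x <= s -> h x = 0).
{ intros x hx.
  assert (Q : q x <= q s).
  { apply derive_nonneg_le with (df := fun x => w x / x); [lra| |].
    - intros y hy; unfold q, w; auto_derive.
      + split_all; auto; eexists; apply dh.
      + rewrite (is_derive_unique (fun x : R => h x) _ _ (dh y)); unfold n.
        destruct N; simpl; field; lra.
    - intros y hy; apply Rmult_le_pos; [apply hw; lra|left; apply Rinv_0_lt_compat; lra]. }
  unfold q in Q; rewrite h0 in Q.
  assert (0 < x ^ N) by (apply pow_lt; lra).
  assert (h x ^ 2 <= 0) by nra. nra. }
(* By monotonicity a zero at [s] forces [h] to vanish on all of [(0, s]], against continuity and
   [h 0 = 1]. *)
assert (C : continuous h 0) by (apply (ex_derive_continuous h); eexists; apply dh).
destruct (proj1 (filterlim_locally _ _) C (mkposreal (1/2) ltac:(lra))) as [d hd].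
set (x := Rmin (d / 2) s).
assert (hx : 0 < x <= s /\ x <= d / 2).
{ unfold x; pose proof (cond_pos d); split; [split|]; [apply Rmin_glb_lt; lra|apply Rmin_r|apply Rmin_l]. }
specialize (hd x).
assert (Rabs (h x - h 0) < 1 / 2) as K.
{ apply hd. unfold ball; simpl; unfold AbsRing_ball, abs, minus, plus, opp; simpl.
  pose proof (cond_pos d); rewrite Ropp_0, Rplus_0_r, Rabs_pos_eq; lra. }
rewrite hq in K by tauto. rewrite h00 in K.
rewrite Rabs_left in K; lra.
Qed.

(** For negative [z] the series alternates and positive coefficients say nothing. The radial
    solution in the field [b = z], taken at [s = 1], is a nonzero multiple of the value in
    question. *)
Lemma kummer_neq_0 (N : nat) (z : R) : kummer (1 / 2) (INR N + 1) z <> 0.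
Proof.
intros E; apply (radial_neq_0 z N 1); [lra|].
unfold radial; rewrite !Rmult_1_r, E; ring.
Qed.

Lemma lambda_kummer (N : nat) (b : R) :
  lambda N b = INR N - b + 2 * b * (kummer1 (1 / 2) (INR N + 1) b / kummer (1 / 2) (INR N + 1) b).
Proof.
pose proof (INR_S_pos N).
unfold lambda; do 3 f_equal.
rewrite (Derive_ext _ (kummer (1 / 2) (INR N + 1))) by reflexivity.
apply is_derive_unique, is_derive_kummer; lra.
Qed.

(** The right-hand side is the derivative at [r = 1] of [r ^ N * radial b N (r ^ 2)]: thus
    [lambda N b] is the logarithmic derivative of the radial solution on the boundary. *)
Lemma lambda_radial (N : nat) (b : R) :
  lambda N b * radial b N 1 = INR N * radial b N 1 + 2 * radial1 b N 1.
Proof.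
rewrite lambda_kummer; unfold radial, radial1; rewrite !Rmult_1_r.
pose proof (kummer_neq_0 N b). field. assumption.
Qed.

(** * Polar coordinates in the disk *)

(** The partial derivatives are explicit arguments rather than [Derive] terms, so that sums and
    products can be differentiated by formula. A function of class C^2 is described by three
    instances, one for it and one for each partial derivative. *)
Definition C1_disk (u ux uy : R -> R -> R) : Prop :=
  forall x y, in_disk x y ->
    is_derive (fun z => u z y) x (ux x y) /\ is_derive (fun z => u x z) y (uy x y) /\
    continuity_2d_pt ux x y /\ continuity_2d_pt uy x y.

Lemma in_disk_open (x y : R) : in_disk x y -> locally_2d in_disk x y.
Proof.
intros h.
assert (C : continuity_2d_pt (fun x y => x * x + y * y) x y).
{ apply continuity_2d_pt_plus; apply continuity_2d_pt_mult;
  (apply continuity_2d_pt_id1 || apply continuity_2d_pt_id2). }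
unfold in_disk in *.
assert (he : 0 < 1 - (x ^ 2 + y ^ 2)) by lra.
destruct (C (mkposreal _ he)) as [d hd]; exists d; intros u w hu hw.
specialize (hd u w hu hw); simpl in hd.
apply Rabs_lt_between in hd; lra.
Qed.

Lemma in_disk_polar (r th : R) : Rabs r < 1 -> in_disk (r * cos th) (r * sin th).
Proof.
intros hr; unfold in_disk.
replace ((r * cos th) ^ 2 + (r * sin th) ^ 2) with (r ^ 2 * ((sin th)² + (cos th)²))
  by (unfold Rsqr; ring).
rewrite sin2_cos2, Rmult_1_r.
rewrite <- (pow2_abs r); pose proof (Rabs_pos r); simpl; nra.
Qed.

Lemma C1_disk_differentiable (u ux uy : R -> R -> R) (x y : R) : C1_disk u ux uy ->
  in_disk x y -> differentiable_pt_lim u x y (ux x y) (uy x y).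
Proof.
intros hu hxy.
apply filterdiff_differentiable_pt_lim.
apply (is_derive_filterdiff u x y ux (uy x y)).
- apply (locally_2d_locally (fun a c => is_derive (fun z => u z c) a (ux a c))).
  apply (locally_2d_impl in_disk); [apply locally_2d_forall|apply in_disk_open, hxy].
  intros a c h; apply hu, h.
- apply hu, hxy.
- apply (proj1 (continuity_2d_pt_filterlim ux x y)), hu, hxy.
Qed.

Lemma continuity_2d_pt_comp (u a b : R -> R -> R) (x y : R) :
  continuity_2d_pt u (a x y) (b x y) -> continuity_2d_pt a x y -> continuity_2d_pt b x y ->
  continuity_2d_pt (fun x y => u (a x y) (b x y)) x y.
Proof.
intros hu ha hb e.
destruct (hu e) as [d hd].
apply (locally_2d_impl_strong (fun s t => Rabs (a s t - a x y) < d /\ Rabs (b s t - b x y) < d)).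
- apply locally_2d_forall; intros s t h; apply locally_2d_singleton in h.
  apply hd; apply h.
- apply locally_2d_and; [apply ha|apply hb].
Qed.

Lemma continuity_2d_pt_fst (f : R -> R) (x y : R) : continuous f x ->
  continuity_2d_pt (fun x _ => f x) x y.
Proof.
intros h; apply (continuity_1d_2d_pt_comp f (fun x _ => x)); [|apply continuity_2d_pt_id1].
apply continuity_pt_filterlim, h.
Qed.

Lemma continuity_2d_pt_snd (f : R -> R) (x y : R) : continuous f y ->
  continuity_2d_pt (fun _ y => f y) x y.
Proof.
intros h; apply (continuity_1d_2d_pt_comp f (fun _ y => y)); [|apply continuity_2d_pt_id2].
apply continuity_pt_filterlim, h.
Qed.

Lemma continuity_2d_pt_continuous (u : R -> R -> R) (x y : R) : continuity_2d_pt u x y ->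
  continuous (fun z => u x z) y.
Proof.
intros h; apply filterlim_locally; intros e.
destruct (h e) as [d hd]; exists d; intros z hz.
apply hd; [|apply hz]. rewrite Rminus_diag, Rabs_R0; apply cond_pos.
Qed.

Definition polar (u : R -> R -> R) (r th : R) : R := u (r * cos th) (r * sin th).

Lemma continuity_2d_pt_polar (u : R -> R -> R) (r th : R) :
  continuity_2d_pt u (r * cos th) (r * sin th) -> continuity_2d_pt (polar u) r th.
Proof.
intros h; apply (continuity_2d_pt_comp u (fun r th => r * cos th) (fun r th => r * sin th)); auto;
  (apply continuity_2d_pt_mult; [apply continuity_2d_pt_id1|apply continuity_2d_pt_snd]).
- apply (ex_derive_continuous cos); auto_derive; auto.
- apply (ex_derive_continuous sin); auto_derive; auto.
Qed.

Lemma is_derive_polar_r (u ux uy : R -> R -> R) (r th : R) : C1_disk u ux uy -> Rabs r < 1 ->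
  is_derive (fun r => polar u r th) r (polar ux r th * cos th + polar uy r th * sin th).
Proof.
intros hu hr; apply is_derive_Reals.
apply (derivable_pt_lim_comp_2d u (fun r => r * cos th) (fun r => r * sin th)).
- apply (C1_disk_differentiable u ux uy (r * cos th) (r * sin th)); [|apply in_disk_polar]; auto.
- apply is_derive_Reals; auto_derive; auto; ring.
- apply is_derive_Reals; auto_derive; auto; ring.
Qed.

Lemma is_derive_polar_th (u ux uy : R -> R -> R) (r th : R) : C1_disk u ux uy -> Rabs r < 1 ->
  is_derive (fun th => polar u r th) th
    (polar ux r th * (- (r * sin th)) + polar uy r th * (r * cos th)).
Proof.
intros hu hr; apply is_derive_Reals.
apply (derivable_pt_lim_comp_2d u (fun th => r * cos th) (fun th => r * sin th)).
- apply (C1_disk_differentiable u ux uy (r * cos th) (r * sin th)); [|apply in_disk_polar]; auto.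
- apply is_derive_Reals; auto_derive; auto; ring.
- apply is_derive_Reals; auto_derive; auto; ring.
Qed.

Lemma C1_disk_continuity (u ux uy : R -> R -> R) (r th : R) : C1_disk u ux uy -> Rabs r < 1 ->
  continuity_2d_pt (polar u) r th.
Proof.
intros hu hr; apply continuity_2d_pt_polar.
apply differentiable_continuity_pt; eexists; eexists.
apply C1_disk_differentiable with (1 := hu), in_disk_polar, hr.
Qed.

Lemma C1_disk_continuity_dx (u ux uy : R -> R -> R) (r th : R) : C1_disk u ux uy -> Rabs r < 1 ->
  continuity_2d_pt (polar ux) r th.
Proof. intros hu hr; apply continuity_2d_pt_polar, hu, in_disk_polar, hr. Qed.

Lemma C1_disk_continuity_dy (u ux uy : R -> R -> R) (r th : R) : C1_disk u ux uy -> Rabs r < 1 ->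
  continuity_2d_pt (polar uy) r th.
Proof. intros hu hr; apply continuity_2d_pt_polar, hu, in_disk_polar, hr. Qed.

(** * Fourier modes of solutions *)

Lemma derive_0_eq (f : R -> R) (a b : R) : a <= b ->
  (forall x, a <= x <= b -> is_derive f x 0) -> f a = f b.
Proof.
intros hab hd; apply Rle_antisym.
- apply derive_nonneg_le with (df := fun _ => 0); auto; intros; lra.
- cut (- f a <= - f b); [lra|].
  apply (derive_nonneg_le (fun x => - f x) (fun _ => - 0)); [auto| |intros; lra].
  intros x hx; apply (is_derive_opp f), hd, hx.
Qed.

Lemma cos_2PI_Z (m : Z) : cos (IZR m * (2 * PI)) = 1.
Proof.
destruct m as [|p|p]; simpl; [rewrite Rmult_0_l; apply cos_0| |].
- rewrite <- (Rplus_0_l (_ * _)), <- (positive_nat_Z p), <- INR_IZR_INZ.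
  replace (0 + INR (Pos.to_nat p) * (2 * PI)) with (0 + 2 * INR (Pos.to_nat p) * PI) by ring.
  rewrite cos_period; apply cos_0.
- rewrite <- cos_neg, <- (Rplus_0_l (- _)).
  change (IZR (Z.neg p)) with (- IZR (Z.pos p)).
  rewrite <- (positive_nat_Z p), <- INR_IZR_INZ.
  replace (0 + - (- INR (Pos.to_nat p) * (2 * PI))) with (0 + 2 * INR (Pos.to_nat p) * PI) by ring.
  rewrite cos_period; apply cos_0.
Qed.

Lemma sin_2PI_Z (m : Z) : sin (IZR m * (2 * PI)) = 0.
Proof.
pose proof (cos_2PI_Z m) as E; pose proof (sin2_cos2 (IZR m * (2 * PI))) as P.
rewrite E in P; unfold Rsqr in P; nra.
Qed.

(** For [v = v1 + i v2] this is the real part of [r (v_r f - v f') e^{- i m theta}]. The factor [r]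
    puts the radial operator in divergence form, and it also makes the integral vanish at the
    origin. *)
Definition wronskian_integrand (m : Z) (f f1 : R -> R) (v1 v1x v1y v2 v2x v2y : R -> R -> R)
    (r th : R) : R :=
  r * (((polar v1x r th * cos th + polar v1y r th * sin th) * f r - polar v1 r th * f1 r)
         * cos (IZR m * th) +
       ((polar v2x r th * cos th + polar v2y r th * sin th) * f r - polar v2 r th * f1 r)
         * sin (IZR m * th)).

Lemma continuous_cos_lin (M x : R) : continuous (fun t => cos (M * t)) x.
Proof. apply (ex_derive_continuous (fun t => cos (M * t))); auto_derive; auto. Qed.

Lemma continuous_sin_lin (M x : R) : continuous (fun t => sin (M * t)) x.
Proof. apply (ex_derive_continuous (fun t => sin (M * t))); auto_derive; auto. Qed.

Ltac cont2d_step :=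
  lazymatch goal with
  | |- continuity_2d_pt (fun x y => @?a x y + @?b x y) _ _ => apply (continuity_2d_pt_plus a b)
  | |- continuity_2d_pt (fun x y => @?a x y - @?b x y) _ _ => apply (continuity_2d_pt_minus a b)
  | |- continuity_2d_pt (fun x y => @?a x y * @?b x y) _ _ => apply (continuity_2d_pt_mult a b)
  | |- continuity_2d_pt (fun x y => polar ?u x y) _ _ => fail
  | |- continuity_2d_pt (fun x y => cos (?M * y)) _ _ =>
      apply (continuity_2d_pt_snd (fun y => cos (M * y))), continuous_cos_lin
  | |- continuity_2d_pt (fun x y => sin (?M * y)) _ _ =>
      apply (continuity_2d_pt_snd (fun y => sin (M * y))), continuous_sin_lin
  | |- continuity_2d_pt (fun x y => cos y) _ _ => apply (continuity_2d_pt_snd cos), continuous_cos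
  | |- continuity_2d_pt (fun x y => sin y) _ _ => apply (continuity_2d_pt_snd sin), continuous_sin
  | |- continuity_2d_pt (fun x y => x) _ _ => apply continuity_2d_pt_id1
  | |- continuity_2d_pt (fun x y => y) _ _ => apply continuity_2d_pt_id2
  | |- continuity_2d_pt (fun x y => ?f x) _ _ => apply (continuity_2d_pt_fst f); auto
  end.

Ltac cont2d_polar :=
  match goal with
  | H : C1_disk ?u ?ux ?uy |- continuity_2d_pt (fun x y => polar ?u x y) _ _ =>
      apply (C1_disk_continuity u ux uy); assumption
  | H : C1_disk ?u ?ux ?uy |- continuity_2d_pt (fun x y => polar ?ux x y) _ _ =>
      apply (C1_disk_continuity_dx u ux uy); assumption
  | H : C1_disk ?u ?ux ?uy |- continuity_2d_pt (fun x y => polar ?uy x y) _ _ =>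
      apply (C1_disk_continuity_dy u ux uy); assumption
  end.

Ltac cont2d := repeat cont2d_step; cont2d_polar.

(* On a radial solution [f] and a solution [v] of the magnetic equation, the r-derivative of the
   Wronskian of [f] and of the m-th Fourier mode of [v] is the integral of a theta-derivative. *)
Lemma wronskian_derive (b : R) (m : Z) (f f1 f2 : R -> R)
  (v1 v1x v1y v1xx v1xy v1yx v1yy v2 v2x v2y v2xx v2xy v2yx v2yy : R -> R -> R) (r : R) :
  (forall r, is_derive f r (f1 r)) -> (forall r, is_derive f1 r (f2 r)) ->
  (forall r, continuous f2 r) ->
  (forall r, r ^ 2 * f2 r + r * f1 r = (IZR m - b * r ^ 2) ^ 2 * f r) ->
  C1_disk v1 v1x v1y -> C1_disk v1x v1xx v1xy -> C1_disk v1y v1yx v1yy ->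
  C1_disk v2 v2x v2y -> C1_disk v2x v2xx v2xy -> C1_disk v2y v2yx v2yy ->
  (forall x y, in_disk x y ->
    v1xx x y + v1yy x y + 2 * b * (x * v2y x y - y * v2x x y) - b ^ 2 * (x ^ 2 + y ^ 2) * v1 x y = 0) ->
  (forall x y, in_disk x y ->
    v2xx x y + v2yy x y - 2 * b * (x * v1y x y - y * v1x x y) - b ^ 2 * (x ^ 2 + y ^ 2) * v2 x y = 0) ->
  0 < r < 1 ->
  is_derive (fun r => RInt (wronskian_integrand m f f1 v1 v1x v1y v2 v2x v2y r) 0 (2 * PI)) r 0.
Proof.
intros df df1 cf2 ode hv1 hv1x hv1y hv2 hv2x hv2y pde1 pde2 hr.
set (M := IZR m).
set (k := wronskian_integrand m f f1 v1 v1x v1y v2 v2x v2y).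
assert (cf : forall r, continuous f r).
{ intros s; apply (ex_derive_continuous f); eexists; apply df. }
assert (cf1 : forall r, continuous f1 r).
{ intros s; apply (ex_derive_continuous f1); eexists; apply df1. }
set (rr := fun uxx uxy uyx uyy : R -> R -> R => fun r th =>
  (polar uxx r th * cos th + polar uxy r th * sin th) * cos th +
  (polar uyx r th * cos th + polar uyy r th * sin th) * sin th).
set (dk := fun r th =>
  (((polar v1x r th * cos th + polar v1y r th * sin th) * f r - polar v1 r th * f1 r)
         * cos (M * th) +
       ((polar v2x r th * cos th + polar v2y r th * sin th) * f r - polar v2 r th * f1 r)
         * sin (M * th)) +
  r * ((rr v1xx v1xy v1yx v1yy r th * f r - polar v1 r th * f2 r) * cos (M * th) +
       (rr v2xx v2xy v2yx v2yy r th * f r - polar v2 r th * f2 r) * sin (M * th))).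
assert (Rr : forall s, 0 < s < 1 -> Rabs s < 1) by (intros s hs; rewrite Rabs_pos_eq; lra).
assert (hdk : forall s th, Rabs s < 1 -> is_derive (fun s => k s th) s (dk s th)).
{ intros s th hs.
  pose proof (is_derive_polar_r _ _ _ s th hv1 hs) as D1.
  pose proof (is_derive_polar_r _ _ _ s th hv1x hs) as D1x.
  pose proof (is_derive_polar_r _ _ _ s th hv1y hs) as D1y.
  pose proof (is_derive_polar_r _ _ _ s th hv2 hs) as D2.
  pose proof (is_derive_polar_r _ _ _ s th hv2x hs) as D2x.
  pose proof (is_derive_polar_r _ _ _ s th hv2y hs) as D2y.
  pose proof (df s) as Df; pose proof (df1 s) as Df1.
  unfold k, wronskian_integrand, dk, rr; fold M.
  auto_derive.
  - split_all; auto; match goal with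
      | H : is_derive (fun s => polar ?u s _) _ _ |- ex_derive (fun s => polar ?u s _) _ => exact (ex_intro _ _ H)
      | H : is_derive (fun s => polar ?u _ s) _ _ |- ex_derive (fun s => polar ?u _ s) _ => exact (ex_intro _ _ H)
      | H : is_derive ?f _ _ |- ex_derive (fun s => ?f s) _ => exact (ex_intro _ _ H)
      end.
  - rewrite (is_derive_unique (fun s : R => polar v1 s th) s _ D1), (is_derive_unique (fun s : R => polar v1x s th) s _ D1x), (is_derive_unique (fun s : R => polar v1y s th) s _ D1y),
    (is_derive_unique (fun s : R => polar v2 s th) s _ D2), (is_derive_unique (fun s : R => polar v2x s th) s _ D2x), (is_derive_unique (fun s : R => polar v2y s th) s _ D2y).
    rewrite (is_derive_unique (fun s : R => f s) _ _ Df), (is_derive_unique (fun s : R => f1 s) _ _ Df1).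
    ring. }
(* Real part of [e^{- i m theta} (- v_theta - i m v + 2 i b r^2 v)]. Inserting both equations in the
   r-derivative of the integrand leaves [f / r] times [e^{- i m theta} (- v_thetatheta + 2 i b r^2
   v_theta - (m^2 - 2 m b r^2) v)], which is [f / r] times the theta-derivative of that
   expression. *)
set (Q := fun th =>
   - (polar v1x r th * (- (r * sin th)) + polar v1y r th * (r * cos th)) * cos (M * th)
   - M * polar v1 r th * sin (M * th)
   - (polar v2x r th * (- (r * sin th)) + polar v2y r th * (r * cos th)) * sin (M * th)
   + M * polar v2 r th * cos (M * th)
   + 2 * b * r ^ 2 * (polar v1 r th * sin (M * th) - polar v2 r th * cos (M * th))).
assert (hQ : forall th, is_derive (fun th => f r / r * Q th) th (dk r th)).
{ intros th.
  assert (hs : Rabs r < 1) by auto.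
  pose proof (is_derive_polar_th _ _ _ r th hv1 hs) as D1.
  pose proof (is_derive_polar_th _ _ _ r th hv1x hs) as D1x.
  pose proof (is_derive_polar_th _ _ _ r th hv1y hs) as D1y.
  pose proof (is_derive_polar_th _ _ _ r th hv2 hs) as D2.
  pose proof (is_derive_polar_th _ _ _ r th hv2x hs) as D2x.
  pose proof (is_derive_polar_th _ _ _ r th hv2y hs) as D2y.
  unfold Q.
  auto_derive.
  - split_all; auto; match goal with
      | H : is_derive (fun s => polar ?u s _) _ _ |- ex_derive (fun s => polar ?u s _) _ => exact (ex_intro _ _ H)
      | H : is_derive (fun s => polar ?u _ s) _ _ |- ex_derive (fun s => polar ?u _ s) _ => exact (ex_intro _ _ H)
      | H : is_derive ?f _ _ |- ex_derive (fun s => ?f s) _ => exact (ex_intro _ _ H)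
      end.
  - rewrite (is_derive_unique (fun th : R => polar v1 r th) th _ D1), (is_derive_unique (fun th : R => polar v1x r th) th _ D1x), (is_derive_unique (fun th : R => polar v1y r th) th _ D1y),
    (is_derive_unique (fun th : R => polar v2 r th) th _ D2), (is_derive_unique (fun th : R => polar v2x r th) th _ D2x), (is_derive_unique (fun th : R => polar v2y r th) th _ D2y).
    unfold dk, rr.
    pose proof (pde1 _ _ (in_disk_polar r th hs)) as P1.
    pose proof (pde2 _ _ (in_disk_polar r th hs)) as P2.
    pose proof (ode r) as O. fold M in O.
    pose proof (sin2_cos2 th) as T; unfold Rsqr in T.
    replace ((r * cos th) ^ 2 + (r * sin th) ^ 2) with (r ^ 2) in P1, P2
      by (transitivity (r ^ 2 * (sin th * sin th + cos th * cos th)); [rewrite T|]; ring).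
    change (v1 (r * cos th) (r * sin th)) with (polar v1 r th) in *.
    change (v1x (r * cos th) (r * sin th)) with (polar v1x r th) in *.
    change (v1y (r * cos th) (r * sin th)) with (polar v1y r th) in *.
    change (v1xx (r * cos th) (r * sin th)) with (polar v1xx r th) in *.
    change (v1yy (r * cos th) (r * sin th)) with (polar v1yy r th) in *.
    change (v2 (r * cos th) (r * sin th)) with (polar v2 r th) in *.
    change (v2x (r * cos th) (r * sin th)) with (polar v2x r th) in *.
    change (v2y (r * cos th) (r * sin th)) with (polar v2y r th) in *.
    change (v2xx (r * cos th) (r * sin th)) with (polar v2xx r th) in *.
    change (v2yy (r * cos th) (r * sin th)) with (polar v2yy r th) in *.
    generalize dependent (cos th); intros c; generalize dependent (sin th); intros s.
    generalize dependent (cos (M * th)); intros C; generalize dependent (sin (M * th)); intros S.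
    generalize dependent (polar v1 r th); intros a0; generalize dependent (polar v1x r th); intros ax.
    generalize dependent (polar v1y r th); intros ay; generalize dependent (polar v1xx r th); intros axx.
    generalize dependent (polar v1xy r th); intros axy; generalize dependent (polar v1yx r th); intros ayx.
    generalize dependent (polar v1yy r th); intros ayy.
    generalize dependent (polar v2 r th); intros d0; generalize dependent (polar v2x r th); intros dx.
    generalize dependent (polar v2y r th); intros dy; generalize dependent (polar v2xx r th); intros dxx.
    generalize dependent (polar v2xy r th); intros dxy; generalize dependent (polar v2yx r th); intros dyx.
    generalize dependent (polar v2yy r th); intros dyy.
    intros.
    apply Rmult_eq_reg_l with r; [|lra].
    apply Rminus_diag_uniq, Ropp_eq_reg; rewrite Ropp_0.
    (* The difference of the two sides is written as a combination of the radial equation, the two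
       real equations and [sin^2 + cos^2 = 1]. The mixed derivatives occur on both sides through
       their sum and cancel. *)
    transitivity (- (a0 * C + d0 * S) * ((r ^ 2 * f2 r + r * f1 r) - (M - b * r ^ 2) ^ 2 * f r)
      + f r * r ^ 2 * C * (axx + ayy + 2 * b * (r * c * dy - r * s * dx) - b ^ 2 * r ^ 2 * a0)
      + f r * r ^ 2 * S * (dxx + dyy - 2 * b * (r * c * ay - r * s * ax) - b ^ 2 * r ^ 2 * d0)
      + ((s * s + c * c) - 1) * f r * r ^ 2 * ((axx + ayy) * C + (dxx + dyy) * S)).
    + field; lra.
    + rewrite P1, P2, O, T; ring. }
assert (ck : forall s th, Rabs s < 1 -> continuity_2d_pt dk s th).
{ intros s th hs; unfold dk, rr.
  cont2d. }
assert (near : locally r (fun s => Rabs s < 1)).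
{ apply (open_comp Rabs (fun s => s < 1)); [|apply open_lt|auto].
  intros x _; apply (continuous_Rabs x). }
evar_last.
- apply (is_derive_RInt_param k 0 (2 * PI) r).
  + revert near; apply filter_imp; intros s hs th _; eexists; apply hdk, hs.
  + intros th _; apply (continuity_2d_pt_ext_loc dk); [|apply ck; auto].
    apply (locally_2d_impl (fun s _ => Rabs s < 1)).
    * apply locally_2d_forall; intros s t hs; symmetry; apply is_derive_unique, hdk, hs.
    * destruct near as [d hd]; exists d; intros u w hu _; apply hd, hu.
  + revert near; apply filter_imp; intros s hs.
    apply (ex_RInt_continuous (k s)); intros th _; apply continuity_2d_pt_continuous.
    unfold k, wronskian_integrand; fold M.
  cont2d.
- rewrite (RInt_ext _ (dk r)).
  + assert (I : is_RInt (dk r) 0 (2 * PI) (minus (f r / r * Q (2 * PI)) (f r / r * Q 0))).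
    { apply (is_RInt_derive (fun th => f r / r * Q th)); intros th _; [apply hQ|].
      apply continuity_2d_pt_continuous, ck; auto. }
    rewrite (is_RInt_unique _ _ _ _ I).
    (* Since [m] is an integer, [Q] is 2 pi-periodic and its boundary values cancel. *)
    unfold Q, polar, M; rewrite cos_2PI_Z, sin_2PI_Z, cos_2PI, sin_2PI, !Rmult_0_r, sin_0, cos_0. rewrite !Rmult_0_r.
    unfold minus, plus, opp; simpl; ring.
  + intros th _; apply is_derive_unique, hdk; auto.
Qed.

Lemma polar_bounded_near_0 (u : R -> R -> R) : continuity_2d_pt u 0 0 ->
  exists d, 0 < d /\ forall r th, 0 < r < d -> Rabs (polar u r th) <= Rabs (u 0 0) + 1.
Proof.
intros hu; destruct (hu (mkposreal 1 Rlt_0_1)) as [d hd].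
exists d; split; [apply cond_pos|]; intros r th hr; unfold polar.
assert (K : forall c, -1 <= c <= 1 -> Rabs (r * c - 0) < d).
{ intros c hc; rewrite Rminus_0_r, Rabs_mult, (Rabs_pos_eq r) by lra.
  assert (Rabs c <= 1) by (apply Rabs_le; lra). nra. }
specialize (hd _ _ (K _ (COS_bound th)) (K _ (SIN_bound th))); simpl in hd.
pose proof (Rabs_triang_inv (u (r * cos th) (r * sin th)) (u 0 0)); lra.
Qed.

Lemma continuous_bounded_near_0 (f : R -> R) : continuous f 0 ->
  exists d, 0 < d /\ forall r, 0 < r < d -> Rabs (f r) <= Rabs (f 0) + 1.
Proof.
intros hf; destruct (polar_bounded_near_0 (fun x _ => f x)) as [d [hd h]].
- apply continuity_2d_pt_fst, hf.
- exists d; split; auto; intros r hr; specialize (h r 0 hr).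
  unfold polar in h; rewrite cos_0, Rmult_1_r in h; exact h.
Qed.

Lemma wronskian_eq (b : R) (m : Z) (f f1 f2 : R -> R)
  (v1 v1x v1y v1xx v1xy v1yx v1yy v2 v2x v2y v2xx v2xy v2yx v2yy : R -> R -> R) (r : R) :
  (forall r, is_derive f r (f1 r)) -> (forall r, is_derive f1 r (f2 r)) ->
  (forall r, continuous f2 r) ->
  (forall r, r ^ 2 * f2 r + r * f1 r = (IZR m - b * r ^ 2) ^ 2 * f r) ->
  C1_disk v1 v1x v1y -> C1_disk v1x v1xx v1xy -> C1_disk v1y v1yx v1yy ->
  C1_disk v2 v2x v2y -> C1_disk v2x v2xx v2xy -> C1_disk v2y v2yx v2yy ->
  (forall x y, in_disk x y ->
    v1xx x y + v1yy x y + 2 * b * (x * v2y x y - y * v2x x y) - b ^ 2 * (x ^ 2 + y ^ 2) * v1 x y = 0) ->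
  (forall x y, in_disk x y ->
    v2xx x y + v2yy x y - 2 * b * (x * v1y x y - y * v1x x y) - b ^ 2 * (x ^ 2 + y ^ 2) * v2 x y = 0) ->
  0 < r < 1 ->
  f r * RInt (fun th => (polar v1x r th * cos th + polar v1y r th * sin th) * cos (IZR m * th)
     + (polar v2x r th * cos th + polar v2y r th * sin th) * sin (IZR m * th)) 0 (2 * PI) =
  f1 r * RInt (fun th => polar v1 r th * cos (IZR m * th) + polar v2 r th * sin (IZR m * th)) 0 (2 * PI).
Proof.
intros df df1 cf2 ode hv1 hv1x hv1y hv2 hv2x hv2y pde1 pde2 hr.
set (k := wronskian_integrand m f f1 v1 v1x v1y v2 v2x v2y).
assert (dK : forall s, 0 < s < 1 -> is_derive (fun r => RInt (k r) 0 (2 * PI)) s 0).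
{ intros s hs; eapply wronskian_derive; eassumption. }
assert (cf : forall r, continuous f r).
{ intros s; apply (ex_derive_continuous f); eexists; apply df. }
assert (cf1 : forall r, continuous f1 r).
{ intros s; apply (ex_derive_continuous f1); eexists; apply df1. }
assert (pi : 0 < PI) by apply PI_RGT_0.
assert (ek : forall s, 0 < s < 1 -> ex_RInt (k s) 0 (2 * PI)).
{ intros s hs; apply (ex_RInt_continuous (k s)); intros th _; apply continuity_2d_pt_continuous.
  assert (Rabs s < 1) by (rewrite Rabs_pos_eq; lra).
  unfold k, wronskian_integrand; cont2d. }
assert (bound : exists B d, 0 < d /\ forall s th, 0 < s < d -> Rabs (k s th) <= s * B).
{ assert (O0 : in_disk 0 0) by (unfold in_disk; lra).
  assert (c0 : forall u ux uy, C1_disk u ux uy -> continuity_2d_pt u 0 0).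
  { intros u ux uy hu; replace 0 with (0 * cos 0) at 1 by ring; replace 0 with (0 * sin 0) at 3 by ring.
    apply differentiable_continuity_pt; eexists; eexists.
    apply C1_disk_differentiable with (1 := hu), in_disk_polar; rewrite Rabs_R0; lra. }
  destruct (polar_bounded_near_0 v1 (c0 _ _ _ hv1)) as [d1 [p1 h1]].
  destruct (polar_bounded_near_0 v1x (c0 _ _ _ hv1x)) as [d2 [p2 h2]].
  destruct (polar_bounded_near_0 v1y (c0 _ _ _ hv1y)) as [d3 [p3 h3]].
  destruct (polar_bounded_near_0 v2 (c0 _ _ _ hv2)) as [d4 [p4 h4]].
  destruct (polar_bounded_near_0 v2x (c0 _ _ _ hv2x)) as [d5 [p5 h5]].
  destruct (polar_bounded_near_0 v2y (c0 _ _ _ hv2y)) as [d6 [p6 h6]].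
  destruct (continuous_bounded_near_0 f (cf 0)) as [d7 [p7 h7]].
  destruct (continuous_bounded_near_0 f1 (cf1 0)) as [d8 [p8 h8]].
  (* The constant [B] is left open here; [bp], [bm] and [bt] assemble it while they follow the shape
     of the integrand. *)
  eexists; exists (Rmin (Rmin (Rmin d1 d2) (Rmin d3 d4)) (Rmin (Rmin d5 d6) (Rmin d7 d8))).
  split; [repeat apply Rmin_glb_lt; assumption|].
  intros s th [hs0 hs].
  repeat match goal with H : s < Rmin _ _ |- _ => apply Rmin_Rgt_l in H; destruct H | H : Rmin _ _ > s |- _ => apply Rmin_Rgt_l in H; destruct H end.
  specialize (h1 s th ltac:(lra)); specialize (h2 s th ltac:(lra)); specialize (h3 s th ltac:(lra)).
  specialize (h4 s th ltac:(lra)); specialize (h5 s th ltac:(lra)); specialize (h6 s th ltac:(lra)).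
  specialize (h7 s ltac:(lra)); specialize (h8 s ltac:(lra)).
  assert (bc : forall x, Rabs (cos x) <= 1) by (intros; apply Rabs_le, COS_bound).
  assert (bs : forall x, Rabs (sin x) <= 1) by (intros; apply Rabs_le, SIN_bound).
  assert (bp : forall x y X Y, Rabs x <= X -> Rabs y <= Y -> Rabs (x + y) <= X + Y).
  { intros; eapply Rle_trans; [apply Rabs_triang|lra]. }
  assert (bm : forall x y X Y, Rabs x <= X -> Rabs y <= Y -> Rabs (x - y) <= X + Y).
  { intros; unfold Rminus; apply bp; auto; rewrite Rabs_Ropp; auto. }
  assert (bt : forall x y X Y, Rabs x <= X -> Rabs y <= Y -> Rabs (x * y) <= X * Y).
  { intros; rewrite Rabs_mult; apply Rmult_le_compat; auto using Rabs_pos. }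
  unfold k, wronskian_integrand.
  rewrite Rabs_mult, (Rabs_pos_eq s) by lra.
  apply Rmult_le_compat_l; [lra|].
  apply bp; (apply bt; [apply bm; apply bt; [apply bp; apply bt|..]|]); eauto. }
assert (K0 : RInt (k r) 0 (2 * PI) = 0).
{ destruct bound as [B [d [hd hB]]].
  assert (Bp : 0 <= B).
  { specialize (hB (d / 2) 0 ltac:(lra)). pose proof (Rabs_pos (k (d/2) 0)). nra. }
  apply Rabs_eq_0.
  apply Rle_antisym; [|apply Rabs_pos].
  apply le_epsilon; intros e he; rewrite Rplus_0_l.
  (* The radius [s] lies below [r], so that constancy transports the value from [r] to [s]; it lies
     inside the region of the bound, and it satisfies [2 * PI * B * s <= e]. *)
  set (s := Rmin (Rmin r (d / 2)) (e / (2 * PI * B + 1))).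
  assert (P1 : 0 <= 2 * PI * B) by (apply Rmult_le_pos; lra).
  assert (hs : 0 < s).
  { unfold s; repeat apply Rmin_glb_lt; try lra. apply Rdiv_lt_0_compat; lra. }
  assert (hs1 : s <= r) by (unfold s; eapply Rle_trans; [apply Rmin_l|apply Rmin_l]).
  assert (hs2 : s <= d / 2) by (unfold s; eapply Rle_trans; [apply Rmin_l|apply Rmin_r]).
  assert (hs3 : s * (2 * PI * B + 1) <= e).
  { apply Rle_div_r; [lra|]. unfold s; apply Rmin_r. }
  rewrite <- (derive_0_eq (fun r => RInt (k r) 0 (2 * PI)) s r hs1).
  2: intros x hx; apply dK; lra.
  eapply Rle_trans; [apply (abs_RInt_le_const (k s) 0 (2 * PI) (s * B))|].
  - lra.
  - apply ek; lra.
  - intros t _; apply hB; lra.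
  - nra. }
assert (hr1 : Rabs r < 1) by (rewrite Rabs_pos_eq; lra).
match goal with |- f r * RInt ?A _ _ = f1 r * RInt ?B _ _ => set (a := A); set (c := B) end.
assert (ea : ex_RInt a 0 (2 * PI)).
{ apply (ex_RInt_continuous a); intros th _.
  apply (continuity_2d_pt_continuous (fun r th =>
    (polar v1x r th * cos th + polar v1y r th * sin th) * cos (IZR m * th)
     + (polar v2x r th * cos th + polar v2y r th * sin th) * sin (IZR m * th)) r th).
  cont2d. }
assert (ec : ex_RInt c 0 (2 * PI)).
{ apply (ex_RInt_continuous c); intros th _.
  apply (continuity_2d_pt_continuous (fun r th =>
    polar v1 r th * cos (IZR m * th) + polar v2 r th * sin (IZR m * th)) r th).
  cont2d. }
assert (E : RInt (k r) 0 (2 * PI) = r * (f r * RInt a 0 (2 * PI) - f1 r * RInt c 0 (2 * PI))).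
{ apply is_RInt_unique.
  apply (is_RInt_ext (fun th => scal r (minus (scal (f r) (a th)) (scal (f1 r) (c th))))).
  - intros th _; unfold scal, minus, plus, opp; simpl; unfold mult; simpl.
    unfold k, wronskian_integrand, a, c; ring.
  - apply (is_RInt_scal (fun th => minus (scal (f r) (a th)) (scal (f1 r) (c th)))).
    apply (is_RInt_minus (fun th => scal (f r) (a th)) (fun th => scal (f1 r) (c th)));
    [apply (is_RInt_scal a)|apply (is_RInt_scal c)]; apply (RInt_correct (V := R_CompleteNormedModule)); auto. }
rewrite K0 in E.
destruct (Rmult_integral _ _ (eq_sym E)); lra.
Qed.

(** * The magnetic equation as two real equations *)

Lemma DmA1_eq (b : R) (w : R -> R -> C) (x y d1 d2 : R) :
  is_derive (fun z => Re (w z y)) x d1 -> is_derive (fun z => Im (w z y)) x d2 ->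
  DmA1 b w x y = (d2 + b * y * Re (w x y), - d1 + b * y * Im (w x y)).
Proof.
intros h1 h2; unfold DmA1, DeriveC.
rewrite (is_derive_unique (fun z : R => Re (w z y)) x _ h1).
rewrite (is_derive_unique (fun z : R => Im (w z y)) x _ h2).
unfold Cmult, Cminus, Copp, Cplus, RtoC, Ci, Re, Im; simpl; f_equal; ring.
Qed.

Lemma DmA2_eq (b : R) (w : R -> R -> C) (x y d1 d2 : R) :
  is_derive (fun z => Re (w x z)) y d1 -> is_derive (fun z => Im (w x z)) y d2 ->
  DmA2 b w x y = (d2 - b * x * Re (w x y), - d1 - b * x * Im (w x y)).
Proof.
intros h1 h2; unfold DmA2, DeriveC.
rewrite (is_derive_unique (fun z : R => Re (w x z)) y _ h1).
rewrite (is_derive_unique (fun z : R => Im (w x z)) y _ h2).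
unfold Cmult, Cminus, Copp, Cplus, RtoC, Ci, Re, Im; simpl; f_equal; ring.
Qed.

Lemma mag_laplacian_eq (b : R) (v : R -> R -> C)
  (v1x v1y v1xx v1xy v1yx v1yy v2x v2y v2xx v2xy v2yx v2yy : R -> R -> R) (x y : R) :
  C1_disk (fun x y => Re (v x y)) v1x v1y -> C1_disk v1x v1xx v1xy -> C1_disk v1y v1yx v1yy ->
  C1_disk (fun x y => Im (v x y)) v2x v2y -> C1_disk v2x v2xx v2xy -> C1_disk v2y v2yx v2yy ->
  in_disk x y ->
  mag_laplacian b v x y =
    (- (v1xx x y + v1yy x y + 2 * b * (x * v2y x y - y * v2x x y)
        - b ^ 2 * (x ^ 2 + y ^ 2) * Re (v x y)),
     - (v2xx x y + v2yy x y - 2 * b * (x * v1y x y - y * v1x x y)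
        - b ^ 2 * (x ^ 2 + y ^ 2) * Im (v x y))).
Proof.
intros h1 h1x h1y h2 h2x h2y hxy; unfold mag_laplacian.
assert (E1 : forall x y, in_disk x y ->
  DmA1 b v x y = (v2x x y + b * y * Re (v x y), - v1x x y + b * y * Im (v x y))).
{ intros s t h; apply DmA1_eq; [apply h1|apply h2]; exact h. }
assert (E2 : forall x y, in_disk x y ->
  DmA2 b v x y = (v2y x y - b * x * Re (v x y), - v1y x y - b * x * Im (v x y))).
{ intros s t h; apply DmA2_eq; [apply h1|apply h2]; exact h. }
pose proof (in_disk_open x y hxy) as O.
destruct (h1 x y hxy) as [D1x [D1y _]]; destruct (h2 x y hxy) as [D2x [D2y _]].
destruct (h1x x y hxy) as [D1xx _]; destruct (h2x x y hxy) as [D2xx _].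
destruct (h1y x y hxy) as [_ [D1yy _]]; destruct (h2y x y hxy) as [_ [D2yy _]].
rewrite (DmA1_eq b (DmA1 b v) x y (v2xx x y + b * y * v1x x y) (- v1xx x y + b * y * v2x x y)).
2: { apply (is_derive_ext_loc (fun z => v2x z y + b * y * Re (v z y))).
     - generalize (locally_2d_1d_const_y _ _ _ O); apply filter_imp; intros z hz; rewrite E1; auto.
     - apply (is_derive_plus (fun z => v2x z y)); [exact D2xx|].
       apply (is_derive_scal (fun z => Re (v z y))); exact D1x. }
2: { apply (is_derive_ext_loc (fun z => - v1x z y + b * y * Im (v z y))).
     - generalize (locally_2d_1d_const_y _ _ _ O); apply filter_imp; intros z hz; rewrite E1; auto.
     - apply (is_derive_plus (fun z => - v1x z y)); [apply (is_derive_opp (fun z => v1x z y)); exact D1xx|].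
       apply (is_derive_scal (fun z => Im (v z y))); exact D2x. }
rewrite (DmA2_eq b (DmA2 b v) x y (v2yy x y - b * x * v1y x y) (- v1yy x y - b * x * v2y x y)).
2: { apply (is_derive_ext_loc (fun z => v2y x z - b * x * Re (v x z))).
     - generalize (locally_2d_1d_const_x _ _ _ O); apply filter_imp; intros z hz; rewrite E2; auto.
     - apply (is_derive_minus (fun z => v2y x z)); [exact D2yy|].
       apply (is_derive_scal (fun z => Re (v x z))); exact D1y. }
2: { apply (is_derive_ext_loc (fun z => - v1y x z - b * x * Im (v x z))).
     - generalize (locally_2d_1d_const_x _ _ _ O); apply filter_imp; intros z hz; rewrite E2; auto.
     - apply (is_derive_minus (fun z => - v1y x z)); [apply (is_derive_opp (fun z => v1y x z)); exact D1yy|].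
       apply (is_derive_scal (fun z => Im (v x z))); exact D2y. }
rewrite E1, E2 by exact hxy.
unfold Cplus; simpl; f_equal; ring.
Qed.

Definition dx (u : R -> R -> R) (x y : R) : R := Derive (fun z => u z y) x.
Definition dy (u : R -> R -> R) (x y : R) : R := Derive (fun z => u x z) y.

Lemma ex_diff_1_C1 (u : R -> R -> R) : (forall x y, in_disk x y -> ex_diff_n u 1 x y) ->
  C1_disk u (dx u) (dy u).
Proof.
intros h x y hxy; destruct (h x y hxy) as [_ [a [c [d e]]]].
split; [|split; [|split]].
- apply Derive_correct, a.
- apply Derive_correct, c.
- apply d.
- apply e.
Qed.

Lemma ex_diff_2_C1 (u : R -> R -> R) : (forall x y, in_disk x y -> ex_diff_n u 2 x y) ->
  C1_disk u (dx u) (dy u) /\ C1_disk (dx u) (dx (dx u)) (dy (dx u)) /\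
  C1_disk (dy u) (dx (dy u)) (dy (dy u)).
Proof.
intros h; split; [|split]; apply ex_diff_1_C1; intros x y hxy.
- apply (ex_diff_n_m 2 1); auto.
- apply (h x y hxy).
- apply (h x y hxy).
Qed.

Lemma C1_disk_opp (u ux uy : R -> R -> R) : C1_disk u ux uy ->
  C1_disk (fun x y => - u x y) (fun x y => - ux x y) (fun x y => - uy x y).
Proof.
intros h x y hxy; destruct (h x y hxy) as [a [c [d e]]]; split; [|split; [|split]].
- apply (is_derive_opp (fun z => u z y)), a.
- apply (is_derive_opp (fun z => u x z)), c.
- apply continuity_2d_pt_opp, d.
- apply continuity_2d_pt_opp, e.
Qed.

Lemma RtoC_mult_pair (a p q : R) : (RtoC a * (p, q))%C = (a * p, a * q).
Proof. unfold Cmult, RtoC; simpl; f_equal; ring. Qed.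

Lemma RInt_ext_R (f g : R -> R) (a b : R) : (forall x, f x = g x) -> RInt f a b = RInt g a b.
Proof. intros h; apply RInt_ext; intros x _; apply h. Qed.

Lemma fourier_radial_deriv (b : R) (m : Z) (f f1 f2 : R -> R) (v : R -> R -> C) (r : R) :
  (forall r, is_derive f r (f1 r)) -> (forall r, is_derive f1 r (f2 r)) ->
  (forall r, continuous f2 r) ->
  (forall r, r ^ 2 * f2 r + r * f1 r = (IZR m - b * r ^ 2) ^ 2 * f r) ->
  C2_disk v -> (forall x y, in_disk x y -> mag_laplacian b v x y = RtoC 0) -> 0 < r < 1 ->
  (RtoC (f r) * fourier (radial_deriv v r) m)%C = (RtoC (f1 r) * fourier (on_circle v r) m)%C.
Proof.
intros df df1 cf2 ode hv pde hr.
set (v1 := fun x y => Re (v x y)); set (v2 := fun x y => Im (v x y)).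
destruct (ex_diff_2_C1 v1 (fun x y h => proj1 (hv x y h))) as [h1 [h1x h1y]].
destruct (ex_diff_2_C1 v2 (fun x y h => proj2 (hv x y h))) as [h2 [h2x h2y]].
assert (P : forall x y, in_disk x y ->
  dx (dx v1) x y + dy (dy v1) x y + 2 * b * (x * dy v2 x y - y * dx v2 x y) - b ^ 2 * (x ^ 2 + y ^ 2) * v1 x y = 0
  /\ dx (dx v2) x y + dy (dy v2) x y - 2 * b * (x * dy v1 x y - y * dx v1 x y) - b ^ 2 * (x ^ 2 + y ^ 2) * v2 x y = 0).
{ intros x y hxy; pose proof (pde x y hxy) as E.
  rewrite (mag_laplacian_eq b v _ _ _ _ _ _ _ _ _ _ _ _ x y h1 h1x h1y h2 h2x h2y hxy) in E.
  unfold RtoC in E; injection E; unfold v1, v2; intros; lra. }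
assert (rd : forall th, radial_deriv v r th =
  (polar (dx v1) r th * cos th + polar (dy v1) r th * sin th,
   polar (dx v2) r th * cos th + polar (dy v2) r th * sin th)).
{ assert (Rabs r < 1) by (rewrite Rabs_pos_eq; lra).
  intros th; unfold radial_deriv, DeriveC; f_equal; apply is_derive_unique.
  - apply (is_derive_polar_r v1); auto.
  - apply (is_derive_polar_r v2); auto. }
pose proof (wronskian_eq b m f f1 f2 _ _ _ _ _ _ _ _ _ _ _ _ _ _ r df df1 cf2 ode h1 h1x h1y h2 h2x h2y
  (fun x y h => proj1 (P x y h)) (fun x y h => proj2 (P x y h)) hr) as W1.
(* The pair [(v2, - v1)] consists of the real and imaginary parts of [- i v], again a solution; the
   real identity for it is the imaginary part of the identity for [v]. *)
pose proof (wronskian_eq b m f f1 f2 _ _ _ _ _ _ _ _ _ _ _ _ _ _ r df df1 cf2 ode h2 h2x h2y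
  (C1_disk_opp _ _ _ h1) (C1_disk_opp _ _ _ h1x) (C1_disk_opp _ _ _ h1y)) as W2.
specialize (W2 ltac:(intros x y h; destruct (P x y h); lra) ltac:(intros x y h; destruct (P x y h); lra) hr).
unfold fourier; cbv zeta; rewrite !RtoC_mult_pair.
unfold Rdiv; rewrite <- !Rmult_assoc.
f_equal; f_equal.
- rewrite (RInt_ext _ (fun th => (polar (dx v1) r th * cos th + polar (dy v1) r th * sin th) * cos (IZR m * th)
     + (polar (dx v2) r th * cos th + polar (dy v2) r th * sin th) * sin (IZR m * th))).
  2: { intros th _; rewrite rd; unfold Cmult, Re; simpl; ring. }
  rewrite W1; f_equal; apply RInt_ext_R; intros th; unfold Cmult, polar, v1, v2, on_circle, Re, Im; simpl; ring.
- rewrite (RInt_ext _ (fun th => (polar (dx v2) r th * cos th + polar (dy v2) r th * sin th) * cos (IZR m * th)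
     + (polar (fun x y => - dx v1 x y) r th * cos th + polar (fun x y => - dy v1 x y) r th * sin th) * sin (IZR m * th))).
  2: { intros th _; rewrite rd; unfold Cmult, Im; simpl; unfold polar; ring. }
  rewrite W2; f_equal; apply RInt_ext_R; intros th; unfold Cmult, polar, v1, v2, on_circle, Re, Im; simpl; ring.
Qed.

(** * Distributions on the circle *)

Lemma is_series_zero (a : nat -> R) : (forall k, a k = 0) -> is_series a 0.
Proof.
intros h; apply (filterlim_ext (fun _ => 0)); [|apply filterlim_const].
intros n; symmetry; rewrite (sum_n_ext _ (fun _ => 0)) by exact h.
rewrite sum_n_const; ring.
Qed.

Lemma is_series_single (a : nat -> R) (k : nat) : (forall j, j <> k -> a j = 0) ->
  is_series a (a k).
Proof.
revert a; induction k as [|k IH]; intros a h.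
- apply is_series_decr_1.
  unfold plus, opp; simpl; rewrite Rplus_opp_r.
  apply is_series_zero; intros j; apply h; lia.
- apply is_series_decr_1.
  rewrite (h 0%nat) by lia; unfold plus, opp; simpl; rewrite Ropp_0, Rplus_0_r.
  apply (IH (fun j => a (S j))); intros j hj; apply h; lia.
Qed.

Lemma term_le_Series (a : nat -> R) (k : nat) : (forall j, 0 <= a j) -> ex_series a ->
  a k <= Series a.
Proof.
intros h0 ha.
set (s := fun j => if Nat.eq_dec j k then a j else 0).
assert (E : Series s = a k).
{ replace (a k) with (s k) by (unfold s; destruct (Nat.eq_dec k k); lia || auto).
  apply is_series_unique, is_series_single; intros j hj; unfold s; destruct (Nat.eq_dec j k); tauto. }
rewrite <- E; apply Series_le; auto.
intros j; unfold s; destruct (Nat.eq_dec j k); split; auto; lra.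
Qed.

Lemma term_le_sumZ (a : Z -> R) (n : Z) : (forall j, 0 <= a j) -> ex_sumZ a -> a n <= sumZ a.
Proof.
intros h0 [h1 h2]; unfold sumZ.
assert (N1 : 0 <= Series (fun k => a (Z.of_nat k))).
{ eapply Rle_trans; [apply h0|apply (term_le_Series (fun k => a (Z.of_nat k)) 0); auto]. }
assert (N2 : 0 <= Series (fun k => a (- Z.of_nat (S k))%Z)).
{ eapply Rle_trans; [apply h0|apply (term_le_Series (fun k => a (- Z.of_nat (S k))%Z) 0); auto]. }
destruct (Z_le_dec 0 n) as [hn|hn].
- pose proof (term_le_Series (fun k => a (Z.of_nat k)) (Z.to_nat n) (fun j => h0 _) h1) as T.
  simpl in T; rewrite Z2Nat.id in T by exact hn; lra.
- pose proof (term_le_Series (fun k => a (- Z.of_nat (S k))%Z) (pred (Z.to_nat (- n))) (fun j => h0 _) h2) as T.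
  cbv beta in T.
  replace (- Z.of_nat (S (pred (Z.to_nat (- n)))))%Z with n in T by lia; lra.
Qed.

Lemma sumZ_single (a : Z -> R) (m : Z) : (forall j, j <> m -> a j = 0) ->
  ex_sumZ a /\ sumZ a = a m.
Proof.
intros h; destruct (Z_le_dec 0 m) as [hm|hm].
- assert (S1 : is_series (fun k => a (Z.of_nat k)) (a m)).
  { replace m with (Z.of_nat (Z.to_nat m)) by lia.
    apply (is_series_single (fun k => a (Z.of_nat k))); intros j hj; apply h; lia. }
  assert (S2 : is_series (fun k => a (- Z.of_nat (S k))%Z) 0).
  { apply is_series_zero; intros k; apply h; lia. }
  split; [split; eexists; eassumption|].
  unfold sumZ; rewrite (is_series_unique _ _ S1), (is_series_unique _ _ S2); ring.
- assert (S1 : is_series (fun k => a (- Z.of_nat (S k))%Z) (a m)).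
  { replace m with (- Z.of_nat (S (pred (Z.to_nat (- m)))))%Z by lia.
    apply (is_series_single (fun k => a (- Z.of_nat (S k))%Z)); intros j hj; apply h; lia. }
  assert (S2 : is_series (fun k => a (Z.of_nat k)) 0).
  { apply is_series_zero; intros k; apply h; lia. }
  split; [split; eexists; eassumption|].
  unfold sumZ; rewrite (is_series_unique _ _ S1), (is_series_unique _ _ S2); ring.
Qed.

Lemma Rpower_pos (x y : R) : 0 < Rpower x y.
Proof. apply exp_pos. Qed.

Lemma Hs_term_ge_0 (s : R) (u : distr) (n : Z) : 0 <= Hs_term s u n.
Proof.
unfold Hs_term; apply Rmult_le_pos; [left; apply Rpower_pos|apply pow2_ge_0].
Qed.

Lemma Hs_term_minus (s : R) (u w : distr) (n : Z) :
  Hs_term s (fun n => (u n - w n)%C) n <= 2 * Hs_term s u n + 2 * Hs_term s w n.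
Proof.
unfold Hs_term.
pose proof (Rpower_pos (1 + IZR n ^ 2) s).
assert (Cmod (u n - w n) ^ 2 <= 2 * Cmod (u n) ^ 2 + 2 * Cmod (w n) ^ 2).
{ pose proof (Cmod_triangle (u n) (- w n)) as T; rewrite Cmod_opp in T; fold (u n - w n)%C in T.
  pose proof (Cmod_ge_0 (u n - w n)); pose proof (Cmod_ge_0 (u n)); pose proof (Cmod_ge_0 (w n)).
  apply Rle_trans with ((Cmod (u n) + Cmod (w n)) ^ 2); [apply pow_incr; lra|].
  pose proof (pow2_ge_0 (Cmod (u n) - Cmod (w n))); lra. }
nra.
Qed.

Lemma ex_series_Rle (a b : nat -> R) : (forall k, Rabs (a k) <= b k) -> ex_series b -> ex_series a.
Proof. apply (ex_series_le (K := R_AbsRing) (V := R_CompleteNormedModule)). Qed.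

Lemma ex_series_Rscal (c : R) (a : nat -> R) : ex_series a -> ex_series (fun k => c * a k).
Proof. apply (ex_series_scal (V := R_NormedModule) c a). Qed.

Lemma ex_series_Rplus (a b : nat -> R) : ex_series a -> ex_series b ->
  ex_series (fun k => a k + b k).
Proof. apply (ex_series_plus (V := R_NormedModule) a b). Qed.

Lemma in_Hs_minus (s : R) (u w : distr) : in_Hs s u -> in_Hs s w ->
  in_Hs s (fun n => (u n - w n)%C).
Proof.
intros [a1 a2] [b1 b2]; split.
- apply (ex_series_Rle _ (fun k => 2 * Hs_term s u (Z.of_nat k) + 2 * Hs_term s w (Z.of_nat k))).
  + intros k; rewrite Rabs_pos_eq by apply Hs_term_ge_0.
    apply Hs_term_minus.
  + apply ex_series_Rplus; apply ex_series_Rscal; assumption.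
- apply (ex_series_Rle _ (fun k => 2 * Hs_term s u (- Z.of_nat (S k))%Z + 2 * Hs_term s w (- Z.of_nat (S k))%Z)).
  + intros k; rewrite Rabs_pos_eq by apply Hs_term_ge_0.
    apply Hs_term_minus.
  + apply ex_series_Rplus; apply ex_series_Rscal; assumption.
Qed.

(** In a sum of nonnegative terms one term is at most the whole, so an [H^s] limit can be read on
    each Fourier coefficient, at the cost of a fixed weight. This is how the limits in [DN] and
    [heat_flow] become scalar. *)
Lemma cvg_Hs_coef (s : R) (f : R -> distr) (F : (R -> Prop) -> Prop) (u : distr) (n : Z) :
  Filter F -> cvg_Hs s f F u ->
  filterlim (fun x => Cmod (f x n - u n)) F (locally 0).
Proof.
intros FF [hu [hf hl]].
apply filterlim_locally; intros e.
set (w := Rpower (1 + IZR n ^ 2) s).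
assert (hw : 0 < w) by apply Rpower_pos.
assert (he : 0 < w * e ^ 2) by (apply Rmult_lt_0_compat; [auto|apply pow_lt, cond_pos]).
generalize (filter_and _ _ hf (proj1 (filterlim_locally _ _) hl (mkposreal _ he))).
apply filter_imp; intros x [hx hb].
unfold ball in hb |- *; simpl in hb |- *; unfold AbsRing_ball, abs, minus, plus, opp in hb |- *; simpl in hb |- *.
rewrite Ropp_0, Rplus_0_r in hb |- *.
rewrite Rabs_pos_eq by apply Cmod_ge_0.
(* Membership of both distributions in [H^s] is essential: [Series] of a divergent nonnegative
   series has the default value 0, and a small [Hs_dist2] would then mean nothing. *)
pose proof (term_le_sumZ _ n (Hs_term_ge_0 s _) (in_Hs_minus s (f x) u hx hu)) as T.
fold (Hs_dist2 s (f x) u) in T.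
unfold Hs_term in T; fold w in T.
pose proof (Rle_abs (Hs_dist2 s (f x) u)).
assert (K : w * Cmod (f x n - u n) ^ 2 < w * e ^ 2) by (simpl in *; lra).
apply Rmult_lt_reg_l in K; [|exact hw].
pose proof (cond_pos e); pose proof (Cmod_ge_0 (f x n - u n)).
destruct (Rlt_le_dec (Cmod (f x n - u n)) e) as [?|hh]; [auto|].
pose proof (pow_incr e _ 2 (conj (Rlt_le _ _ (cond_pos e)) hh)); lra.
Qed.

Definition single (m : Z) (c : C) : distr := fun n => if Z.eq_dec n m then c else RtoC 0.

Lemma Hs_term_single (s : R) (m : Z) (c : C) : forall j, j <> m -> Hs_term s (single m c) j = 0.
Proof.
intros j hj; unfold Hs_term, single; destruct (Z.eq_dec j m); [tauto|].
rewrite Cmod_0; simpl; ring.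
Qed.

Lemma in_Hs_single (s : R) (m : Z) (c : C) : in_Hs s (single m c).
Proof. apply (sumZ_single _ m), Hs_term_single. Qed.

Lemma cvg_Hs_single (s : R) (m : Z) (g : R -> R) (F : (R -> Prop) -> Prop) (c : R) :
  Filter F -> filterlim g F (locally c) ->
  cvg_Hs s (fun x => single m (RtoC (g x))) F (single m (RtoC c)).
Proof.
intros FF hg; split; [apply in_Hs_single|split].
- apply filter_forall; intros x; apply in_Hs_single.
- set (w := Rpower (1 + IZR m ^ 2) s).
  apply (filterlim_ext (fun x => w * (g x - c) ^ 2)).
  + intros x; unfold Hs_dist2.
    replace (fun n => (single m (RtoC (g x)) n - single m (RtoC c) n)%C)
      with (single m (RtoC (g x - c))).
    2: { apply functional_extensionality; intros n; unfold single.
         destruct (Z.eq_dec n m); [apply RtoC_minus|ring]. }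
    rewrite (proj2 (sumZ_single _ m (Hs_term_single s m _))).
    unfold Hs_term, single; destruct (Z.eq_dec m m); [|tauto].
    rewrite Cmod_R, pow2_abs; reflexivity.
  + apply (filterlim_comp _ _ _ g (fun y => w * (y - c) ^ 2) F (locally c)); [exact hg|].
    replace 0 with (w * (c - c) ^ 2) by ring.
    apply (ex_derive_continuous (fun y => w * (y - c) ^ 2)); auto_derive; auto.
Qed.

Lemma expi_single (m : Z) : expi m = single m (RtoC 1).
Proof. reflexivity. Qed.

Lemma Rabs_Im_le_Cmod (z : C) : Rabs (Im z) <= Cmod z.
Proof.
eapply Rle_trans; [apply Rmax_r|apply (Rmax_Cmod z)].
Qed.

Lemma filterlim_Rle_0 (F : (R -> Prop) -> Prop) (g h : R -> R) (l : R) : Filter F ->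
  (forall x, Rabs (g x - l) <= h x) -> filterlim h F (locally 0) -> filterlim g F (locally l).
Proof.
intros FF hb hh; apply filterlim_locally; intros e.
generalize (proj1 (filterlim_locally _ _) hh e); apply filter_imp; intros x hx.
unfold ball in hx |- *; simpl in hx |- *; unfold AbsRing_ball, abs, minus, plus, opp in hx |- *; simpl in hx |- *.
rewrite Ropp_0, Rplus_0_r in hx.
pose proof (hb x); pose proof (Rle_abs (h x)); unfold Rminus in *; lra.
Qed.

Lemma cvg_Hs_Re (s : R) (f : R -> distr) (F : (R -> Prop) -> Prop) (u : distr) (n : Z) :
  Filter F -> cvg_Hs s f F u -> filterlim (fun x => Re (f x n)) F (locally (Re (u n))).
Proof.
intros FF h; apply (filterlim_Rle_0 F _ (fun x => Cmod (f x n - u n)%C)); auto.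
- intros x; apply (re_le_Cmod (f x n - u n)%C).
- apply (cvg_Hs_coef s); auto.
Qed.

Lemma cvg_Hs_Im (s : R) (f : R -> distr) (F : (R -> Prop) -> Prop) (u : distr) (n : Z) :
  Filter F -> cvg_Hs s f F u -> filterlim (fun x => Im (f x n)) F (locally (Im (u n))).
Proof.
intros FF h; apply (filterlim_Rle_0 F _ (fun x => Cmod (f x n - u n)%C)); auto.
- intros x; apply (Rabs_Im_le_Cmod (f x n - u n)%C).
- apply (cvg_Hs_coef s); auto.
Qed.

(** * The radial profile and the eigenvalues *)

Definition prof (b : R) (N : nat) (r : R) : R := r ^ N * radial b N (r ^ 2).
Definition prof1 (b : R) (N : nat) (r : R) : R :=
  INR N * r ^ pred N * radial b N (r ^ 2) + r ^ N * (2 * r * radial1 b N (r ^ 2)).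
Definition prof2 (b : R) (N : nat) (r : R) : R :=
  INR N * (INR (pred N) * r ^ pred (pred N)) * radial b N (r ^ 2)
  + 2 * (INR N * r ^ pred N) * (2 * r * radial1 b N (r ^ 2))
  + r ^ N * (2 * radial1 b N (r ^ 2) + 4 * r ^ 2 * radial2 b N (r ^ 2)).

Lemma is_derive_sq (g g1 : R -> R) (r : R) : (forall s, is_derive g s (g1 s)) ->
  is_derive (fun r => g (r ^ 2)) r (2 * r * g1 (r ^ 2)).
Proof.
intros h; apply (is_derive_comp g (fun r => r ^ 2)); [apply h|].
auto_derive; auto; ring.
Qed.

Lemma is_derive_Rmult (f g : R -> R) (x l k : R) : is_derive f x l -> is_derive g x k ->
  is_derive (fun x => f x * g x) x (l * g x + f x * k).
Proof. intros hf hg; apply (is_derive_mult f g x l k hf hg Rmult_comm). Qed.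

Lemma is_derive_Rpow (N : nat) (x : R) : is_derive (fun x => x ^ N) x (INR N * x ^ pred N).
Proof. auto_derive; auto; ring. Qed.

Lemma is_derive_Rplus (f g : R -> R) (x l k : R) : is_derive f x l -> is_derive g x k ->
  is_derive (fun x => f x + g x) x (l + k).
Proof. intros hf hg; apply (is_derive_plus f g x l k hf hg). Qed.

Lemma is_derive_Rscal (c : R) (f : R -> R) (x l : R) : is_derive f x l ->
  is_derive (fun x => c * f x) x (c * l).
Proof. intros hf; apply (is_derive_scal f x c l hf). Qed.

Lemma is_derive_prof (b : R) (N : nat) (r : R) : is_derive (prof b N) r (prof1 b N r).
Proof.
apply (is_derive_Rmult (fun r => r ^ N) (fun r => radial b N (r ^ 2))).
- apply is_derive_Rpow.
- apply is_derive_sq, is_derive_radial.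
Qed.

Lemma is_derive_prof1 (b : R) (N : nat) (r : R) : is_derive (prof1 b N) r (prof2 b N r).
Proof.
unfold prof1; evar_last.
- apply (is_derive_Rplus (fun r => INR N * r ^ pred N * radial b N (r ^ 2))).
  + apply (is_derive_Rmult (fun r => INR N * r ^ pred N)).
    * apply is_derive_Rscal, is_derive_Rpow.
    * apply is_derive_sq, is_derive_radial.
  + apply (is_derive_Rmult (fun r => r ^ N)); [apply is_derive_Rpow|].
    apply (is_derive_Rmult (fun r => 2 * r)).
    * apply is_derive_Rscal, is_derive_id.
    * apply is_derive_sq, is_derive_radial1.
- unfold prof2, one; simpl; ring.
Qed.

Lemma continuous_prof2 (b : R) (N : nat) (r : R) : continuous (prof2 b N) r.
Proof.
assert (c2 : continuous (fun r => radial2 b N (r ^ 2)) r).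
{ apply (continuous_comp (fun r => r ^ 2)); [|apply continuous_radial2].
  apply (ex_derive_continuous (fun r => r ^ 2)); auto_derive; auto. }
assert (d0 := is_derive_sq _ _ r (is_derive_radial b N)).
assert (d1 := is_derive_sq _ _ r (is_derive_radial1 b N)).
unfold prof2.
apply (continuous_ext (fun r => (INR N * (INR (pred N) * r ^ pred (pred N)) * radial b N (r ^ 2)
  + 2 * (INR N * r ^ pred N) * (2 * r * radial1 b N (r ^ 2))
  + r ^ N * (2 * radial1 b N (r ^ 2))) + (r ^ N * (4 * r ^ 2)) * radial2 b N (r ^ 2))).
{ intros x; apply Rminus_diag_uniq; ring. }
apply (continuous_plus (fun r => INR N * (INR (pred N) * r ^ pred (pred N)) * radial b N (r ^ 2)
  + 2 * (INR N * r ^ pred N) * (2 * r * radial1 b N (r ^ 2))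
  + r ^ N * (2 * radial1 b N (r ^ 2)))).
- apply (ex_derive_continuous (fun r => INR N * (INR (pred N) * r ^ pred (pred N)) * radial b N (r ^ 2)
  + 2 * (INR N * r ^ pred N) * (2 * r * radial1 b N (r ^ 2))
  + r ^ N * (2 * radial1 b N (r ^ 2)))).
  eexists.
  apply (is_derive_Rplus (fun r => INR N * (INR (pred N) * r ^ pred (pred N)) * radial b N (r ^ 2)
  + 2 * (INR N * r ^ pred N) * (2 * r * radial1 b N (r ^ 2)))).
  + apply (is_derive_Rplus (fun r => INR N * (INR (pred N) * r ^ pred (pred N)) * radial b N (r ^ 2))).
    * apply (is_derive_Rmult (fun r => INR N * (INR (pred N) * r ^ pred (pred N)))); [|exact d0].
      do 2 apply is_derive_Rscal; apply is_derive_Rpow.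
    * apply (is_derive_Rmult (fun r => 2 * (INR N * r ^ pred N))).
      -- do 2 apply is_derive_Rscal; apply is_derive_Rpow.
      -- apply (is_derive_Rmult (fun r => 2 * r)); [apply is_derive_Rscal, is_derive_id|exact d1].
  + apply (is_derive_Rmult (fun r => r ^ N)); [apply is_derive_Rpow|].
    apply is_derive_Rscal; exact d1.
- apply (continuous_mult (fun r => r ^ N * (4 * r ^ 2))); [|exact c2].
  apply (ex_derive_continuous (fun r => r ^ N * (4 * r ^ 2))); auto_derive; auto.
Qed.

Lemma prof_ode (b : R) (N : nat) (r : R) :
  r ^ 2 * prof2 b N r + r * prof1 b N r = (INR N - b * r ^ 2) ^ 2 * prof b N r.
Proof.
pose proof (radial_ode b N (r ^ 2)) as O.
unfold prof, prof1, prof2.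
set (h := radial b N (r ^ 2)) in *; set (h1 := radial1 b N (r ^ 2)) in *; set (h2 := radial2 b N (r ^ 2)) in *.
(* Where [pred] truncates, the prefactor [INR N] or [INR (pred N)] is zero, so the power rules hold
   for every [N]. *)
assert (E1 : r * (INR N * r ^ pred N) = INR N * r ^ N) by (destruct N; simpl; ring).
assert (E2 : r ^ 2 * (INR N * (INR (pred N) * r ^ pred (pred N))) = INR N * (INR N - 1) * r ^ N).
{ destruct N as [|[|N]]; simpl; ring. }
transitivity (r ^ 2 * (INR N * (INR (pred N) * r ^ pred (pred N))) * h + r * (INR N * r ^ pred N) * h
  + 4 * r ^ 2 * (r * (INR N * r ^ pred N)) * h1 + r ^ N * r ^ 2 * (4 * r ^ 2 * h2 + 4 * h1)); [ring|].
rewrite E1, E2.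
transitivity (INR N ^ 2 * r ^ N * h + r ^ N * r ^ 2 * (4 * r ^ 2 * h2 + 4 * (INR N + 1) * h1)); [ring|].
rewrite O; ring.
Qed.

(** The radial equation sees [m] and [b] only through [(m - b r^2)^2], so a negative mode in the
    field [b] behaves as the mode [- m] in the field [- b]. *)
Definition mode_field (b : R) (m : Z) : R := if Z_le_dec 0 m then b else - b.
Definition eigenvalue (b : R) (m : Z) : R := lambda (Z.abs_nat m) (mode_field b m).

Lemma mode_sq (b : R) (m : Z) (x : R) :
  (INR (Z.abs_nat m) - mode_field b m * x) ^ 2 = (IZR m - b * x) ^ 2.
Proof.
rewrite INR_IZR_INZ, Zabs2Nat.id_abs; unfold mode_field.
destruct (Z_le_dec 0 m).
- rewrite Z.abs_eq by lia; reflexivity.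
- rewrite Z.abs_neq, opp_IZR by lia; ring.
Qed.

Lemma prof_1 (b : R) (N : nat) : prof b N 1 = radial b N 1.
Proof. unfold prof; rewrite !pow1; ring. Qed.

Lemma prof1_1 (b : R) (N : nat) : prof1 b N 1 = lambda N b * prof b N 1.
Proof.
rewrite prof_1, lambda_radial; unfold prof1; rewrite !pow1; ring.
Qed.

Lemma prof_1_neq_0 (b : R) (N : nat) : prof b N 1 <> 0.
Proof. rewrite prof_1; apply radial_neq_0; lra. Qed.

Lemma filterlim_Rmult (F : (R -> Prop) -> Prop) (f g : R -> R) (a c : R) : Filter F ->
  filterlim f F (locally a) -> filterlim g F (locally c) ->
  filterlim (fun x => f x * g x) F (locally (a * c)).
Proof. intros FF hf hg; eapply filterlim_comp_2; [exact hf|exact hg|apply (filterlim_mult a c)]. Qed.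

Lemma continuous_within (D : R -> Prop) (g : R -> R) (x : R) : continuous g x ->
  filterlim g (within D (locally x)) (locally (g x)).
Proof.
intros C P hP; assert (C' : locally x (fun y => P (g y))) by exact (C P hP).
change (locally x (fun y => D y -> P (g y))).
revert C'; apply filter_imp; auto.
Qed.

(** On each circle the m-th coefficients of the trace and of the radial derivative are in the ratio
    [prof1 / prof]. This ratio has the limit [lambda] at the boundary because [prof] does not vanish
    there. [Psi] and [Phi] are arbitrary, as uniqueness of the heat flow requires. *)
Lemma DN_diag (b : R) (Psi Phi : distr) (m : Z) : DN b Psi Phi ->
  Phi m = (RtoC (eigenvalue b m) * Psi m)%C.
Proof.
intros [v [hv [pde [c1 c2]]]].
set (N := Z.abs_nat m); set (B := mode_field b m).
assert (E : forall r, 0 < r < 1 ->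
  (RtoC (prof B N r) * fourier (radial_deriv v r) m)%C
   = (RtoC (prof1 B N r) * fourier (on_circle v r) m)%C).
{ intros r hr; apply (fourier_radial_deriv b m _ _ (prof2 B N)); auto.
  - apply is_derive_prof.
  - apply is_derive_prof1.
  - apply continuous_prof2.
  - intros s; rewrite prof_ode; unfold B, N; rewrite mode_sq; reflexivity. }
assert (near : at_left 1 (fun r => 0 < r < 1)).
{ exists (mkposreal 1 Rlt_0_1); intros y hy hy1.
  unfold ball in hy; simpl in hy; unfold AbsRing_ball, abs, minus, plus, opp in hy; simpl in hy.
  apply Rabs_lt_between in hy; lra. }
assert (cp : forall g g1 : R -> R, (forall r, is_derive g r (g1 r)) ->
  filterlim g (at_left 1) (locally (g 1))).
{ intros g g1 hg; apply continuous_within, (ex_derive_continuous g); eexists; apply hg. }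
pose proof (cp _ _ (is_derive_prof B N)) as l0.
pose proof (cp _ _ (is_derive_prof1 B N)) as l1.
(* The functional [p] stands for [Re] and [Im], which are real-linear; both sides are limits of the
   same function of [r], whence equality. *)
assert (U : forall p : C -> R,
  (forall a z, p (RtoC a * z)%C = a * p z) ->
  filterlim (fun r => p (fourier (radial_deriv v r) m)) (at_left 1) (locally (p (Phi m))) ->
  filterlim (fun r => p (fourier (on_circle v r) m)) (at_left 1) (locally (p (Psi m))) ->
  p (Phi m) = eigenvalue b m * p (Psi m)).
{ intros p hp h2 h1.
  assert (K : prof B N 1 * p (Phi m) = prof1 B N 1 * p (Psi m)).
  { apply (filterlim_locally_unique (F := at_left 1)
      (fun r => prof B N r * p (fourier (radial_deriv v r) m))).
    - apply filterlim_Rmult; [typeclasses eauto|exact l0|exact h2].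
    - apply (filterlim_ext_loc (fun r => prof1 B N r * p (fourier (on_circle v r) m))).
      + revert near; apply filter_imp; intros r hr; rewrite <- !hp, E by exact hr; reflexivity.
      + apply filterlim_Rmult; [typeclasses eauto|exact l1|exact h1]. }
  rewrite prof1_1 in K; fold N B in K.
  unfold eigenvalue; fold N B.
  apply Rmult_eq_reg_l with (prof B N 1); [lra|apply prof_1_neq_0]. }
assert (R1 := U Re ltac:(intros; unfold Cmult, RtoC, Re; simpl; ring)
  (cvg_Hs_Re _ _ _ _ m _ c2) (cvg_Hs_Re _ _ _ _ m _ c1)).
assert (R2 := U Im ltac:(intros; unfold Cmult, RtoC, Im; simpl; ring)
  (cvg_Hs_Im _ _ _ _ m _ c2) (cvg_Hs_Im _ _ _ _ m _ c1)).
destruct (Phi m) as [p1 p2], (Psi m) as [q1 q2]; simpl in R1, R2.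
rewrite RtoC_mult_pair, R1, R2; reflexivity.
Qed.

(** * The solution with a single Fourier mode *)

Lemma C1_disk_cont (u ux uy : R -> R -> R) (x y : R) : C1_disk u ux uy -> in_disk x y ->
  continuity_2d_pt u x y.
Proof.
intros hu hxy; apply differentiable_continuity_pt; eexists; eexists.
apply C1_disk_differentiable with (1 := hu), hxy.
Qed.

Lemma C1_disk_mult (u ux uy w wx wy : R -> R -> R) : C1_disk u ux uy -> C1_disk w wx wy ->
  C1_disk (fun x y => u x y * w x y) (fun x y => ux x y * w x y + u x y * wx x y)
    (fun x y => uy x y * w x y + u x y * wy x y).
Proof.
intros hu hw x y hxy.
pose proof (C1_disk_cont _ _ _ x y hu hxy); pose proof (C1_disk_cont _ _ _ x y hw hxy).
destruct (hu x y hxy) as [a [c [d e]]]; destruct (hw x y hxy) as [a' [c' [d' e']]].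
split; [|split; [|split]].
- apply (is_derive_Rmult (fun z => u z y) (fun z => w z y)); assumption.
- apply (is_derive_Rmult (fun z => u x z) (fun z => w x z)); assumption.
- apply continuity_2d_pt_plus; apply continuity_2d_pt_mult; assumption.
- apply continuity_2d_pt_plus; apply continuity_2d_pt_mult; assumption.
Qed.

Lemma C1_disk_plus (u ux uy w wx wy : R -> R -> R) : C1_disk u ux uy -> C1_disk w wx wy ->
  C1_disk (fun x y => u x y + w x y) (fun x y => ux x y + wx x y) (fun x y => uy x y + wy x y).
Proof.
intros hu hw x y hxy.
destruct (hu x y hxy) as [a [c [d e]]]; destruct (hw x y hxy) as [a' [c' [d' e']]].
split; [|split; [|split]].
- apply (is_derive_Rplus (fun z => u z y) (fun z => w z y)); assumption.
- apply (is_derive_Rplus (fun z => u x z) (fun z => w x z)); assumption.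
- apply continuity_2d_pt_plus; assumption.
- apply continuity_2d_pt_plus; assumption.
Qed.

Lemma C1_disk_scal (k : R) (u ux uy : R -> R -> R) : C1_disk u ux uy ->
  C1_disk (fun x y => k * u x y) (fun x y => k * ux x y) (fun x y => k * uy x y).
Proof.
intros hu x y hxy; destruct (hu x y hxy) as [a [c [d e]]].
split; [|split; [|split]].
- apply (is_derive_Rscal k (fun z => u z y)); assumption.
- apply (is_derive_Rscal k (fun z => u x z)); assumption.
- apply continuity_2d_pt_mult; [apply continuity_2d_pt_const|assumption].
- apply continuity_2d_pt_mult; [apply continuity_2d_pt_const|assumption].
Qed.

(** [ex_diff_n] is built on [Derive], which agrees with the explicit partial derivatives only in the
    disk; the transfer works because the disk is open. *)
Lemma C1_ex_diff_2 (u ux uy uxx uxy uyx uyy : R -> R -> R) (x y : R) : C1_disk u ux uy ->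
  C1_disk ux uxx uxy -> C1_disk uy uyx uyy -> in_disk x y -> ex_diff_n u 2 x y.
Proof.
assert (one : forall w wx wy : R -> R -> R, C1_disk w wx wy -> forall x y, in_disk x y ->
  ex_diff_n w 1 x y).
{ intros w wx wy hw s t h; destruct (hw s t h) as [a [c [d e]]].
  pose proof (in_disk_open s t h) as O.
  split; [apply (C1_disk_cont w wx wy); assumption|].
  split; [eexists; eassumption|split; [eexists; eassumption|split; (split; [|exact I])]].
  - apply (continuity_2d_pt_ext_loc wx); [|assumption].
    revert O; apply locally_2d_impl, locally_2d_forall; intros p q hpq; symmetry.
    apply is_derive_unique, (hw p q hpq).
  - apply (continuity_2d_pt_ext_loc wy); [|assumption].
    revert O; apply locally_2d_impl, locally_2d_forall; intros p q hpq; symmetry.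
    apply is_derive_unique, (hw p q hpq). }
intros hu hx hy h; destruct (hu x y h) as [a [c [d e]]].
pose proof (in_disk_open x y h) as O.
split; [apply (C1_disk_cont u ux uy); assumption|].
split; [eexists; eassumption|split; [eexists; eassumption|split]].
- apply (ex_diff_n_ext_loc ux); [|apply (one _ _ _ hx), h].
  revert O; apply locally_2d_impl, locally_2d_forall; intros p q hpq; symmetry.
  apply is_derive_unique, (hu p q hpq).
- apply (ex_diff_n_ext_loc uy); [|apply (one _ _ _ hy), h].
  revert O; apply locally_2d_impl, locally_2d_forall; intros p q hpq; symmetry.
  apply is_derive_unique, (hu p q hpq).
Qed.

(* [(x + i s y) ^ N], for [s = 1] or [s = -1]. *)
Fixpoint zpow (s : R) (N : nat) (x y : R) : R * R :=
  match N with
  | O => (1, 0)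
  | S k => (x * fst (zpow s k x y) - s * y * snd (zpow s k x y),
            x * snd (zpow s k x y) + s * y * fst (zpow s k x y))
  end.
Definition zre (s : R) (N : nat) (x y : R) : R := fst (zpow s N x y).
Definition zim (s : R) (N : nat) (x y : R) : R := snd (zpow s N x y).

(** Euler's identity [x u_x + y u_y = N u] for the homogeneous polynomial [zre s N], with its
    derivatives already inserted. The factor [INR N] covers [N = 0], where [pred] truncates. *)
Lemma zre_euler (s : R) (N : nat) (x y : R) :
  x * (INR N * zre s (pred N) x y) - s * y * (INR N * zim s (pred N) x y) = INR N * zre s N x y.
Proof. destruct N as [|N]; [simpl; ring|]; unfold zre, zim; simpl zpow; simpl pred; simpl fst; ring. Qed.

Lemma zim_euler (s : R) (N : nat) (x y : R) :
  x * (INR N * zim s (pred N) x y) + s * y * (INR N * zre s (pred N) x y) = INR N * zim s N x y.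
Proof. destruct N as [|N]; [simpl; ring|]; unfold zre, zim; simpl zpow; simpl pred; simpl snd; ring. Qed.

(** For [s = 1] these are the Cauchy-Riemann formulas for [z^N], for [s = -1] those for its
    conjugate. In the induction Euler's identity turns the derivative of the product back into a
    multiple of the N-th power. *)
Lemma is_derive_zpow (s : R) (N : nat) (x y : R) :
  (is_derive (fun z => zre s N z y) x (INR N * zre s (pred N) x y) /\
   is_derive (fun z => zim s N z y) x (INR N * zim s (pred N) x y)) /\
  (is_derive (fun z => zre s N x z) y (- s * (INR N * zim s (pred N) x y)) /\
   is_derive (fun z => zim s N x z) y (s * (INR N * zre s (pred N) x y))).
Proof.
induction N as [|N IH].
- unfold zre, zim; simpl; split_all; auto_derive; auto; ring.
- destruct IH as [[a c] [d e]].
  pose proof (zre_euler s N x y) as E1; pose proof (zim_euler s N x y) as E2.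
  assert (X : forall g : R -> R, forall l, is_derive g x l -> is_derive (fun z => z * g z) x (g x + x * l)).
  { intros g l hg; evar_last; [apply (is_derive_Rmult (fun z => z) g); [apply is_derive_id|exact hg]|].
    unfold one; simpl; ring. }
  assert (Y : forall g : R -> R, forall l, is_derive g y l -> is_derive (fun z => s * z * g z) y (s * g y + s * y * l)).
  { intros g l hg; evar_last; [apply (is_derive_Rmult (fun z => s * z) g); [apply is_derive_Rscal, is_derive_id|exact hg]|].
    unfold one; simpl; ring. }
  rewrite S_INR; simpl pred.
  change (fun z => zre s (S N) z y) with (fun z => z * zre s N z y - s * y * zim s N z y).
  change (fun z => zim s (S N) z y) with (fun z => z * zim s N z y + s * y * zre s N z y).
  change (fun z => zre s (S N) x z) with (fun z => x * zre s N x z - s * z * zim s N x z).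
  change (fun z => zim s (S N) x z) with (fun z => x * zim s N x z + s * z * zre s N x z).
  split; split.
  + evar_last; [apply (is_derive_minus (fun z => z * zre s N z y) (fun z => s * y * zim s N z y));
      [apply X, a|apply is_derive_Rscal, c]|].
    unfold minus, plus, opp; simpl; lra.
  + evar_last; [apply (is_derive_Rplus (fun z => z * zim s N z y) (fun z => s * y * zre s N z y));
      [apply X, c|apply is_derive_Rscal, a]|]. simpl; lra.
  + evar_last; [apply (is_derive_minus (fun z => x * zre s N x z) (fun z => s * z * zim s N x z));
      [apply is_derive_Rscal, d|apply Y, e]|].
    unfold minus, plus, opp; simpl.
    transitivity (- s * (zim s N x y + (x * (INR N * zim s (pred N) x y) + s * y * (INR N * zre s (pred N) x y))));
      [ring|rewrite E2; ring].
  + evar_last; [apply (is_derive_Rplus (fun z => x * zim s N x z) (fun z => s * z * zre s N x z));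
      [apply is_derive_Rscal, e|apply Y, d]|].
    simpl.
    transitivity (s * (zre s N x y + (x * (INR N * zre s (pred N) x y) - s * y * (INR N * zim s (pred N) x y))));
      [ring|rewrite E1; ring].
Qed.

Lemma continuity_zpow (s : R) (N : nat) (x y : R) :
  continuity_2d_pt (zre s N) x y /\ continuity_2d_pt (zim s N) x y.
Proof.
induction N as [|N [IH1 IH2]]; [split; [exact (continuity_2d_pt_const x y 1)|exact (continuity_2d_pt_const x y 0)]|].
split.
- apply (continuity_2d_pt_minus (fun x y => x * zre s N x y) (fun x y => s * y * zim s N x y));
  repeat apply continuity_2d_pt_mult; auto using continuity_2d_pt_id1, continuity_2d_pt_id2, continuity_2d_pt_const.
- apply (continuity_2d_pt_plus (fun x y => x * zim s N x y) (fun x y => s * y * zre s N x y));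
  repeat apply continuity_2d_pt_mult; auto using continuity_2d_pt_id1, continuity_2d_pt_id2, continuity_2d_pt_const.
Qed.

Lemma C1_disk_zre (s : R) (N : nat) : C1_disk (zre s N)
  (fun x y => INR N * zre s (pred N) x y) (fun x y => - s * (INR N * zim s (pred N) x y)).
Proof.
intros x y _; destruct (is_derive_zpow s N x y) as [[a c] [d e]].
pose proof (continuity_zpow s (pred N) x y) as [k1 k2].
split; [exact a|split; [exact d|split]];
  repeat apply continuity_2d_pt_mult; auto using continuity_2d_pt_const.
Qed.

Lemma C1_disk_zim (s : R) (N : nat) : C1_disk (zim s N)
  (fun x y => INR N * zim s (pred N) x y) (fun x y => s * (INR N * zre s (pred N) x y)).
Proof.
intros x y _; destruct (is_derive_zpow s N x y) as [[a c] [d e]].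
pose proof (continuity_zpow s (pred N) x y) as [k1 k2].
split; [exact c|split; [exact e|split]];
  repeat apply continuity_2d_pt_mult; auto using continuity_2d_pt_const.
Qed.

Lemma zpow_polar (s : R) (N : nat) (r th : R) : s ^ 2 = 1 ->
  zre s N (r * cos th) (r * sin th) = r ^ N * cos (INR N * th) /\
  zim s N (r * cos th) (r * sin th) = s * (r ^ N * sin (INR N * th)).
Proof.
intros hs; induction N as [|N [IH1 IH2]].
- unfold zre, zim; simpl; rewrite Rmult_0_l, cos_0, sin_0; split; ring.
- unfold zre, zim in *; simpl zpow; simpl fst; simpl snd; rewrite IH1, IH2, S_INR.
  replace ((INR N + 1) * th) with (INR N * th + th) by ring.
  rewrite cos_plus, sin_plus; simpl pow; split; [|ring].
  transitivity (r * r ^ N * (cos (INR N * th) * cos th) - s ^ 2 * (r * r ^ N * (sin (INR N * th) * sin th)));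
   [ring|rewrite hs; ring].
Qed.

Lemma C1_disk_sq (g g1 : R -> R) : (forall s, is_derive g s (g1 s)) -> (forall s, continuous g1 s) ->
  C1_disk (fun x y => g (x ^ 2 + y ^ 2)) (fun x y => 2 * x * g1 (x ^ 2 + y ^ 2))
    (fun x y => 2 * y * g1 (x ^ 2 + y ^ 2)).
Proof.
intros dg cg x y _.
assert (c : continuity_2d_pt (fun x y => g1 (x ^ 2 + y ^ 2)) x y).
{ apply (continuity_1d_2d_pt_comp g1 (fun x y => x ^ 2 + y ^ 2)).
  - apply continuity_pt_filterlim, cg.
  - apply (continuity_2d_pt_ext (fun x y => x * x + y * y)); [intros; ring|].
    apply continuity_2d_pt_plus; apply continuity_2d_pt_mult; (apply continuity_2d_pt_id1 || apply continuity_2d_pt_id2). }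
split; [|split; [|split]].
- apply (is_derive_comp g (fun z => z ^ 2 + y ^ 2)); [apply dg|auto_derive; auto; ring].
- apply (is_derive_comp g (fun z => x ^ 2 + z ^ 2)); [apply dg|auto_derive; auto; ring].
- repeat apply continuity_2d_pt_mult; auto using continuity_2d_pt_id1, continuity_2d_pt_const.
- repeat apply continuity_2d_pt_mult; auto using continuity_2d_pt_id2, continuity_2d_pt_const.
Qed.

Lemma C1_disk_x : C1_disk (fun x _ => 2 * x) (fun _ _ => 2) (fun _ _ => 0).
Proof.
intros x y _; split; [|split; [|split]]; try apply continuity_2d_pt_const; auto_derive; auto; ring.
Qed.

Lemma C1_disk_y : C1_disk (fun _ y => 2 * y) (fun _ _ => 0) (fun _ _ => 2).
Proof.
intros x y _; split; [|split; [|split]]; try apply continuity_2d_pt_const; auto_derive; auto; ring.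
Qed.

Lemma RInt_cos_Z (a : R) (k : Z) :
  RInt (fun th => a * cos (IZR k * th)) 0 (2 * PI) = if Z.eq_dec k 0 then 2 * PI * a else 0.
Proof.
destruct (Z.eq_dec k 0) as [->|hk].
- rewrite (RInt_ext_R _ (fun _ => a)).
  + rewrite RInt_const; unfold scal; simpl; unfold mult; simpl; ring.
  + intros x; rewrite Rmult_0_l, cos_0; ring.
- assert (hk' : IZR k <> 0) by (apply not_0_IZR, hk).
  apply is_RInt_unique.
  replace 0 with (minus (a * sin (IZR k * (2 * PI)) / IZR k) (a * sin (IZR k * 0) / IZR k)) at 2.
  + apply (is_RInt_derive (fun th => a * sin (IZR k * th) / IZR k)); intros x _.
    * auto_derive; auto; field; auto.
    * apply (ex_derive_continuous (fun th => a * cos (IZR k * th))); auto_derive; auto.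
  + rewrite sin_2PI_Z, !Rmult_0_r, sin_0; unfold minus, plus, opp; simpl; field; auto.
Qed.

Lemma RInt_sin_Z (a : R) (k : Z) : RInt (fun th => a * sin (IZR k * th)) 0 (2 * PI) = 0.
Proof.
destruct (Z.eq_dec k 0) as [->|hk].
- rewrite (RInt_ext_R _ (fun _ => 0)).
  + rewrite RInt_const; unfold scal; simpl; unfold mult; simpl; ring.
  + intros x; rewrite Rmult_0_l, sin_0; ring.
- assert (hk' : IZR k <> 0) by (apply not_0_IZR, hk).
  apply is_RInt_unique.
  replace 0 with (minus (- a * cos (IZR k * (2 * PI)) / IZR k) (- a * cos (IZR k * 0) / IZR k)) at 2.
  + apply (is_RInt_derive (fun th => - a * cos (IZR k * th) / IZR k)); intros x _.
    * auto_derive; auto; field; auto.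
    * apply (ex_derive_continuous (fun th => a * sin (IZR k * th))); auto_derive; auto.
  + rewrite cos_2PI_Z, !Rmult_0_r, cos_0; unfold minus, plus, opp; simpl; field; auto.
Qed.

Lemma fourier_mode (a : R) (m : Z) :
  fourier (fun th => (a * cos (IZR m * th), a * sin (IZR m * th))) = single m (RtoC a).
Proof.
apply functional_extensionality; intros k; unfold fourier; cbv zeta.
pose proof PI_RGT_0.
rewrite (RInt_ext_R _ (fun th => a * cos (IZR (m - k) * th))).
2: { intros th; rewrite minus_IZR, Rmult_minus_distr_r, cos_minus; unfold Cmult, Re; simpl; ring. }
rewrite (RInt_ext_R (fun th => Im _) (fun th => a * sin (IZR (m - k) * th))).
2: { intros th; rewrite minus_IZR, Rmult_minus_distr_r, sin_minus; unfold Cmult, Im; simpl; ring. }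
rewrite RInt_cos_Z, RInt_sin_Z; unfold single, RtoC.
destruct (Z.eq_dec (m - k) 0), (Z.eq_dec k m); try lia; f_equal; field; lra.
Qed.

(** On [z^N g(|z|^2)] the angular derivative acts as multiplication by [i N]; conjugating [z]
    changes its sign, which amounts to replacing [b] by [s * b]. What remains is the radial equation
    in the variable [x ^ 2 + y ^ 2]. *)
Lemma mag_mode_solution (b s : R) (N : nat) (g g1 g2 : R -> R) : s = 1 \/ s = -1 ->
  (forall x, is_derive g x (g1 x)) -> (forall x, is_derive g1 x (g2 x)) ->
  (forall x, continuous g2 x) ->
  (forall x, 4 * x * g2 x + 4 * (INR N + 1) * g1 x = ((s * b) ^ 2 * x - 2 * INR N * (s * b)) * g x) ->
  let v := fun x y => (zre s N x y * g (x ^ 2 + y ^ 2), zim s N x y * g (x ^ 2 + y ^ 2)) in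
  C2_disk v /\ forall x y, in_disk x y -> mag_laplacian b v x y = RtoC 0.
Proof.
intros hs dg dg1 cg2 ode v.
assert (cg1 : forall x, continuous g1 x).
{ intros x; apply (ex_derive_continuous g1); eexists; apply dg1. }
pose proof (C1_disk_sq g g1 dg cg1) as H0.
pose proof (C1_disk_sq g1 g2 dg1 cg2) as H1.
pose proof (C1_disk_zre s N) as A0; pose proof (C1_disk_zim s N) as B0.
pose proof (C1_disk_scal (INR N) _ _ _ (C1_disk_zre s (pred N))) as A1.
pose proof (C1_disk_scal (INR N) _ _ _ (C1_disk_zim s (pred N))) as B1.
pose proof (C1_disk_mult _ _ _ _ _ _ A0 H0) as h1.
pose proof (C1_disk_mult _ _ _ _ _ _ B0 H0) as h2.
pose proof (C1_disk_mult _ _ _ _ _ _ C1_disk_x H1) as X1.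
pose proof (C1_disk_mult _ _ _ _ _ _ C1_disk_y H1) as Y1.
pose proof (C1_disk_plus _ _ _ _ _ _ (C1_disk_mult _ _ _ _ _ _ A1 H0) (C1_disk_mult _ _ _ _ _ _ A0 X1)) as h1x.
pose proof (C1_disk_plus _ _ _ _ _ _ (C1_disk_mult _ _ _ _ _ _ (C1_disk_scal (- s) _ _ _ B1) H0)
   (C1_disk_mult _ _ _ _ _ _ A0 Y1)) as h1y.
pose proof (C1_disk_plus _ _ _ _ _ _ (C1_disk_mult _ _ _ _ _ _ B1 H0) (C1_disk_mult _ _ _ _ _ _ B0 X1)) as h2x.
pose proof (C1_disk_plus _ _ _ _ _ _ (C1_disk_mult _ _ _ _ _ _ (C1_disk_scal s _ _ _ A1) H0)
   (C1_disk_mult _ _ _ _ _ _ B0 Y1)) as h2y.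
split.
- intros x y hxy; split.
  + exact (C1_ex_diff_2 _ _ _ _ _ _ _ x y h1 h1x h1y hxy).
  + exact (C1_ex_diff_2 _ _ _ _ _ _ _ x y h2 h2x h2y hxy).
- intros x y hxy.
  rewrite (mag_laplacian_eq b v _ _ _ _ _ _ _ _ _ _ _ _ x y h1 h1x h1y h2 h2x h2y hxy).
  pose proof (zre_euler s N x y) as E1; pose proof (zim_euler s N x y) as E2.
  pose proof (ode (x ^ 2 + y ^ 2)) as O.
  unfold v, RtoC, Re, Im; cbn [fst snd].
  set (A := zre s N x y) in *; set (B := zim s N x y) in *.
  set (A' := zre s (pred N) x y) in *; set (B' := zim s (pred N) x y) in *.
  set (A2 := zre s (pred (pred N)) x y); set (B2 := zim s (pred (pred N)) x y).
  set (G := g _) in *; set (G1 := g1 _) in *; set (G2 := g2 _) in *.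
  set (n := INR N) in *; set (k := INR (pred N)).
  assert (hs2 : s ^ 2 = 1) by (destruct hs as [-> | ->]; ring).
  f_equal.
  (* The terms are grouped so that Euler's identity and then the radial equation apply. The
     multiples of [1 - s ^ 2] appear because [zre s N] is harmonic thanks to [s ^ 2 = 1]. *)
  + transitivity (- ((1 - s ^ 2) * (n * k * A2 * G)
      + (x * (n * A') - s * y * (n * B')) * (4 * G1 + 2 * b * s * G)
      + (s ^ 2 - 1) * (2 * b * y * n * B' * G) + A * (4 * G1 + 4 * (x ^ 2 + y ^ 2) * G2)
      - b ^ 2 * (x ^ 2 + y ^ 2) * A * G)); [ring|].
    rewrite E1.
    transitivity (- ((1 - s ^ 2) * (n * k * A2 * G) + (s ^ 2 - 1) * (2 * b * y * n * B' * G)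
      + A * ((4 * (x ^ 2 + y ^ 2) * G2 + 4 * (n + 1) * G1) + 2 * b * s * n * G - b ^ 2 * (x ^ 2 + y ^ 2) * G)));
      [ring|].
    rewrite O, Rpow_mult_distr, hs2; ring.
  + transitivity (- ((1 - s ^ 2) * (n * k * B2 * G)
      + (x * (n * B') + s * y * (n * A')) * (4 * G1 + 2 * b * s * G)
      + (1 - s ^ 2) * (2 * b * y * n * A' * G) + B * (4 * G1 + 4 * (x ^ 2 + y ^ 2) * G2)
      - b ^ 2 * (x ^ 2 + y ^ 2) * B * G)); [ring|].
    rewrite E2.
    transitivity (- ((1 - s ^ 2) * (n * k * B2 * G) + (1 - s ^ 2) * (2 * b * y * n * A' * G)
      + B * ((4 * (x ^ 2 + y ^ 2) * G2 + 4 * (n + 1) * G1) + 2 * b * s * n * G - b ^ 2 * (x ^ 2 + y ^ 2) * G)));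
      [ring|].
    rewrite O, Rpow_mult_distr, hs2; ring.
Qed.

(** All traces of the explicit solution are multiples of one mode, so convergence in either Sobolev
    space reduces to convergence of one real number. *)
Lemma DN_single (b c : R) (m : Z) :
  DN b (single m (RtoC c)) (single m (RtoC (eigenvalue b m * c))).
Proof.
set (N := Z.abs_nat m); set (B := mode_field b m).
set (s := if Z_le_dec 0 m then 1 else -1).
assert (hs : s = 1 \/ s = -1) by (unfold s; destruct (Z_le_dec 0 m); auto).
assert (hs2 : s ^ 2 = 1) by (destruct hs as [-> | ->]; ring).
assert (hB : s * b = B) by (unfold s, B, mode_field; destruct (Z_le_dec 0 m); ring).
assert (hm : IZR m = s * INR N).
{ unfold N, s; rewrite INR_IZR_INZ, Zabs2Nat.id_abs; destruct (Z_le_dec 0 m).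
  - rewrite Z.abs_eq by lia; ring.
  - rewrite Z.abs_neq, opp_IZR by lia; ring. }
pose proof (prof_1_neq_0 B N) as p1.
(* Normalises the profile to the value [c] on the boundary; the division is legitimate because
   [prof] is nonzero at 1. *)
set (kap := c / prof B N 1).
destruct (mag_mode_solution b s N (fun x => kap * radial B N x) (fun x => kap * radial1 B N x)
  (fun x => kap * radial2 B N x) hs) as [hv pde].
{ intros x; apply is_derive_Rscal, is_derive_radial. }
{ intros x; apply is_derive_Rscal, is_derive_radial1. }
{ intros x; apply (continuous_mult (fun _ => kap)); [apply continuous_const|apply continuous_radial2]. }
{ intros x; rewrite hB; pose proof (radial_ode B N x) as O.
  transitivity (kap * (4 * x * radial2 B N x + 4 * (INR N + 1) * radial1 B N x)); [ring|rewrite O; ring]. }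
set (v := fun x y : R => _) in hv, pde.
assert (oc : forall r th, on_circle v r th =
  (kap * prof B N r * cos (IZR m * th), kap * prof B N r * sin (IZR m * th))).
{ intros r th; unfold on_circle, v.
  destruct (zpow_polar s N r th hs2) as [-> ->].
  replace ((r * cos th) ^ 2 + (r * sin th) ^ 2) with (r ^ 2 * ((sin th)² + (cos th)²))
    by (unfold Rsqr; ring).
  rewrite sin2_cos2, Rmult_1_r; unfold prof; rewrite hm.
  destruct hs as [-> | ->].
  - replace (1 * INR N * th) with (INR N * th) by ring; f_equal; ring.
  - replace (-1 * INR N * th) with (- (INR N * th)) by ring.
    rewrite cos_neg, sin_neg; f_equal; ring. }
assert (rd : forall r th, radial_deriv v r th =
  (kap * prof1 B N r * cos (IZR m * th), kap * prof1 B N r * sin (IZR m * th))).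
{ intros r th; unfold radial_deriv, DeriveC.
  assert (D : forall k, Derive (fun rho => kap * prof B N rho * k) r = kap * prof1 B N r * k).
  { intros k; apply is_derive_unique.
    apply (is_derive_ext (fun rho => k * (kap * prof B N rho))); [intros; apply Rmult_comm|].
    rewrite (Rmult_comm _ k); apply is_derive_Rscal, is_derive_Rscal, is_derive_prof. }
  f_equal; rewrite <- D; apply Derive_ext; intros rho; rewrite oc; reflexivity. }
assert (lim : forall g g1 : R -> R, (forall r, is_derive g r (g1 r)) ->
  filterlim (fun r => kap * g r) (at_left 1) (locally (kap * g 1))).
{ intros g g1 hg; apply (continuous_within (fun r => r < 1) (fun r => kap * g r)).
  apply (ex_derive_continuous (fun r => kap * g r)); eexists; apply is_derive_Rscal, hg. }
exists v; split; [exact hv|split; [exact pde|split]].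
- replace (fun r => fourier (on_circle v r)) with (fun r => single m (RtoC (kap * prof B N r))).
  + replace c with (kap * prof B N 1) by (unfold kap; field; auto).
    apply cvg_Hs_single; [typeclasses eauto|apply (lim _ _ (is_derive_prof B N))].
  + apply functional_extensionality; intros r; rewrite <- fourier_mode; f_equal.
    apply functional_extensionality; intros th; rewrite oc; reflexivity.
- replace (fun r => fourier (radial_deriv v r)) with (fun r => single m (RtoC (kap * prof1 B N r))).
  + replace (eigenvalue b m * c) with (kap * prof1 B N 1).
    * apply cvg_Hs_single; [typeclasses eauto|apply (lim _ _ (is_derive_prof1 B N))].
    * rewrite prof1_1; unfold eigenvalue, kap; fold N B; field; auto.
  + apply functional_extensionality; intros r; rewrite <- fourier_mode; f_equal.
    apply functional_extensionality; intros th; rewrite rd; reflexivity.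
Qed.

(** * The heat flow *)

Lemma ball_R (x y e : R) : ball x e y <-> Rabs (y - x) < e.
Proof. reflexivity. Qed.

Lemma is_derive_quotient (c : R -> R) (t l : R) :
  is_derive c t l <-> filterlim (fun s => (c s - c t) / (s - t)) (locally' t) (locally l).
Proof.
rewrite is_derive_Reals; split.
- intros h; apply filterlim_locally; intros e.
  destruct (h e (cond_pos e)) as [d hd]; exists d; intros s hs hst.
  apply ball_R; apply ball_R in hs.
  specialize (hd (s - t) ltac:(lra) hs).
  rewrite Rplus_minus in hd; exact hd.
- intros h e he.
  destruct (proj1 (filterlim_locally _ _) h (mkposreal e he)) as [d hd]; exists d; intros k hk hkd.
  specialize (hd (t + k)).
  rewrite !ball_R in hd; simpl in hd.
  replace (t + k - t) with k in hd by ring.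
  apply hd; [exact hkd|intros E; apply hk; change (t + k = t) in E; lra].
Qed.

Lemma heat_flow_coef (b t : R) (Psi : distr) (u : R -> distr) (n : Z) : 0 < t ->
  heat_flow (DN b) Psi u -> u t n = (RtoC (exp (- t * eigenvalue b n)) * Psi n)%C.
Proof.
intros ht [_ [_ [h0 hd]]].
set (l := eigenvalue b n).
(* Both the real and the complex inverse of 0 are 0, so the formula holds for [x = 0] too. This
   allows a pointwise replacement of the difference quotient, including at [s = t]. *)
assert (Cdiv_R : forall (z : C) (x : R), (z / RtoC x)%C = (Re z / x, Im z / x)).
{ intros [z1 z2] x; unfold Cdiv, Cmult, Cinv, RtoC, Re, Im; simpl.
  destruct (Req_dec x 0) as [-> | hx].
  - rewrite ?Rmult_0_l, ?Rplus_0_r; unfold Rdiv; rewrite Rinv_0; f_equal; ring.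
  - f_equal; field; auto. }
assert (U : forall p : C -> R,
  (forall z w : C, forall x : R, p ((z - w) / RtoC x)%C = (p z - p w) / x) ->
  (forall (a : R) (z : C), p (- (RtoC a * z))%C = - (a * p z)) ->
  filterlim (fun s => p (u s n)) (at_right 0) (locally (p (Psi n))) ->
  (forall s Phi, 0 < s -> cvg_Hs 0 (fun s' n => ((u s' n - u s n) / RtoC (s' - s))%C)
       (locally' s) (fun n => (- Phi n)%C) ->
   filterlim (fun s' => p ((u s' n - u s n) / RtoC (s' - s))%C) (locally' s) (locally (p (- Phi n)%C))) ->
  p (u t n) = exp (- t * l) * p (Psi n)).
{ intros p pq pm l0 ld.
  assert (D : forall s, 0 < s -> is_derive (fun s => p (u s n)) s (- (l * p (u s n)))).
  { intros s hs; destruct (hd s hs) as [Phi [hPhi hq]].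
    specialize (ld s Phi hs hq).
    rewrite (DN_diag b (u s) Phi n hPhi), pm in ld; fold l in ld.
    apply is_derive_quotient.
    revert ld; apply filterlim_ext; intros s'; apply pq. }
  (* Integrating factor: [w] is constant on [s > 0], and its limit at [0+] is the initial
     coefficient. *)
  set (w := fun s => p (u s n) * exp (l * s)).
  assert (W : forall s, 0 < s -> is_derive w s 0).
  { intros s hs.
    replace 0 with (- (l * p (u s n)) * exp (l * s) + p (u s n) * (l * exp (l * s))) by ring.
    apply (is_derive_Rmult (fun s => p (u s n)) (fun s => exp (l * s))); [apply D, hs|].
    auto_derive; auto; ring. }
  assert (E : w t = p (Psi n) * exp (l * 0)).
  { apply (filterlim_locally_unique (F := at_right 0) w).
    - apply (filterlim_ext_loc (fun _ => w t)); [|apply filterlim_const].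
      exists (mkposreal t ht); intros s hs hs0; apply ball_R in hs; change (Rabs (s - 0) < t) in hs.
      rewrite Rminus_0_r, Rabs_pos_eq in hs by lra.
      symmetry; apply derive_0_eq; [lra|]; intros x hx; apply W; lra.
    - apply filterlim_Rmult; [typeclasses eauto|exact l0|].
      apply (continuous_within (fun s => 0 < s) (fun s => exp (l * s))).
      apply (ex_derive_continuous (fun s => exp (l * s))); auto_derive; auto. }
  unfold w in E; rewrite Rmult_0_r, exp_0, Rmult_1_r in E; rewrite <- E.
  rewrite (Rmult_comm (exp _)), Rmult_assoc, <- exp_plus.
  replace (l * t + - t * l) with 0 by ring; rewrite exp_0; ring. }
assert (R1 : Re (u t n) = exp (- t * l) * Re (Psi n)).
{ apply U.
  - intros z w x; rewrite Cdiv_R; reflexivity.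
  - intros a z; unfold Copp, Cmult, RtoC, Re; simpl; ring.
  - apply (cvg_Hs_Re 0); [typeclasses eauto|exact h0].
  - intros s Phi hs hq; exact (cvg_Hs_Re 0 _ _ _ n _ hq). }
assert (R2 : Im (u t n) = exp (- t * l) * Im (Psi n)).
{ apply U.
  - intros z w x; rewrite Cdiv_R; reflexivity.
  - intros a z; unfold Copp, Cmult, RtoC, Im; simpl; ring.
  - apply (cvg_Hs_Im 0); [typeclasses eauto|exact h0].
  - intros s Phi hs hq; exact (cvg_Hs_Im 0 _ _ _ n _ hq). }
destruct (u t n) as [p1 p2], (Psi n) as [q1 q2]; simpl in R1, R2.
rewrite RtoC_mult_pair, R1, R2; reflexivity.
Qed.

Lemma heat_flow_single (b : R) (m : Z) :
  heat_flow (DN b) (expi m) (fun t => single m (RtoC (exp (- t * eigenvalue b m)))).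
Proof.
set (l := eigenvalue b m).
assert (D : forall t, is_derive (fun t => exp (- t * l)) t (- (l * exp (- t * l)))).
{ intros t; auto_derive; auto; ring. }
split; [|split; [|split]].
- intros n; rewrite Ropp_0, Rmult_0_l, exp_0; reflexivity.
- intros t _; apply in_Hs_single.
- rewrite expi_single; replace 1 with (exp (- 0 * l)) by (rewrite Ropp_0, Rmult_0_l, exp_0; reflexivity).
  apply cvg_Hs_single; [typeclasses eauto|].
  apply (continuous_within (fun s => 0 < s) (fun t => exp (- t * l))).
  apply (ex_derive_continuous (fun t => exp (- t * l))); eexists; apply D.
- intros t ht; exists (single m (RtoC (l * exp (- t * l)))); split; [apply DN_single|].
  replace (fun n => (- single m (RtoC (l * exp (- t * l))) n)%C)
    with (single m (RtoC (- (l * exp (- t * l))))).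
  2: { apply functional_extensionality; intros n; unfold single; destruct (Z.eq_dec n m);
       [apply RtoC_opp|ring]. }
  replace (fun s n => ((single m (RtoC (exp (- s * l))) n - single m (RtoC (exp (- t * l))) n) / RtoC (s - t))%C)
    with (fun s => single m (RtoC ((exp (- s * l) - exp (- t * l)) / (s - t)))).
  2: { apply functional_extensionality; intros s; apply functional_extensionality; intros n.
       unfold single; destruct (Z.eq_dec n m).
       - rewrite <- RtoC_minus; unfold Cdiv, Cmult, Cinv, RtoC; simpl.
         destruct (Req_dec (s - t) 0) as [-> | hx].
         + rewrite ?Rmult_0_l, ?Rplus_0_r; unfold Rdiv; rewrite Rinv_0; f_equal; ring.
         + f_equal; field; auto.
       - unfold Cdiv; ring. }
  apply cvg_Hs_single; [typeclasses eauto|].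
  apply (is_derive_quotient (fun s => exp (- s * l))), D.
Qed.

(** The explicit flow shows that the chosen set is not empty, so [epsilon] returns the value at [t]
    of some flow; [heat_flow_coef] forces the coefficients of any such value. *)
Lemma exp_op_diag (b t : R) (m : Z) : 0 < t ->
  exp_op (DN b) t (expi m) m = RtoC (exp (- t * eigenvalue b m)).
Proof.
intros ht; unfold exp_op.
match goal with |- epsilon ?i ?P m = _ => destruct (epsilon_spec i P) as [u [hu ->]] end.
- eexists; eexists; split; [apply heat_flow_single|reflexivity].
- rewrite (heat_flow_coef b t (expi m) u m ht hu).
  unfold expi; destruct (Z.eq_dec m m); [ring|tauto].
Qed.

(** * Asymptotics of the eigenvalues *)

(** For [a = 1 / 2] the ratio of consecutive coefficients is at most [1 / (c + k)]. The first [p]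
    steps each give a factor [1 / c], the later ones give the factorial. The weight [INR (p + j)]
    makes the estimate serve the differentiated series as well. *)
Lemma kummer_coef_tail (c : R) (p j : nat) : 1 <= c -> (0 < p)%nat ->
  INR (p + j) * kummer_coef (1 / 2) c (p + j) <= INR p / c ^ p / INR (fact j).
Proof.
intros hc hp.
assert (S1 : forall k, kummer_coef (1 / 2) c (S k) <= kummer_coef (1 / 2) c k / (c + INR k)).
{ intros k; pose proof (kummer_coef_S (1 / 2) c k ltac:(lra)) as E.
  pose proof (kummer_coef_pos (1 / 2) c k ltac:(lra) ltac:(lra)).
  pose proof (kummer_coef_pos (1 / 2) c (S k) ltac:(lra) ltac:(lra)).
  pose proof (pos_INR k).
  apply (proj1 (Rle_div_r _ _ (c + INR k) ltac:(lra))).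
  apply Rmult_le_reg_r with (INR k + 1); [lra|].
  apply Rle_trans with (kummer_coef (1 / 2) c k * (1 / 2 + INR k)); [rewrite <- E; right; ring|].
  apply Rmult_le_compat_l; lra. }
assert (hp1 : 1 <= INR p) by (apply (le_INR 1); lia).
induction j as [|j IH].
- rewrite Nat.add_0_r; simpl (INR (fact 0)); unfold Rdiv; rewrite Rinv_1, Rmult_1_r.
  apply Rmult_le_compat_l; [lra|].
  clear hp hp1; induction p as [|p IHp].
  + unfold kummer_coef; simpl; lra.
  + eapply Rle_trans; [apply S1|].
    pose proof (pos_INR p); pose proof (kummer_coef_pos (1 / 2) c p ltac:(lra) ltac:(lra)).
    pose proof (pow_lt c p ltac:(lra)).
    apply Rle_trans with (kummer_coef (1 / 2) c p / c).
    * apply Rmult_le_compat_l; [lra|]; apply Rinv_le_contravar; lra.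
    * simpl pow; rewrite Rinv_mult, (Rmult_comm (/ c)).
      apply Rmult_le_compat_r; [left; apply Rinv_0_lt_compat; lra|exact IHp].
- replace (p + S j)%nat with (S (p + j)) by lia.
  set (m := kummer_coef (1 / 2) c (p + j)) in *.
  assert (hm : 0 < m) by (apply kummer_coef_pos; lra).
  assert (hpj : INR (p + j) = INR p + INR j) by apply plus_INR.
  pose proof (pos_INR j).
  apply Rle_trans with m.
  + eapply Rle_trans; [apply Rmult_le_compat_l; [apply pos_INR|apply S1]|].
    fold m; rewrite S_INR.
    unfold Rdiv; rewrite <- Rmult_assoc; apply Rle_div_l; [lra|nra].
  + apply Rle_trans with (INR p / c ^ p / INR (fact j) / (INR j + 1)).
    * apply (proj1 (Rle_div_r _ _ (INR j + 1) ltac:(lra))).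
      eapply Rle_trans; [|exact IH]; rewrite hpj; nra.
    * rewrite fact_simpl, mult_INR, S_INR; right.
      pose proof (INR_fact_lt_0 j); pose proof (pow_lt c p ltac:(lra)); field; lra.
Qed.

Lemma exp_le_compat (x y : R) : x <= y -> exp x <= exp y.
Proof. intros [h | ->]; [left; apply exp_increasing, h|right; reflexivity]. Qed.

Lemma is_series_exp (x : R) : is_series (fun k => x ^ k / INR (fact k)) (exp x).
Proof.
apply (is_series_ext (fun k => scal (pow_n x k) (/ INR (fact k)))).
- intros k; rewrite pow_n_pow; reflexivity.
- apply is_exp_Reals.
Qed.

Lemma Series_Rabs_le (a b : nat -> R) (l : R) : (forall k, Rabs (a k) <= b k) -> is_series b l ->
  ex_series a /\ Rabs (Series a) <= l.
Proof.
intros h hb.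
assert (ea : ex_series (fun k => Rabs (a k))).
{ apply (ex_series_Rle _ b); [|eexists; exact hb]; intros k; rewrite Rabs_Rabsolu; apply h. }
split; [apply ex_series_Rabs, ea|].
eapply Rle_trans; [apply Series_Rabs, ea|].
rewrite <- (is_series_unique _ _ hb); apply Series_le; [|eexists; exact hb].
intros k; split; [apply Rabs_pos|apply h].
Qed.

Lemma is_series_Rscal (c : R) (a : nat -> R) (l : R) : is_series a l ->
  is_series (fun k => c * a k) (c * l).
Proof. apply (is_series_scal (V := R_NormedModule) c a l). Qed.

Lemma kummer_tail (L c z : R) (p : nat) : 1 <= c -> (0 < p)%nat -> Rabs z <= L ->
  Rabs (kummer (1 / 2) c z - sum_f_R0 (fun k => kummer_coef (1 / 2) c k * z ^ k) (pred p))
    <= INR p * L ^ p * exp L / c ^ p.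
Proof.
intros hc hp hz.
assert (hL : 0 <= L) by (pose proof (Rabs_pos z); lra).
rewrite kummer_PSeries; unfold PSeries.
assert (ex : ex_series (fun k => kummer_coef (1 / 2) c k * z ^ k)).
{ apply ex_pseries_R, ex_pseries_infinite, CV_radius_kummer; lra. }
rewrite (Series_incr_n _ p hp ex).
match goal with |- Rabs (?s + ?t - ?s) <= _ => replace (s + t - s) with t by ring end.
apply (Series_Rabs_le _ (fun j => INR p * L ^ p / c ^ p * (L ^ j / INR (fact j)))).
- intros j; pose proof (kummer_coef_tail c p j hc hp) as T.
  pose proof (kummer_coef_pos (1 / 2) c (p + j) ltac:(lra) ltac:(lra)) as P.
  assert (1 <= INR (p + j)) by (apply (le_INR 1); lia).
  rewrite Rabs_mult, (Rabs_pos_eq (kummer_coef _ _ _)) by lra.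
  rewrite <- RPow_abs.
  apply Rle_trans with (INR p / c ^ p / INR (fact j) * L ^ (p + j)).
  + apply Rmult_le_compat; [lra|apply pow_le, Rabs_pos| |apply pow_incr; split; [apply Rabs_pos|auto]].
    eapply Rle_trans; [|exact T]; nra.
  + rewrite pow_add; right; pose proof (INR_fact_lt_0 j); pose proof (pow_lt c p ltac:(lra)); field; lra.
- replace (INR p * L ^ p * exp L / c ^ p) with (INR p * L ^ p / c ^ p * exp L)
    by (pose proof (pow_lt c p ltac:(lra)); field; lra).
  apply is_series_Rscal, is_series_exp.
Qed.

(** Differentiation shifts the index: the coefficient of [z ^ k] is now of size [1 / c ^ (k + 1)],
    so the [p + 1] terms kept leave an error of order [1 / c ^ (p + 2)]. *)
Lemma kummer1_tail (L c z : R) (p : nat) : 1 <= c -> Rabs z <= L ->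
  Rabs (kummer1 (1 / 2) c z
     - sum_f_R0 (fun k => INR (S k) * kummer_coef (1 / 2) c (S k) * z ^ k) p)
    <= INR (S (S p)) * L ^ S p * exp L / c ^ S (S p).
Proof.
intros hc hz.
assert (hL : 0 <= L) by (pose proof (Rabs_pos z); lra).
unfold kummer1, PSeries.
assert (ex : ex_series (fun k => PS_derive (kummer_coef (1 / 2) c) k * z ^ k)).
{ apply ex_pseries_R, ex_pseries_infinite; rewrite CV_radius_derive; apply CV_radius_kummer; lra. }
rewrite (Series_incr_n _ (S p) ltac:(lia) ex).
unfold PS_derive at 1; simpl pred.
match goal with |- Rabs (?s + ?t - ?s) <= _ => replace (s + t - s) with t by ring end.
apply (Series_Rabs_le _ (fun j => INR (S (S p)) * L ^ (S p) / c ^ (S (S p)) * (L ^ j / INR (fact j)))).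
- intros j; pose proof (kummer_coef_tail c (S (S p)) j hc ltac:(lia)) as T.
  pose proof (kummer_coef_pos (1 / 2) c (S (S p) + j) ltac:(lra) ltac:(lra)) as P.
  unfold PS_derive; change (S (S p + j)) with (S (S p) + j)%nat.
  pose proof (pos_INR (S (S p) + j)).
  rewrite Rabs_mult, Rabs_pos_eq by nra.
  rewrite <- RPow_abs.
  apply Rle_trans with (INR (S (S p)) / c ^ S (S p) / INR (fact j) * L ^ (S p + j)).
  + apply Rmult_le_compat; [nra|apply pow_le, Rabs_pos|exact T|apply pow_incr; split; [apply Rabs_pos|auto]].
  + rewrite pow_add; right; pose proof (INR_fact_lt_0 j); pose proof (pow_lt c (S (S p)) ltac:(lra)); field; lra.
- replace (INR (S (S p)) * L ^ S p * exp L / c ^ S (S p)) with (INR (S (S p)) * L ^ S p / c ^ S (S p) * exp L)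
    by (pose proof (pow_lt c (S (S p)) ltac:(lra)); field; lra).
  apply is_series_Rscal, is_series_exp.
Qed.

(** * The ratio M'/M for large n *)

Definition ratio_approx (n b : R) : R :=
  1 / (2 * n) + (b - 1) / (2 * n ^ 2) + (2 * b ^ 2 - 7 * b + 2) / (4 * n ^ 3).

Lemma kummer_ratio_poly (n z m1 m2 m3 : R) : 0 < n ->
  m1 = 1 / (2 * (n + 1)) -> m2 = 3 / (8 * (n + 1) * (n + 2)) ->
  m3 = 5 / (16 * (n + 1) * (n + 2) * (n + 3)) ->
  m1 + 2 * m2 * z + 3 * m3 * z ^ 2 - ratio_approx n z * (1 + m1 * z + m2 * z ^ 2 + m3 * z ^ 3)
  = (n ^ 2 * (- (19 / 32) * z ^ 3 - 15 / 4 * z ^ 2 + 9 / 2 * z - 1 / 2)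
     + n * (- (11 / 32) * z ^ 4 - z ^ 3 - 9 / 4 * z ^ 2 + 33 / 2 * z - 5 / 2)
     + (- (5 / 32) * z ^ 5 - 1 / 64 * z ^ 4 + 5 / 16 * z ^ 3 + 27 / 16 * z ^ 2 + 9 * z - 3))
    / (n ^ 3 * ((n + 1) * (n + 2) * (n + 3))).
Proof.
intros hn -> -> ->; unfold ratio_approx; field; lra.
Qed.

Lemma bounded_segment (f : R -> R) (L : R) : 0 <= L -> (forall z, ex_derive f z) ->
  exists C, 0 <= C /\ forall z, Rabs z <= L -> Rabs (f z) <= C.
Proof.
intros hL hf.
destruct (continuity_ab_maj (fun z => Rabs (f z)) (- L) L ltac:(lra)) as [m [hm _]].
- intros z _; apply continuity_pt_filterlim.
  apply (continuous_comp f Rabs); [apply (ex_derive_continuous f), hf|apply continuous_Rabs].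
- exists (Rabs (f m)); split; [apply Rabs_pos|].
  intros z hz; apply hm; apply Rabs_le_between in hz; lra.
Qed.

Lemma kummer_ratio_large (L : R) : 0 < L -> exists K N, forall (n : nat) (z : R),
  (N <= n)%nat -> (1 <= n)%nat -> Rabs z <= L ->
  Rabs (kummer1 (1 / 2) (INR n + 1) z / kummer (1 / 2) (INR n + 1) z - ratio_approx (INR n) z)
    <= K / INR n ^ 4.
Proof.
intros hL.
destruct (bounded_segment (fun z => - (19 / 32) * z ^ 3 - 15 / 4 * z ^ 2 + 9 / 2 * z - 1 / 2) L
  ltac:(lra)) as [C2 [c2 h2]]; [intros; auto_derive; auto|].
destruct (bounded_segment (fun z => - (11 / 32) * z ^ 4 - z ^ 3 - 9 / 4 * z ^ 2 + 33 / 2 * z - 5 / 2) L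
  ltac:(lra)) as [C1 [c1 h1]]; [intros; auto_derive; auto|].
destruct (bounded_segment (fun z => - (5 / 32) * z ^ 5 - 1 / 64 * z ^ 4 + 5 / 16 * z ^ 3 + 27 / 16 * z ^ 2 + 9 * z - 3) L
  ltac:(lra)) as [C0 [c0 h0]]; [intros; auto_derive; auto|].
destruct (bounded_segment (fun z => 2 * z ^ 2 - 7 * z + 2) L ltac:(lra)) as [D [d hD]];
  [intros; auto_derive; auto|].
(* Beyond this [N] the tail after the constant term, at most [L * exp L / (n + 1)], is below 1/2, so
   Kummer's function is at least 1/2 and can be divided by. *)
destruct (INR_unbounded (2 * L * exp L)) as [N hN].
set (Kr := 1 + (L + 1) + D).
set (T0 := 4 * L ^ 4 * exp L); set (T1 := 4 * L ^ 3 * exp L).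
exists (2 * ((C2 + C1 + C0) + T1 + Kr * T0)), N; intros n z hn hn1 hz.
assert (e : 0 < exp L) by apply exp_pos.
assert (t0 : 0 <= T0) by (unfold T0; apply Rmult_le_pos; [|lra]; apply Rmult_le_pos; [lra|apply pow_le; lra]).
assert (t1 : 0 <= T1) by (unfold T1; apply Rmult_le_pos; [|lra]; apply Rmult_le_pos; [lra|apply pow_le; lra]).
apply le_INR in hn, hn1; simpl (INR 1) in hn1.
set (x := INR n) in *; set (c := x + 1).
assert (hM : Rabs (kummer (1 / 2) c z - 1) <= 1 / 2).
{ pose proof (kummer_tail L c z 1 ltac:(unfold c; lra) ltac:(lia) hz) as T.
  unfold kummer_coef in T; simpl in T.
  replace (1 / 1 / 1 * 1) with 1 in T by field.
  eapply Rle_trans; [exact T|]; apply Rle_div_l; unfold c; lra. }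
assert (hR : Rabs (ratio_approx x z) <= Kr).
{ unfold ratio_approx, Kr.
  assert (x2 : 1 <= x ^ 2) by (apply pow_R1_Rle; lra).
  assert (x3 : 1 <= x ^ 3) by (apply pow_R1_Rle; lra).
  assert (div : forall u v U, Rabs u <= U -> 1 <= v -> Rabs (u / v) <= U).
  { intros u v U hu hv; unfold Rdiv; rewrite Rabs_mult, (Rabs_pos_eq (/ v)) by (left; apply Rinv_0_lt_compat; lra).
    apply Rle_div_l; [lra|]. pose proof (Rabs_pos u); nra. }
  eapply Rle_trans; [apply Rabs_triang|]; apply Rplus_le_compat.
  - eapply Rle_trans; [apply Rabs_triang|]; apply Rplus_le_compat.
    + apply div; [rewrite Rabs_R1|]; lra.
    + apply div; [apply Rabs_le_between in hz; apply Rabs_le; lra|lra].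
  - apply div; [apply hD, hz|lra]. }
(* Four terms of the function and three of its derivative, so that both truncation errors are of
   order [c ^ - 4]. *)
pose proof (kummer_tail L c z 4 ltac:(unfold c; lra) ltac:(lia) hz) as E0.
pose proof (kummer1_tail L c z 2 ltac:(unfold c; lra) hz) as E1.
simpl pred in E0; unfold sum_f_R0 in E0, E1.
set (m1 := kummer_coef (1 / 2) c 1) in *; set (m2 := kummer_coef (1 / 2) c 2) in *.
set (m3 := kummer_coef (1 / 2) c 3) in *.
pose proof (kummer_ratio_poly x z m1 m2 m3 ltac:(lra)
  ltac:(unfold m1, c, kummer_coef; simpl; field; lra)
  ltac:(unfold m2, c, kummer_coef; simpl; field; lra)
  ltac:(unfold m3, c, kummer_coef; simpl; field; lra)) as P.
replace (kummer_coef (1 / 2) c 0) with 1 in E0 by (unfold kummer_coef; simpl; field).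
replace (INR 4 * L ^ 4 * exp L) with T0 in E0 by (unfold T0; simpl; ring).
replace (INR 4 * L ^ 3 * exp L) with T1 in E1 by (unfold T1; simpl; ring).
replace (1 * z ^ 0 + m1 * z ^ 1 + m2 * z ^ 2 + m3 * z ^ 3)
  with (1 + m1 * z + m2 * z ^ 2 + m3 * z ^ 3) in E0 by ring.
replace (INR 1 * m1 * z ^ 0 + INR 2 * m2 * z ^ 1 + INR 3 * m3 * z ^ 2)
  with (m1 + 2 * m2 * z + 3 * m3 * z ^ 2) in E1 by (simpl; ring).
set (M := kummer (1 / 2) c z) in *; set (M1 := kummer1 (1 / 2) c z) in *.
set (rho := ratio_approx x z) in *.
set (p0 := 1 + m1 * z + m2 * z ^ 2 + m3 * z ^ 3) in *.
set (p1 := m1 + 2 * m2 * z + 3 * m3 * z ^ 2) in *.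
assert (x4 : 0 < x ^ 4) by (apply pow_lt; lra).
assert (xc : x ^ 4 <= c ^ 4) by (apply pow_incr; unfold c; lra).
assert (wc : forall T, 0 <= T -> T / c ^ 4 <= T / x ^ 4).
{ intros T hT; apply Rmult_le_compat_l; [exact hT|]; apply Rinv_le_contravar; auto. }
assert (hp : Rabs (p1 - rho * p0) <= (C2 + C1 + C0) / x ^ 4).
{ rewrite P; specialize (h2 z hz); specialize (h1 z hz); specialize (h0 z hz).
  set (q2 := _ - 1 / 2) in *; set (q1 := _ - 5 / 2) in *; set (q0 := _ - 3) in *.
  assert (xx : 1 <= x ^ 2) by (apply pow_R1_Rle; lra).
  assert (den : x ^ 6 <= x ^ 3 * ((x + 1) * (x + 2) * (x + 3))).
  { replace (x ^ 6) with (x ^ 3 * (x * x * x)) by ring.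
    apply Rmult_le_compat_l; [apply pow_le; lra|].
    apply Rmult_le_compat; nra. }
  assert (x6 : 0 < x ^ 6) by (apply pow_lt; lra).
  assert (num : Rabs (x ^ 2 * q2 + x * q1 + q0) <= x ^ 2 * (C2 + C1 + C0)).
  { eapply Rle_trans; [apply Rabs_triang|].
    eapply Rle_trans; [apply Rplus_le_compat_r, Rabs_triang|].
    rewrite !Rabs_mult, (Rabs_pos_eq x), (Rabs_pos_eq (x ^ 2)) by lra.
    pose proof (Rabs_pos q2); pose proof (Rabs_pos q1); pose proof (Rabs_pos q0).
    assert (x * Rabs q1 <= x ^ 2 * C1) by (apply Rmult_le_compat; nra).
    nra. }
  unfold Rdiv at 1; rewrite Rabs_mult, (Rabs_pos_eq (/ _)) by (left; apply Rinv_0_lt_compat; lra).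
  apply Rle_trans with (x ^ 2 * (C2 + C1 + C0) * / x ^ 6).
  - apply Rmult_le_compat; [apply Rabs_pos|left; apply Rinv_0_lt_compat; lra|exact num|].
    apply Rinv_le_contravar; lra.
  - right; field; lra. }
assert (hd : Rabs (M1 - rho * M) <= ((C2 + C1 + C0) + T1 + Kr * T0) / x ^ 4).
{ replace (M1 - rho * M) with ((p1 - rho * p0) + ((M1 - p1) + - (rho * (M - p0)))) by ring.
  eapply Rle_trans; [apply Rabs_triang|].
  eapply Rle_trans; [apply Rplus_le_compat_l, Rabs_triang|].
  rewrite Rabs_Ropp, Rabs_mult.
  pose proof (wc T0 t0); pose proof (wc T1 t1).
  assert (Rabs rho * Rabs (M - p0) <= Kr * (T0 / x ^ 4)).
  { apply Rmult_le_compat; auto using Rabs_pos; lra. }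
  replace (((C2 + C1 + C0) + T1 + Kr * T0) / x ^ 4)
    with ((C2 + C1 + C0) / x ^ 4 + (T1 / x ^ 4 + Kr * (T0 / x ^ 4))) by (field; lra).
  lra. }
assert (Mlow : 1 / 2 <= M) by (apply Rabs_le_between in hM; lra).
replace (M1 / M - rho) with ((M1 - rho * M) / M) by (field; lra).
unfold Rdiv at 1; rewrite Rabs_mult, (Rabs_pos_eq (/ M)) by (left; apply Rinv_0_lt_compat; lra).
apply Rle_div_l; [lra|].
eapply Rle_trans; [exact hd|].
set (q := C2 + C1 + C0 + T1 + Kr * T0) in *.
assert (0 <= q / x ^ 4) by (eapply Rle_trans; [apply Rabs_pos|exact hd]).
replace (2 * q / x ^ 4) with (2 * (q / x ^ 4)) by (field; lra).
nra.
Qed.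

(** The finitely many small [n] are covered by compactness: for each of them the ratio is continuous
    on [[-L, L]], because Kummer's function has no real zero. *)
Lemma kummer_ratio_bound (L : R) : 0 < L -> exists K, 0 <= K /\ forall (n : nat) (z : R),
  (1 <= n)%nat -> Rabs z <= L ->
  Rabs (kummer1 (1 / 2) (INR n + 1) z / kummer (1 / 2) (INR n + 1) z - ratio_approx (INR n) z)
    <= K / INR n ^ 4.
Proof.
intros hL; destruct (kummer_ratio_large L hL) as [K [N hK]].
set (f := fun n z => kummer1 (1 / 2) (INR n + 1) z / kummer (1 / 2) (INR n + 1) z - ratio_approx (INR n) z).
assert (small : forall N, exists C, 0 <= C /\ forall n z, (n < N)%nat -> (1 <= n)%nat -> Rabs z <= L ->
  Rabs (f n z) * INR n ^ 4 <= C).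
{ clear N hK; induction N as [|N [C [hC IH]]]; [exists 0; split; [lra|intros; lia]|].
  destruct N as [|N].
  { exists 0; split; [lra|intros; lia]. }
  destruct (bounded_segment (f (S N)) L ltac:(lra)) as [B [hB hf]].
  { intros z; unfold f, ratio_approx.
    pose proof (kummer_neq_0 (S N) z).
    pose proof (INR_S_pos (S N)).
    apply (ex_derive_minus (fun z => kummer1 (1 / 2) (INR (S N) + 1) z / kummer (1 / 2) (INR (S N) + 1) z)).
    - apply (ex_derive_div (kummer1 (1 / 2) (INR (S N) + 1)) (kummer (1 / 2) (INR (S N) + 1))); auto.
      + eexists; apply is_derive_kummer1; lra.
      + eexists; apply is_derive_kummer; lra.
    - auto_derive; auto. }
  exists (C + B * INR (S N) ^ 4).
  assert (0 <= INR (S N) ^ 4) by (apply pow_le, pos_INR).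
  assert (0 <= B * INR (S N) ^ 4) by (apply Rmult_le_pos; lra).
  split; [lra|].
  intros n z hn hn1 hz; destruct (Nat.eq_dec n (S N)) as [-> | hne].
  - specialize (hf z hz). assert (Rabs (f (S N) z) * INR (S N) ^ 4 <= B * INR (S N) ^ 4)
      by (apply Rmult_le_compat_r; lra). lra.
  - specialize (IH n z ltac:(lia) hn1 hz); lra. }
destruct (small N) as [C [hC hs]].
exists (Rmax K C); split; [eapply Rle_trans; [exact hC|apply Rmax_r]|].
intros n z hn hz; fold (f n z).
assert (x4 : 0 < INR n ^ 4) by (apply pow_lt, lt_0_INR; lia).
destruct (le_lt_dec N n) as [h|h].
- eapply Rle_trans; [apply (hK n z h hn hz)|].
  apply Rmult_le_compat_r; [left; apply Rinv_0_lt_compat, x4|apply Rmax_l].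
- specialize (hs n z h hn hz).
  apply (proj1 (Rle_div_r _ _ _ x4)); eapply Rle_trans; [exact hs|apply Rmax_r].
Qed.

Lemma lambda_mu_bound (L : R) : 0 < L -> exists K, 0 <= K /\ forall (n : nat) (b : R),
  (1 <= n)%nat -> Rabs b <= L -> Rabs (lambda n b - mu n b) <= K * Rabs b / INR n ^ 4.
Proof.
intros hL; destruct (kummer_ratio_bound L hL) as [K [hK h]].
exists (2 * K); split; [lra|]; intros n b hn hb.
rewrite lambda_kummer; unfold mu; fold (ratio_approx (INR n) b).
set (q := kummer1 _ _ _ / _).
replace (INR n - b + 2 * b * q - (INR n - b + 2 * b * ratio_approx (INR n) b))
  with (2 * b * (q - ratio_approx (INR n) b)) by ring.
rewrite !Rabs_mult, (Rabs_pos_eq 2) by lra.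
specialize (h n b hn hb); fold q in h.
replace (2 * K * Rabs b / INR n ^ 4) with (2 * Rabs b * (K / INR n ^ 4)) by (unfold Rdiv; ring).
apply Rmult_le_compat_l; [|exact h]; pose proof (Rabs_pos b); lra.
Qed.

(** * Values of the zeta function *)

Fixpoint dirichlet (N : nat) (x : R) : R :=
  match N with
  | O => 1 / 2
  | S k => dirichlet k x + cos (INR (S k) * x)
  end.

Lemma dirichlet_sin (N : nat) (x : R) :
  2 * sin (x / 2) * dirichlet N x = sin ((INR N + 1 / 2) * x).
Proof.
induction N as [|N IH].
- simpl; replace ((0 + 1 / 2) * x) with (x / 2) by field; field.
- change (dirichlet (S N) x) with (dirichlet N x + cos (INR (S N) * x)).
  rewrite Rmult_plus_distr_l, IH, !S_INR.
  replace ((INR N + 1 / 2) * x) with ((INR N + 1) * x - x / 2) by field.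
  replace ((INR N + 1 + 1 / 2) * x) with ((INR N + 1) * x + x / 2) by field.
  rewrite sin_minus, sin_plus; ring.
Qed.

(** From [sin y >= y - y ^ 3 / 6] and [y ^ 2 <= 4]; any positive slope would do for the bound on the
    Dirichlet kernel. *)
Lemma sin_ge_third (y : R) : 0 <= y <= PI / 2 -> y / 3 <= sin y.
Proof.
intros hy; pose proof PI_4.
destruct (sin_bound y 0 ltac:(lra) ltac:(lra)) as [h _].
unfold sin_approx, sin_term in h; simpl in h.
assert (E : y - y ^ 3 / 6 <= sin y) by (eapply Rle_trans; [|exact h]; right; field).
eapply Rle_trans; [|exact E].
assert (y ^ 2 <= 4) by nra. simpl in *; nra.
Qed.

Lemma ex_derive_dirichlet (N : nat) (x : R) : ex_derive (dirichlet N) x.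
Proof.
induction N as [|N IH]; simpl; [auto_derive; auto|].
apply (ex_derive_plus (dirichlet N)); [exact IH|auto_derive; auto].
Qed.

(** A Riemann-Lebesgue argument. The quotient [p x / (2 * sin (x / 2))] is not usable at 0, so the
    interval is split. Near 0, [p] is at most [C * x] and the kernel at most [3 / x], so the
    integrand is bounded independently of [N]. Away from 0 an integration by parts against
    [sin (M * x)] gains a factor [1 / M]. *)
Lemma dirichlet_integral_cvg (p p1 p2 : R -> R) (u : nat -> R) : p 0 = 0 ->
  (forall x, is_derive p x (p1 x)) -> (forall x, is_derive p1 x (p2 x)) ->
  (forall N, is_RInt (fun x => p x * dirichlet N x) 0 PI (u N)) -> is_lim_seq u 0.
Proof.
intros p0 dp dp1 hu.
pose proof PI_RGT_0 as pi.
destruct (bounded_segment p1 PI ltac:(lra)) as [C [hC hp1]]; [intros; eexists; apply dp1|].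
assert (hp : forall x, 0 <= x <= PI -> Rabs (p x) <= C * x).
{ intros x hx; destruct (Req_dec x 0) as [-> | hx0]; [rewrite p0, Rabs_R0; lra|].
  destruct (MVT_cor2 p p1 0 x ltac:(lra)) as [c [hc hc']]; [intros; apply is_derive_Reals, dp|].
  rewrite p0 in hc; replace (p x) with (p1 c * (x - 0)) by lra.
  rewrite Rabs_mult, (Rabs_pos_eq (x - 0)), Rminus_0_r by lra.
  apply Rmult_le_compat_r; [lra|apply hp1; rewrite Rabs_pos_eq; lra]. }
assert (sp : forall x, 0 < x <= PI -> x / 6 <= sin (x / 2)).
{ intros x hx; pose proof (sin_ge_third (x / 2) ltac:(lra)); lra. }
set (q := fun x => p x / (2 * sin (x / 2))).
set (q1 := fun x => (p1 x * (2 * sin (x / 2)) - p x * cos (x / 2)) / (2 * sin (x / 2)) ^ 2).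
assert (dq : forall x, 0 < x <= PI -> is_derive q x (q1 x)).
{ intros x hx; pose proof (sp x hx); pose proof (dp x) as D; unfold q, q1.
  auto_derive.
  - split_all; auto; [eexists; exact D|lra].
  - rewrite (is_derive_unique (fun x : R => p x) x _ D); unfold Rdiv; rewrite ?Rmult_1_l; field; unfold Rdiv in *; lra. }
assert (cq1 : forall x, 0 < x <= PI -> continuous q1 x).
{ intros x hx; pose proof (sp x hx); apply (ex_derive_continuous q1); unfold q1.
  auto_derive; split_all; auto; [eexists; apply dp1|eexists; apply dp|].
  apply Rgt_not_eq; unfold Rdiv in *; nra. }
assert (cd : forall N x, continuous (fun x => p x * dirichlet N x) x).
{ intros N x; apply (ex_derive_continuous (fun x => p x * dirichlet N x)).
  apply (ex_derive_mult p (dirichlet N)); [eexists; apply dp|apply ex_derive_dirichlet]. }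
apply is_lim_seq_spec; intros e; pose proof (cond_pos e) as he.
(* The piece near 0 contributes at most [3 * C * ep], hence less than half of [e]; the added 1 keeps
   the denominator positive when [C = 0]. *)
set (ep := Rmin PI (e / (2 * (3 * C + 1)))).
assert (hep : 0 < ep <= PI).
{ unfold ep; split; [apply Rmin_glb_lt; [lra|apply Rdiv_lt_0_compat; lra]|apply Rmin_l]. }
assert (hep' : ep * (3 * C + 1) <= e / 2).
{ assert (ep <= e / (2 * (3 * C + 1))) by apply Rmin_r.
  replace (e / 2) with (e / (2 * (3 * C + 1)) * (3 * C + 1)) by (field; lra).
  apply Rmult_le_compat_r; lra. }
destruct (continuity_ab_maj (fun x => Rabs (q1 x)) ep PI ltac:(lra)) as [m [hm _]].
{ intros x hx; apply continuity_pt_filterlim.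
  apply (continuous_comp q1 Rabs); [apply cq1; lra|apply continuous_Rabs]. }
set (B := Rabs (q1 m)) in *.
assert (hB : 0 <= B) by apply Rabs_pos.
set (W := Rabs (q PI) + Rabs (q ep) + PI * B).
assert (hW : 0 <= W).
{ unfold W; pose proof (Rabs_pos (q PI)); pose proof (Rabs_pos (q ep)).
  assert (0 <= PI * B) by (apply Rmult_le_pos; lra); lra. }
destruct (INR_unbounded (2 * W / e)) as [N0 hN0].
exists N0; intros N hN; rewrite Rminus_0_r.
apply le_INR in hN.
set (M := INR N + 1 / 2).
assert (hM : 0 < M) by (unfold M; pose proof (pos_INR N); lra).
assert (hWM : W / M < e / 2).
{ apply Rlt_div_l; [exact hM|].
  assert (2 * W / e < M) by (unfold M; lra).
  apply Rlt_div_l in H; [|lra]. nra. }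
assert (ex : forall a c, ex_RInt (fun x => p x * dirichlet N x) a c).
{ intros a c; apply (ex_RInt_continuous (fun x => p x * dirichlet N x)); intros; apply cd. }
rewrite <- (is_RInt_unique _ _ _ _ (hu N)).
rewrite <- (RInt_Chasles _ 0 ep PI (ex _ _) (ex _ _)).
unfold plus; simpl.
eapply Rle_lt_trans; [apply Rabs_triang|].
assert (I1 : Rabs (RInt (fun x => p x * dirichlet N x) 0 ep) <= (ep - 0) * (3 * C)).
{ apply abs_RInt_le_const; [lra|apply ex|].
  intros x hx; destruct (Req_dec x 0) as [-> | hx0].
  - rewrite p0, Rmult_0_l, Rabs_R0; lra.
  - pose proof (dirichlet_sin N x) as D; pose proof (sp x ltac:(lra)) as S.
    pose proof (hp x ltac:(lra)) as P.
    assert (x / 3 * Rabs (dirichlet N x) <= 1).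
    { apply Rle_trans with (Rabs (2 * sin (x / 2) * dirichlet N x)).
      - rewrite Rabs_mult, (Rabs_pos_eq (2 * _)) by lra.
        apply Rmult_le_compat_r; [apply Rabs_pos|lra].
      - rewrite D; apply Rabs_le, SIN_bound. }
    rewrite Rabs_mult.
    apply Rle_trans with (C * x * Rabs (dirichlet N x)).
    + apply Rmult_le_compat_r; [apply Rabs_pos|exact P].
    + nra. }
assert (I2 : Rabs (RInt (fun x => p x * dirichlet N x) ep PI) <= W / M).
{ assert (c1 : forall x, ep <= x <= PI -> continuous (fun x => q1 x * cos (M * x) / M) x).
  { intros x hx; apply (continuous_mult (fun x => q1 x * cos (M * x)) (fun _ => / M)); [|apply continuous_const].
    apply (continuous_mult q1 (fun x => cos (M * x))); [apply cq1; lra|apply continuous_cos_lin]. }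
  assert (ec1 : ex_RInt (fun x => q1 x * cos (M * x) / M) ep PI).
  { apply (ex_RInt_continuous (fun x => q1 x * cos (M * x) / M)); intros x hx.
    rewrite Rmin_left, Rmax_right in hx by lra; apply c1, hx. }
  (* Integration by parts, stated as the derivative of [- q x * cos (M * x) / M], where
     [q x * sin (M * x)] is the original integrand. *)
  assert (A : is_RInt (fun x => p x * dirichlet N x - q1 x * cos (M * x) / M) ep PI
     (minus (- (q PI * cos (M * PI) / M)) (- (q ep * cos (M * ep) / M)))).
  { apply (is_RInt_derive (fun x => - (q x * cos (M * x) / M))); intros x hx;
      rewrite Rmin_left, Rmax_right in hx by lra.
    - pose proof (sp x ltac:(lra)); pose proof (dirichlet_sin N x) as D; fold M in D.
      replace (p x * dirichlet N x) with (q x * sin (M * x))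
        by (rewrite <- D; unfold q; field; lra).
      pose proof (dq x ltac:(lra)) as Dq.
      auto_derive; [eexists; exact Dq|].
      rewrite (is_derive_unique (fun x : R => q x) x _ Dq); field; lra.
    - apply (continuous_minus (fun x => p x * dirichlet N x)); [apply cd|apply c1, hx]. }
  pose proof (is_RInt_plus _ _ _ _ _ _ A (RInt_correct (V := R_CompleteNormedModule) _ _ _ ec1)) as A2.
  assert (A3 : is_RInt (fun x => p x * dirichlet N x) ep PI
    (minus (- (q PI * cos (M * PI) / M)) (- (q ep * cos (M * ep) / M))
      + RInt (fun x => q1 x * cos (M * x) / M) ep PI)).
  { revert A2; apply is_RInt_ext; intros x _; unfold plus; simpl; ring. }
  rewrite (is_RInt_unique _ _ _ _ A3).
  unfold plus, minus, opp; simpl.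
  assert (I3 : Rabs (RInt (fun x => q1 x * cos (M * x) / M) ep PI) <= (PI - ep) * (B / M)).
  { apply abs_RInt_le_const; [lra|exact ec1|].
    intros x hx; unfold Rdiv; rewrite !Rabs_mult, (Rabs_pos_eq (/ M)) by (left; apply Rinv_0_lt_compat, hM).
    apply Rmult_le_compat_r; [left; apply Rinv_0_lt_compat, hM|].
    rewrite <- (Rmult_1_r B); apply Rmult_le_compat; auto using Rabs_pos.
    apply Rabs_le, COS_bound. }
  assert (bc : forall y k, Rabs (y * cos k / M) <= Rabs y / M).
  { intros y k; unfold Rdiv; rewrite !Rabs_mult, (Rabs_pos_eq (/ M)) by (left; apply Rinv_0_lt_compat, hM).
    apply Rmult_le_compat_r; [left; apply Rinv_0_lt_compat, hM|].
    rewrite <- (Rmult_1_r (Rabs y)) at 2; apply Rmult_le_compat_l; [apply Rabs_pos|].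
    apply Rabs_le, COS_bound. }
  eapply Rle_trans; [apply Rabs_triang|].
  eapply Rle_trans; [apply Rplus_le_compat_r, Rabs_triang|].
  rewrite !Rabs_Ropp.
  pose proof (bc (q PI) (M * PI)); pose proof (bc (q ep) (M * ep)).
  assert ((PI - ep) * (B / M) <= PI * (B / M)).
  { apply Rmult_le_compat_r; [apply Rmult_le_pos; [exact hB|left; apply Rinv_0_lt_compat, hM]|lra]. }
  replace (W / M) with (Rabs (q PI) / M + Rabs (q ep) / M + PI * (B / M)) by (unfold W; field; lra).
  lra. }
nra.
Qed.

(* The integral of [p * dirichlet N] is [I / 2] plus a partial sum of [c], and it tends to 0
   because [p 0 = 0]. *)
Lemma fourier_series_at_0 (p p1 p2 : R -> R) (c : nat -> R) (I : R) : p 0 = 0 ->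
  (forall x, is_derive p x (p1 x)) -> (forall x, is_derive p1 x (p2 x)) ->
  is_RInt p 0 PI I ->
  (forall n, is_RInt (fun x => p x * cos (INR (S n) * x)) 0 PI (c n)) ->
  is_series c (- I / 2).
Proof.
intros p0 dp dp1 hI hc.
assert (H : forall N, is_RInt (fun x => p x * dirichlet (S N) x) 0 PI (I / 2 + sum_n c N)).
{ assert (H0 : is_RInt (fun x => p x * dirichlet 0 x) 0 PI (I / 2)).
  { apply (is_RInt_ext (fun x => scal (1 / 2) (p x))).
    - intros x _; unfold scal; simpl; unfold mult; simpl; field.
    - replace (I / 2) with (scal (1 / 2) I) by (unfold scal; simpl; unfold mult; simpl; field).
      apply (is_RInt_scal p), hI. }
  induction N as [|N IH].
  - rewrite sum_O.
    apply (is_RInt_ext (fun x => plus (p x * dirichlet 0 x) (p x * cos (INR 1 * x)))).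
    + intros x _; unfold plus; simpl; ring.
    + apply (is_RInt_plus (fun x => p x * dirichlet 0 x)); [exact H0|apply (hc 0%nat)].
  - rewrite sum_Sn; unfold plus; simpl; rewrite <- Rplus_assoc.
    apply (is_RInt_ext (fun x => plus (p x * dirichlet (S N) x) (p x * cos (INR (S (S N)) * x)))).
    + intros x _; unfold plus; simpl; ring.
    + apply (is_RInt_plus (fun x => p x * dirichlet (S N) x)); [exact IH|apply hc]. }
assert (L : is_lim_seq (fun N => I / 2 + sum_n c N) 0).
{
  apply (is_lim_seq_ext (fun N => RInt (fun x => p x * dirichlet (S N) x) 0 PI)).
  - intros N; apply is_RInt_unique, H.
  - apply (is_lim_seq_incr_1 (fun N => RInt (fun x => p x * dirichlet N x) 0 PI)).
    apply (dirichlet_integral_cvg p p1 p2); auto.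
    intros N; apply (RInt_correct (V := R_CompleteNormedModule)).
    apply (ex_RInt_continuous (fun x => p x * dirichlet N x)); intros x _.
    apply (ex_derive_continuous (fun x => p x * dirichlet N x)).
    apply (ex_derive_mult p (dirichlet N)); [eexists; apply dp|apply ex_derive_dirichlet]. }
assert (L2 : is_lim_seq (fun N => (I / 2 + sum_n c N) + - (I / 2)) (0 + - (I / 2))).
{ apply (is_lim_seq_plus' _ _ _ _ L), is_lim_seq_const. }
replace (0 + - (I / 2)) with (- I / 2) in L2 by field.
apply (is_lim_seq_ext _ (sum_n c)) in L2; [exact L2|intros N; ring].
Qed.

Lemma is_RInt_antiderivative (F f : R -> R) (a b l : R) :
  (forall x, is_derive F x (f x)) -> (forall x, ex_derive f x) -> F b - F a = l -> is_RInt f a b l.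
Proof.
intros hF hf <-; apply (is_RInt_derive F f); intros x _; [apply hF|apply (ex_derive_continuous f), hf].
Qed.

Lemma cos_sin_nat_PI (n : nat) : sin (INR n * PI) = 0 /\ sin (INR n * 0) = 0 /\ cos (INR n * 0) = 1.
Proof.
rewrite Rmult_0_r, sin_0, cos_0; split; [|auto].
apply sin_eq_0_1; exists (Z.of_nat n); rewrite INR_IZR_INZ; reflexivity.
Qed.

(** The quadratic has derivative 0 at pi and -1 at 0, so the only boundary term in the integration
    by parts is [1 / n ^ 2]. The quartic and the sextic below follow the same pattern: their odd
    derivatives vanish at both ends up to the last one that is not identically zero before a
    constant, which vanishes at pi alone and produces [1 / n ^ 4] and [1 / n ^ 6]. *)
Lemma is_series_zeta_2 : is_series (fun k => 1 / INR (S k) ^ 2) (PI ^ 2 / 6).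
Proof.
pose proof PI_RGT_0 as pi.
replace (PI ^ 2 / 6) with (- (- PI ^ 2 / 3) / 2) by field.
apply (fourier_series_at_0 (fun x => x ^ 2 / (2 * PI) - x) (fun x => x / PI - 1) (fun x => / PI)).
- field; lra.
- intros x; auto_derive; auto; field; lra.
- intros x; auto_derive; auto; field; lra.
- apply (is_RInt_antiderivative (fun x => x ^ 3 / (6 * PI) - x ^ 2 / 2)).
  + intros x; auto_derive; auto; field; lra.
  + intros x; auto_derive; auto.
  + field; lra.
- intros k; set (n := INR (S k)); assert (hn : 0 < n) by (apply lt_0_INR; lia).
  destruct (cos_sin_nat_PI (S k)) as [s1 [s2 s3]]; fold n in s1, s2, s3.
  apply (is_RInt_antiderivative (fun x => (x ^ 2 / (2 * PI) - x) * sin (n * x) / n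
    + (x / PI - 1) * cos (n * x) / n ^ 2 - / PI * sin (n * x) / n ^ 3)).
  + intros x; auto_derive; auto; field; lra.
  + intros x; auto_derive; auto.
  + rewrite s1, s2, s3; field; lra.
Qed.

Lemma is_series_zeta_4 : is_series (fun k => 1 / INR (S k) ^ 4) (PI ^ 4 / 90).
Proof.
pose proof PI_RGT_0 as pi.
replace (PI ^ 4 / 90) with (- (- PI ^ 4 / 45) / 2) by field.
apply (fourier_series_at_0 (fun x => - x ^ 4 / (24 * PI) + x ^ 3 / 6 - PI * x ^ 2 / 6)
  (fun x => - x ^ 3 / (6 * PI) + x ^ 2 / 2 - PI * x / 3) (fun x => - x ^ 2 / (2 * PI) + x - PI / 3)).
- field; lra.
- intros x; auto_derive; auto; field; lra.
- intros x; auto_derive; auto; field; lra.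
- apply (is_RInt_antiderivative (fun x => - x ^ 5 / (120 * PI) + x ^ 4 / 24 - PI * x ^ 3 / 18)).
  + intros x; auto_derive; auto; field; lra.
  + intros x; auto_derive; auto.
  + field; lra.
- intros k; set (n := INR (S k)); assert (hn : 0 < n) by (apply lt_0_INR; lia).
  destruct (cos_sin_nat_PI (S k)) as [s1 [s2 s3]]; fold n in s1, s2, s3.
  apply (is_RInt_antiderivative (fun x => (- x ^ 4 / (24 * PI) + x ^ 3 / 6 - PI * x ^ 2 / 6) * sin (n * x) / n
    + (- x ^ 3 / (6 * PI) + x ^ 2 / 2 - PI * x / 3) * cos (n * x) / n ^ 2
    - (- x ^ 2 / (2 * PI) + x - PI / 3) * sin (n * x) / n ^ 3
    - (- x / PI + 1) * cos (n * x) / n ^ 4 + - / PI * sin (n * x) / n ^ 5)).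
  + intros x; auto_derive; auto; field; lra.
  + intros x; auto_derive; auto.
  + rewrite s1, s2, s3; field; lra.
Qed.

Lemma is_series_zeta_6 : is_series (fun k => 1 / INR (S k) ^ 6) (PI ^ 6 / 945).
Proof.
pose proof PI_RGT_0 as pi.
replace (PI ^ 6 / 945) with (- (- 2 * PI ^ 6 / 945) / 2) by field.
apply (fourier_series_at_0
  (fun x => x ^ 6 / (720 * PI) - x ^ 5 / 120 + PI * x ^ 4 / 72 - PI ^ 3 * x ^ 2 / 90)
  (fun x => x ^ 5 / (120 * PI) - x ^ 4 / 24 + PI * x ^ 3 / 18 - PI ^ 3 * x / 45)
  (fun x => x ^ 4 / (24 * PI) - x ^ 3 / 6 + PI * x ^ 2 / 6 - PI ^ 3 / 45)).
- field; lra.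
- intros x; auto_derive; auto; field; lra.
- intros x; auto_derive; auto; field; lra.
- apply (is_RInt_antiderivative (fun x => x ^ 7 / (5040 * PI) - x ^ 6 / 720 + PI * x ^ 5 / 360 - PI ^ 3 * x ^ 3 / 270)).
  + intros x; auto_derive; auto; field; lra.
  + intros x; auto_derive; auto.
  + field; lra.
- intros k; set (n := INR (S k)); assert (hn : 0 < n) by (apply lt_0_INR; lia).
  destruct (cos_sin_nat_PI (S k)) as [s1 [s2 s3]]; fold n in s1, s2, s3.
  apply (is_RInt_antiderivative (fun x =>
    (x ^ 6 / (720 * PI) - x ^ 5 / 120 + PI * x ^ 4 / 72 - PI ^ 3 * x ^ 2 / 90) * sin (n * x) / n
    + (x ^ 5 / (120 * PI) - x ^ 4 / 24 + PI * x ^ 3 / 18 - PI ^ 3 * x / 45) * cos (n * x) / n ^ 2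
    - (x ^ 4 / (24 * PI) - x ^ 3 / 6 + PI * x ^ 2 / 6 - PI ^ 3 / 45) * sin (n * x) / n ^ 3
    - (x ^ 3 / (6 * PI) - x ^ 2 / 2 + PI * x / 3) * cos (n * x) / n ^ 4
    + (x ^ 2 / (2 * PI) - x + PI / 3) * sin (n * x) / n ^ 5
    + (x / PI - 1) * cos (n * x) / n ^ 6 - / PI * sin (n * x) / n ^ 7)).
  + intros x; auto_derive; auto; field; lra.
  + intros x; auto_derive; auto.
  + rewrite s1, s2, s3; field; lra.
Qed.

(** * Polylogarithms near 1 *)

Lemma exp_neg_le_1 (u : R) : 0 <= u -> exp (- u) <= 1.
Proof.
intros hu; rewrite <- exp_0; apply exp_le_compat; lra.
Qed.

Lemma exp_neg_bounds (t : R) : 0 <= t ->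
  1 - t <= exp (- t) /\ exp (- t) <= 1 - t + t ^ 2 / 2 /\ 1 - t + t ^ 2 / 2 - t ^ 3 / 6 <= exp (- t).
Proof.
intros ht.
assert (h1 : forall t, 1 - t <= exp (- t)).
{ intros s; pose proof (exp_ineq1_le (- s)); lra. }
assert (h2 : forall t, 0 <= t -> exp (- t) <= 1 - t + t ^ 2 / 2).
{ intros s hs.
  pose proof (derive_nonneg_le (fun s => 1 - s + s ^ 2 / 2 - exp (- s)) (fun s => -1 + s + exp (- s)) 0 s hs) as D.
  simpl in D; rewrite Ropp_0, exp_0 in D.
  cut (1 - 0 + 0 * (0 * 1) / 2 - 1 <= 1 - s + s * (s * 1) / 2 - exp (- s)); [simpl; lra|].
  apply D.
  - intros x _; auto_derive; auto; field.
  - intros x hx; pose proof (h1 x); lra. }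
split; [apply h1|split; [apply h2, ht|]].
pose proof (derive_nonneg_le (fun s => exp (- s) - (1 - s + s ^ 2 / 2 - s ^ 3 / 6))
  (fun s => - exp (- s) + 1 - s + s ^ 2 / 2) 0 t ht) as D.
simpl in D; rewrite Ropp_0, exp_0 in D.
cut (1 - (1 - 0 + 0 * (0 * 1) / 2 - 0 * (0 * (0 * 1)) / 6) <=
  exp (- t) - (1 - t + t * (t * 1) / 2 - t * (t * (t * 1)) / 6)); [simpl; lra|].
apply D.
- intros x _; auto_derive; auto; field.
- intros x hx; pose proof (h2 x ltac:(lra)) as H; simpl in H; lra.
Qed.

Definition polylog (j : nat) (t : R) : R :=
  Series (fun k => exp (- t * INR (S k)) / INR (S k) ^ j).

Definition polylog_coef (j n : nat) : R := match n with O => 0 | S k => / INR (S k) ^ j end.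

Lemma INR_S_ge_1 (k : nat) : 1 <= INR (S k).
Proof. apply (le_INR 1); lia. Qed.

Lemma INR_S_pow_ge_1 (k j : nat) : 1 <= INR (S k) ^ j.
Proof. apply pow_R1_Rle, INR_S_ge_1. Qed.

Lemma exp_neg_INR (t : R) (n : nat) : exp (- t * INR n) = exp (- t) ^ n.
Proof.
induction n as [|n IH]; [simpl; rewrite Rmult_0_r, exp_0; reflexivity|].
rewrite S_INR, Rmult_plus_distr_l, exp_plus, IH, Rmult_1_r; simpl; ring.
Qed.

Lemma exp_neg_lt_1 (t : R) : 0 < t -> 0 < exp (- t) < 1.
Proof. intros ht; split; [apply exp_pos|rewrite <- exp_0; apply exp_increasing; lra]. Qed.

Lemma polylog_coef_bound (j n : nat) : 0 <= polylog_coef j n <= 1.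
Proof.
destruct n as [|k]; [simpl; lra|]; unfold polylog_coef.
pose proof (INR_S_pow_ge_1 k j); split; [left; apply Rinv_0_lt_compat; lra|].
rewrite <- Rinv_1; apply Rinv_le_contravar; lra.
Qed.

Lemma CV_radius_polylog (j : nat) (x : R) : Rabs x < 1 ->
  Rbar_lt (Rabs x) (CV_radius (polylog_coef j)).
Proof.
intros hx; apply (Rbar_lt_le_trans _ 1); [exact hx|].
apply (proj1 (CV_radius_bounded (polylog_coef j))); exists 1; intros n.
rewrite pow1, Rmult_1_r; destruct (polylog_coef_bound j n).
rewrite Rabs_pos_eq; lra.
Qed.

(** As a power series in [exp (- t)], with coefficients at most 1, the function can be
    differentiated termwise for [t > 0]. *)
Lemma polylog_PSeries (j : nat) (t : R) : 0 < t ->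
  ex_series (fun k => exp (- t * INR (S k)) / INR (S k) ^ j) /\
  polylog j t = PSeries (polylog_coef j) (exp (- t)).
Proof.
intros ht; pose proof (exp_neg_lt_1 t ht) as he.
assert (ex : ex_series (fun n => polylog_coef j n * exp (- t) ^ n)).
{ apply ex_pseries_R, CV_radius_inside, CV_radius_polylog; rewrite Rabs_pos_eq; lra. }
assert (E : forall k, polylog_coef j (S k) * exp (- t) ^ S k = exp (- t * INR (S k)) / INR (S k) ^ j).
{ intros k; rewrite exp_neg_INR; unfold polylog_coef, Rdiv; ring. }
split.
- apply (ex_series_ext (fun k => polylog_coef j (S k) * exp (- t) ^ S k)); [exact E|].
  apply (ex_series_incr_1 (fun n => polylog_coef j n * exp (- t) ^ n)), ex.
- unfold PSeries; rewrite Series_incr_1 by exact ex; simpl (polylog_coef j 0).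
  rewrite Rmult_0_l, Rplus_0_l; unfold polylog; apply Series_ext; intros k; symmetry; apply E.
Qed.

Lemma polylog_0 (t : R) : 0 < t -> polylog 0 t = / (1 - exp (- t)) - 1.
Proof.
intros ht; pose proof (exp_neg_lt_1 t ht) as he.
rewrite <- Series_geom by (rewrite Rabs_pos_eq; lra).
rewrite Series_incr_1.
- simpl; replace (1 + Series (fun k => exp (- t) * exp (- t) ^ k) - 1)
    with (Series (fun k => exp (- t) * exp (- t) ^ k)) by ring.
  unfold polylog; apply Series_ext; intros k; rewrite exp_neg_INR; simpl; field.
- apply ex_series_geom; rewrite Rabs_pos_eq; lra.
Qed.

Lemma polylog_coef_derive (j : nat) (x : R) :
  x * PSeries (PS_derive (polylog_coef (S j))) x = PSeries (polylog_coef j) x.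
Proof.
rewrite <- PSeries_incr_1; apply PSeries_ext; intros [|k]; [reflexivity|].
unfold PS_incr_1, PS_derive, polylog_coef.
pose proof (INR_S_ge_1 k); pose proof (INR_S_pow_ge_1 k j).
change (INR (S k) ^ S j) with (INR (S k) * INR (S k) ^ j); field; lra.
Qed.

Lemma is_derive_polylog (j : nat) (t : R) : 0 < t ->
  is_derive (polylog (S j)) t (- polylog j t).
Proof.
intros ht; pose proof (exp_neg_lt_1 t ht) as he.
apply (is_derive_ext_loc (fun t => PSeries (polylog_coef (S j)) (exp (- t)))).
- exists (mkposreal t ht); intros s hs.
  assert (0 < s).
  { change (Rabs (s - t) < t) in hs; apply Rabs_lt_between in hs; lra. }
  symmetry; apply polylog_PSeries; assumption.
- rewrite (proj2 (polylog_PSeries j t ht)), <- polylog_coef_derive.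
  evar_last.
  + apply (is_derive_comp (PSeries (polylog_coef (S j))) (fun t => exp (- t))).
    * apply is_derive_PSeries, CV_radius_polylog; rewrite Rabs_pos_eq; lra.
    * auto_derive; [auto|reflexivity].
  + unfold scal; simpl; unfold mult; simpl; ring.
Qed.

Lemma polylog_1 (t : R) : 0 < t -> polylog 1 t = - ln (1 - exp (- t)).
Proof.
intros ht; pose proof (exp_neg_lt_1 t ht) as he.
rewrite (proj2 (polylog_PSeries 1 t ht)).
set (x := exp (- t)) in *.
assert (E : PSeries (polylog_coef 1) 0 + ln (1 - 0) = PSeries (polylog_coef 1) x + ln (1 - x)).
{ apply (derive_0_eq (fun x => PSeries (polylog_coef 1) x + ln (1 - x))); [lra|].
  intros y hy.
  replace 0 with (PSeries (PS_derive (polylog_coef 1)) y + - / (1 - y)).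
  - apply is_derive_Rplus.
    + apply is_derive_PSeries, CV_radius_polylog; rewrite Rabs_pos_eq; lra.
    + auto_derive; [lra|field; lra].
  - unfold PSeries; rewrite (Series_ext _ (fun n => y ^ n)).
    + rewrite Series_geom by (rewrite Rabs_pos_eq; lra); ring.
    + intros n; unfold PS_derive, polylog_coef; pose proof (INR_S_ge_1 n); field; lra. }
rewrite PSeries_0, Rminus_0_r, ln_1 in E; simpl in E; lra.
Qed.

Lemma one_minus_exp_bounds (t : R) : 0 < t <= 1 ->
  t / 2 <= 1 - exp (- t) <= t /\ t - t ^ 2 / 2 <= 1 - exp (- t) <= t - t ^ 2 / 2 + t ^ 3 / 6.
Proof.
intros ht; destruct (exp_neg_bounds t ltac:(lra)) as [a [b c]].
repeat split; try lra. nra.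
Qed.

Lemma polylog_0_expansion (t : R) : 0 < t <= 1 -> Rabs (polylog 0 t - (1 / t - 1 / 2)) <= t.
Proof.
intros ht; rewrite polylog_0 by lra.
destruct (one_minus_exp_bounds t ht) as [[a1 a2] [a3 a4]].
set (D := 1 - exp (- t)) in *.
replace (/ D - 1 - (1 / t - 1 / 2)) with ((2 * t - 2 * D - t * D) / (2 * t * D)) by (field; lra).
assert (hD : 0 < 2 * t * D) by nra.
apply Rabs_le; split.
- apply (proj1 (Rle_div_r _ _ _ hD)).
  assert (t * (2 * t * D) >= t * (2 * t * (t / 2))) by nra.
  (* In terms of [w], which is at most of order [t ^ 3], the numerator has no term of order below
     [t ^ 3], while the denominator is at least [t ^ 2]. *)
  set (w := D - (t - t ^ 2 / 2)). assert (0 <= w <= t ^ 3 / 6) by (unfold w; lra).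
  replace (2 * t - 2 * D - t * D) with (t ^ 3 / 2 - 2 * w - t * w) by (unfold w; field). nra.
- apply (proj2 (Rle_div_l _ _ _ hD)).
  assert (t * (2 * t * D) >= t * (2 * t * (t / 2))) by nra.
  set (w := D - (t - t ^ 2 / 2)). assert (0 <= w <= t ^ 3 / 6) by (unfold w; lra).
  replace (2 * t - 2 * D - t * D) with (t ^ 3 / 2 - 2 * w - t * w) by (unfold w; field).
  assert (0 <= t * w) by nra. assert (0 < t ^ 3) by (apply pow_lt; lra). nra.
Qed.

Lemma ln_ge_1_inv (y : R) : 0 < y -> 1 - / y <= ln y.
Proof.
intros hy; pose proof (exp_ineq1_le (- ln y)) as h.
rewrite exp_Ropp, exp_ln in h by exact hy; lra.
Qed.

Lemma polylog_1_expansion (t : R) : 0 < t <= 1 -> - t <= - polylog 1 t - ln t <= 0.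
Proof.
intros ht; rewrite polylog_1 by lra; rewrite Ropp_involutive.
destruct (one_minus_exp_bounds t ht) as [[a1 a2] [a3 a4]].
set (D := 1 - exp (- t)) in *.
split; [|pose proof (ln_le D t ltac:(lra) ltac:(lra)); lra].
replace (ln D - ln t) with (ln (D / t)) by (apply ln_div; lra).
assert (hy : 0 < D / t) by (apply Rdiv_lt_0_compat; lra).
eapply Rle_trans; [|apply ln_ge_1_inv, hy].
replace (/ (D / t)) with (t / D) by (field; lra).
assert (t / D <= 1 + t); [|lra].
apply (proj2 (Rle_div_l _ _ D ltac:(lra))). nra.
Qed.

Lemma ex_series_zeta (j : nat) : (2 <= j)%nat -> ex_series (fun k => 1 / INR (S k) ^ j).
Proof.
intros hj; apply (ex_series_Rle _ (fun k => 1 / INR (S k) ^ 2)); [|eexists; apply is_series_zeta_2].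
intros k; pose proof (INR_S_pow_ge_1 k j); pose proof (INR_S_pow_ge_1 k 2).
rewrite Rabs_pos_eq by (apply Rlt_le, Rdiv_lt_0_compat; lra).
apply Rmult_le_compat_l; [lra|]; apply Rinv_le_contravar; [lra|].
apply Rle_pow; [apply INR_S_ge_1|exact hj].
Qed.

Lemma polylog_term_bounds (j k : nat) (t : R) : 0 <= t ->
  0 <= 1 / INR (S k) ^ j - exp (- t * INR (S k)) / INR (S k) ^ j <= t * (INR (S k) / INR (S k) ^ j).
Proof.
intros ht; pose proof (INR_S_pow_ge_1 k j); pose proof (INR_S_ge_1 k).
assert (0 < / INR (S k) ^ j) by (apply Rinv_0_lt_compat; lra).
assert (0 <= t * INR (S k)) by nra.
destruct (exp_neg_bounds (t * INR (S k)) ltac:(auto)) as [a _].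
rewrite <- Ropp_mult_distr_l in *.
assert (exp (- (t * INR (S k))) <= 1) by (apply exp_neg_le_1; auto).
unfold Rdiv; nra.
Qed.

(** Each term changes by [1 - exp (- t n) <= t n], which lowers the exponent by one; [j >= 3] keeps
    the resulting zeta series convergent. *)
Lemma polylog_zeta (j : nat) (t : R) : (3 <= j)%nat -> 0 < t ->
  Rabs (polylog j t - zeta j) <= t * zeta (pred j).
Proof.
intros hj ht; unfold polylog, zeta.
destruct (polylog_PSeries j t ht) as [ex _].
pose proof (ex_series_zeta j ltac:(lia)) as ez.
rewrite Rabs_minus_sym, <- Series_minus by assumption.
rewrite <- Series_scal_l.
destruct j as [|j]; [lia|]; simpl pred.
pose proof (ex_series_zeta j ltac:(lia)) as ez'.
assert (T : forall k, INR (S k) / INR (S k) ^ S j = 1 / INR (S k) ^ j).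
{ intros k; pose proof (INR_S_ge_1 k); pose proof (INR_S_pow_ge_1 k j).
  change (INR (S k) ^ S j) with (INR (S k) * INR (S k) ^ j); field; lra. }
rewrite Rabs_pos_eq.
- apply Series_le; [|apply ex_series_Rscal, ez'].
  intros k; rewrite <- T; apply polylog_term_bounds; lra.
- rewrite <- (is_series_unique _ _ (is_series_zero (fun _ => 0) (fun _ => eq_refl))).
  apply Series_le.
  + intros k; split; [lra|apply polylog_term_bounds; lra].
  + apply (ex_series_Rplus (fun k => 1 / INR (S k) ^ S j) (fun k => - (exp (- t * INR (S k)) / INR (S k) ^ S j))); auto.
    apply (ex_series_opp (V := R_NormedModule)), ex.
Qed.

(** For [j = 2] the linear bound would involve the harmonic series, so only the limit is obtained: a
    partial sum close to zeta(2) is fixed, and its finitely many terms converge. *)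
Lemma polylog_2_lim (e : R) : 0 < e -> exists d, 0 < d /\ forall s, 0 < s < d ->
  Rabs (polylog 2 s - zeta 2) <= e.
Proof.
intros he.
pose proof (Series_correct _ (ex_series_zeta 2 ltac:(lia))) as Z; fold (zeta 2) in Z.
destruct (proj1 (filterlim_locally _ _) Z (mkposreal (e / 2) ltac:(lra))) as [N hN].
specialize (hN N ltac:(lia)).
change (Rabs (sum_n (fun k => 1 / INR (S k) ^ 2) N - zeta 2) < e / 2) in hN.
exists (e / (2 * INR (S N))).
pose proof (INR_S_ge_1 N) as h1.
split; [apply Rdiv_lt_0_compat; lra|]; intros s hs.
destruct (polylog_PSeries 2 s ltac:(lra)) as [ex _].
assert (U : polylog 2 s <= zeta 2).
{ apply Series_le; [|apply ex_series_zeta; lia].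
  intros k; pose proof (polylog_term_bounds 2 k s ltac:(lra)); split; [|lra].
  pose proof (INR_S_pow_ge_1 k 2); apply Rmult_le_pos; [left; apply exp_pos|].
  left; apply Rinv_0_lt_compat; lra. }
assert (P : sum_n (fun k => exp (- s * INR (S k)) / INR (S k) ^ 2) N <= polylog 2 s).
{ unfold polylog; rewrite (Series_incr_n _ (S N) ltac:(lia) ex); simpl pred.
  rewrite sum_n_Reals.
  assert (0 <= Series (fun k => exp (- s * INR (S (S N + k))) / INR (S (S N + k)) ^ 2)); [|lra].
  rewrite <- (is_series_unique _ _ (is_series_zero (fun _ => 0) (fun _ => eq_refl))).
  apply Series_le.
  - intros k; split; [lra|]; pose proof (INR_S_pow_ge_1 (S N + k) 2).
    apply Rmult_le_pos; [left; apply exp_pos|left; apply Rinv_0_lt_compat; lra].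
  - apply (ex_series_incr_n (fun k => exp (- s * INR (S k)) / INR (S k) ^ 2) (S N)), ex. }
assert (Q : forall n, sum_n (fun k => 1 / INR (S k) ^ 2) n - s * INR (S n)
   <= sum_n (fun k => exp (- s * INR (S k)) / INR (S k) ^ 2) n).
{ assert (T : forall k, 1 / INR (S k) ^ 2 - s <= exp (- s * INR (S k)) / INR (S k) ^ 2).
  { intros k; pose proof (polylog_term_bounds 2 k s ltac:(lra)) as B; pose proof (INR_S_ge_1 k).
    assert (INR (S k) / INR (S k) ^ 2 <= 1) by (apply (proj2 (Rle_div_l _ _ (INR (S k) ^ 2) ltac:(nra))); nra).
    nra. }
  induction n as [|n IH].
  - rewrite !sum_O; specialize (T 0%nat); simpl (INR 1) in *; lra.
  - rewrite !sum_Sn; unfold plus; simpl; specialize (T (S n)).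
    fold (INR (S n)); change (match n with 0%nat => 1 | S _ => INR n + 1 end) with (INR (S n)) in *.
    rewrite (S_INR (S n)) in *; simpl in *; lra. }
specialize (Q N).
assert (s * INR (S N) <= e / 2).
{ destruct hs as [_ hs]; apply Rlt_le.
  apply (Rmult_lt_compat_r (INR (S N))) in hs; [|lra].
  replace (e / (2 * INR (S N)) * INR (S N)) with (e / 2) in hs by (field; lra); exact hs. }
apply Rabs_lt_between in hN; apply Rabs_le; lra.
Qed.

(** With [y = sqrt s], the bound [ln y >= 1 - / y] gives [Rabs (s * ln s) <= 2 * y], whence the
    threshold [(e / 2) ^ 2]. *)
Lemma x_ln_x_small (e : R) : 0 < e -> exists d, 0 < d <= 1 /\ forall s, 0 < s < d ->
  Rabs (s * ln s) <= e /\ s <= e.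
Proof.
intros he; exists (Rmin 1 ((e / 2) ^ 2)).
assert (0 < (e / 2) ^ 2) by (apply pow_lt; lra).
split; [split; [apply Rmin_glb_lt; lra|apply Rmin_l]|].
intros s [hs hs'].
pose proof (Rlt_le_trans _ _ _ hs' (Rmin_l _ _)) as s1.
pose proof (Rlt_le_trans _ _ _ hs' (Rmin_r _ _)) as s2.
set (y := sqrt s).
assert (hy : 0 < y) by (apply sqrt_lt_R0; exact hs).
assert (yy : y * y = s) by (apply sqrt_sqrt; lra).
assert (ye : y < e / 2) by nra.
assert (y1 : y < 1) by nra.
split; [|nra].
rewrite Rabs_left1.
- rewrite <- yy, ln_mult by assumption.
  pose proof (ln_ge_1_inv y hy) as l.
  assert (y * (1 - / y) <= y * ln y) by (apply Rmult_le_compat_l; lra).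
  assert (y * (1 - / y) = y - 1) by (field; lra).
  nra.
- pose proof (ln_le s 1 ltac:(lra) ltac:(lra)) as l; rewrite ln_1 in l; nra.
Qed.

(** Mean value theorem on [[s, t]] with [s] tending to 0. The value at 0 is replaced by a limit
    because the functions contain logarithms; this step carries the expansion of one polylogarithm
    to the next. *)
Lemma derive_linear_bound (H H1 : R -> R) (C l t : R) : 0 < t -> 0 <= C ->
  (forall s, 0 < s <= t -> is_derive H s (H1 s)) ->
  (forall s, 0 < s <= t -> Rabs (H1 s) <= C * s) ->
  (forall e, 0 < e -> exists d, 0 < d /\ forall s, 0 < s < d -> Rabs (H s - l) <= e) ->
  Rabs (H t - l) <= C * t ^ 2.
Proof.
intros ht hC dH hH hl; apply le_epsilon; intros e he.
destruct (hl e he) as [d [hd h]].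
set (s := Rmin (t / 2) (d / 2)).
assert (hs : 0 < s) by (apply Rmin_glb_lt; lra).
assert (hs1 : s <= t / 2) by apply Rmin_l.
assert (hs2 : s <= d / 2) by apply Rmin_r.
destruct (MVT_cor2 H H1 s t ltac:(lra)) as [c [hc hc']].
{ intros c hc; apply is_derive_Reals, dH; lra. }
replace (H t - l) with ((H t - H s) + (H s - l)) by ring.
eapply Rle_trans; [apply Rabs_triang|]; apply Rplus_le_compat; [|apply h; lra].
rewrite hc, Rabs_mult, (Rabs_pos_eq (t - s)) by lra.
replace (C * t ^ 2) with (C * t * t) by ring.
apply Rmult_le_compat; [apply Rabs_pos|lra| |lra].
eapply Rle_trans; [apply hH; lra|]; apply Rmult_le_compat_l; lra.
Qed.

Lemma polylog_2_expansion (t : R) : 0 < t <= 1 ->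
  Rabs (polylog 2 t - (zeta 2 + t * ln t - t)) <= t ^ 2.
Proof.
intros ht.
replace (polylog 2 t - (zeta 2 + t * ln t - t)) with ((polylog 2 t + (- (t * ln t) + t)) - zeta 2) by ring.
rewrite <- (Rmult_1_l (t ^ 2)).
apply (derive_linear_bound (fun s => polylog 2 s + (- (s * ln s) + s)) (fun s => - polylog 1 s + - ln s)); try lra.
- intros s hs; apply is_derive_Rplus; [apply is_derive_polylog; lra|].
  auto_derive; [lra|field; lra].
- intros s hs; pose proof (polylog_1_expansion s ltac:(lra)); apply Rabs_le; lra.
- intros e he.
  destruct (polylog_2_lim (e / 3) ltac:(lra)) as [d1 [hd1 h1]].
  destruct (x_ln_x_small (e / 3) ltac:(lra)) as [d2 [hd2 h2]].
  exists (Rmin d1 d2); split; [apply Rmin_glb_lt; lra|]; intros s [hs hs'].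
  specialize (h1 s (conj hs (Rlt_le_trans _ _ _ hs' (Rmin_l _ _)))).
  destruct (h2 s (conj hs (Rlt_le_trans _ _ _ hs' (Rmin_r _ _)))) as [h3 h4].
  apply Rabs_le_between in h1, h3; apply Rabs_le; lra.
Qed.

(** The term in [t ^ 2] without logarithm is left in the error: the expansion is multiplied by [t]
    later on, and an error of order [t ^ 3] is allowed. *)
Lemma polylog_3_expansion (t : R) : 0 < t <= 1 ->
  Rabs (polylog 3 t - (zeta 3 - zeta 2 * t - t ^ 2 / 2 * ln t)) <= 3 * t ^ 2.
Proof.
intros ht.
assert (z0 : 0 <= zeta 2).
{ unfold zeta; rewrite (is_series_unique _ _ is_series_zeta_2); pose proof (pow2_ge_0 PI); lra. }
replace (polylog 3 t - (zeta 3 - zeta 2 * t - t ^ 2 / 2 * ln t))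
  with ((polylog 3 t + (zeta 2 * t + t ^ 2 / 2 * ln t)) - zeta 3) by ring.
apply (derive_linear_bound (fun s => polylog 3 s + (zeta 2 * s + s ^ 2 / 2 * ln s))
   (fun s => - polylog 2 s + (zeta 2 + s * ln s + s / 2))); try lra.
- intros s hs; apply is_derive_Rplus; [apply is_derive_polylog; lra|].
  auto_derive; [lra|field; lra].
- intros s hs; pose proof (polylog_2_expansion s ltac:(lra)) as h.
  assert (s ^ 2 <= s) by nra.
  apply Rabs_le_between in h; apply Rabs_le; lra.
- intros e he.
  assert (hz : 0 < 2 * zeta 2 + 1) by lra.
  assert (he' : 0 < e / (2 * zeta 2 + 1)) by (apply Rdiv_lt_0_compat; lra).
  destruct (x_ln_x_small (e / (2 * zeta 2 + 1)) he') as [d2 [hd2 h2]].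
  exists d2; split; [lra|]; intros s hs.
  destruct (h2 s hs) as [h3 h4].
  pose proof (polylog_zeta 3 s ltac:(lia) ltac:(lra)) as h1; simpl pred in h1.
  assert (h5 : Rabs (s ^ 2 / 2 * ln s) <= e / (2 * zeta 2 + 1)).
  { replace (s ^ 2 / 2 * ln s) with (s / 2 * (s * ln s)) by field.
    rewrite Rabs_mult, (Rabs_pos_eq (s / 2)) by lra.
    pose proof (Rabs_pos (s * ln s)); nra. }
  assert (h6 : e / (2 * zeta 2 + 1) * (2 * zeta 2 + 1) = e) by (field; lra).
  apply Rabs_le_between in h1, h5.
  assert (0 <= s * zeta 2 <= e / (2 * zeta 2 + 1) * zeta 2) by (split; nra).
  apply Rabs_le; lra.
Qed.

(** * Taylor bounds for the exponential *)

Lemma exp_taylor (x : R) (N : nat) : (0 < N)%nat ->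
  Rabs (exp x - sum_f_R0 (fun k => x ^ k / INR (fact k)) (pred N)) <= Rabs x ^ N * exp (Rabs x).
Proof.
intros hN; rewrite <- (is_series_unique _ _ (is_series_exp x)) at 1.
rewrite (Series_incr_n _ N hN) by (eexists; apply is_series_exp).
match goal with |- Rabs (?s + ?t - ?s) <= _ => replace (s + t - s) with t by ring end.
apply (Series_Rabs_le _ (fun k => Rabs x ^ N * (Rabs x ^ k / INR (fact k)))).
- intros k; pose proof (INR_fact_lt_0 k); pose proof (INR_fact_lt_0 (N + k)).
  unfold Rdiv; rewrite Rabs_mult, <- RPow_abs, pow_add, (Rabs_pos_eq (/ _)), Rmult_assoc
    by (left; apply Rinv_0_lt_compat; lra).
  apply Rmult_le_compat_l; [apply pow_le, Rabs_pos|].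
  apply Rmult_le_compat_l; [apply pow_le, Rabs_pos|].
  apply Rinv_le_contravar; [lra|apply le_INR, fact_le; lia].
- apply is_series_Rscal, is_series_exp.
Qed.

(** With [u] equal to [t] times an eigenvalue, [u] is unbounded above and bounded below. A remainder
    in [exp (Rabs u)] would be useless, so the exponential factor depends on the lower bound
    alone. *)
Lemma exp_neg_second_order (u U : R) : 0 <= U -> - U <= u ->
  Rabs (exp (- u) - 1 + u) <= u ^ 2 * exp U.
Proof.
intros hU hu.
assert (e1 : 1 <= exp U) by (pose proof (exp_ineq1_le U); lra).
destruct (Rle_lt_dec 0 u) as [h|h].
- destruct (exp_neg_bounds u h) as [a [b _]].
  rewrite Rabs_pos_eq by lra.
  apply Rle_trans with (u ^ 2 * 1); [pose proof (pow2_ge_0 u); lra|].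
  apply Rmult_le_compat_l; [apply pow2_ge_0|exact e1].
- pose proof (exp_taylor (- u) 2 ltac:(lia)) as T; simpl pred in T.
  unfold sum_f_R0 in T; simpl in T.
  replace (exp (- u) - (1 / 1 + - u * 1 / 1)) with (exp (- u) - 1 + u) in T by field.
  eapply Rle_trans; [exact T|].
  rewrite Rabs_pos_eq by lra.
  replace (- u * (- u * 1)) with (u ^ 2) by ring.
  apply Rmult_le_compat_l; [apply pow2_ge_0|].
  apply exp_le_compat; lra.
Qed.

(** * Expansion of the trace *)

(** The mean value theorem for [phi], whose derivative is of order [t ^ 3 * x ^ 2], keeps the factor
    [Rabs (l - m)]; expanding the two exponentials separately would lose it. *)
Lemma exp_diff_expansion (t l m X C : R) : 0 < t <= 1 -> 0 <= C -> C <= X ->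
  - C <= l <= X -> - C <= m <= X ->
  Rabs (exp (- t * l) - exp (- t * m) + t * (l - m) - t ^ 2 / 2 * (l ^ 2 - m ^ 2))
    <= Rabs (l - m) * (t ^ 3 * X ^ 2 * exp C).
Proof.
intros ht hC hX hl hm.
set (phi := fun x => exp (- t * x) + t * x - t ^ 2 / 2 * x ^ 2).
destruct (MVT_gen phi m l (fun x => - t * (exp (- t * x) - 1 + t * x))) as [c [hc E]].
- intros x _; unfold phi; auto_derive; auto; field.
- intros x _; apply continuity_pt_filterlim, (ex_derive_continuous phi); unfold phi; auto_derive; auto.
- replace (exp (- t * l) - exp (- t * m) + t * (l - m) - t ^ 2 / 2 * (l ^ 2 - m ^ 2))
    with (phi l - phi m) by (unfold phi; field).
  rewrite E, Rabs_mult, (Rmult_comm (Rabs (l - m))).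
  apply Rmult_le_compat_r; [apply Rabs_pos|].
  assert (hc' : - C <= c <= X).
  { destruct hc as [h1 h2]; split.
    - eapply Rle_trans; [|exact h1]; apply Rmin_glb; lra.
    - eapply Rle_trans; [exact h2|]; apply Rmax_lub; lra. }
  rewrite <- Ropp_mult_distr_l with (r1 := t) (r2 := c).
  rewrite Rabs_mult, Rabs_Ropp, (Rabs_pos_eq t) by lra.
  replace (t ^ 3 * X ^ 2 * exp C) with (t * (t ^ 2 * X ^ 2 * exp C)) by ring.
  apply Rmult_le_compat_l; [lra|].
  eapply Rle_trans; [apply (exp_neg_second_order (t * c) C hC); nra|].
  rewrite Rpow_mult_distr; apply Rmult_le_compat_r; [left; apply exp_pos|].
  apply Rmult_le_compat_l; [apply pow2_ge_0|]; nra.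
Qed.

(** [mu n b - n] split by parity in [b]. The odd part tends to [- b] as [x] grows and does not
    decay; in the sum over the fields [b] and [- b] it enters only through even powers. *)
Definition mu_odd (b x : R) : R := - b + b / x - b / x ^ 2 + (b ^ 3 + b) / x ^ 3.
Definition mu_even (b x : R) : R := b ^ 2 / x ^ 2 - 7 * b ^ 2 / (2 * x ^ 3).

Lemma mu_parity (n : nat) (b : R) : (1 <= n)%nat ->
  mu n b = INR n + (mu_odd b (INR n) + mu_even b (INR n)) /\
  mu n (- b) = INR n + (- mu_odd b (INR n) + mu_even b (INR n)).
Proof.
intros hn; assert (0 < INR n) by (apply lt_0_INR; lia).
unfold mu, mu_odd, mu_even; split; field; lra.
Qed.

Lemma Rabs_div_ge_1 (u v U : R) : Rabs u <= U -> 1 <= v -> Rabs (u / v) <= U.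
Proof.
intros hu hv; unfold Rdiv; rewrite Rabs_mult, (Rabs_pos_eq (/ v)) by (left; apply Rinv_0_lt_compat; lra).
apply (proj2 (Rle_div_l _ _ v ltac:(lra))); pose proof (Rabs_pos u); nra.
Qed.

Lemma mu_odd_even_bound (L : R) : 0 < L -> exists C, 0 <= C /\ forall b x, Rabs b <= L -> 1 <= x ->
  Rabs (mu_odd b x) <= C * Rabs b /\ Rabs (mu_even b x) <= C * Rabs b /\
  Rabs (mu_even b x) <= C * Rabs b / x ^ 2.
Proof.
(* The four terms of [mu_odd] account for [4 + L ^ 2], the two terms of [mu_even] for
   [(1 + 7 / 2) * L]. *)
intros hL; exists (4 + L ^ 2 + 9 / 2 * L).
assert (0 <= L ^ 2) by apply pow2_ge_0.
split; [lra|]; intros b x hb hx.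
assert (x2 : 1 <= x ^ 2) by (apply pow_R1_Rle; lra).
assert (x3 : 1 <= x ^ 3) by (apply pow_R1_Rle; lra).
pose proof (Rabs_pos b) as b0.
assert (hb2 : Rabs b ^ 2 <= L ^ 2) by (apply pow_incr; lra).
assert (o : Rabs (mu_odd b x) <= Rabs b + Rabs b + Rabs b + (L ^ 2 * Rabs b + Rabs b)).
{ unfold mu_odd, Rminus.
  eapply Rle_trans; [apply Rabs_triang|]; apply Rplus_le_compat.
  - eapply Rle_trans; [apply Rabs_triang|]; apply Rplus_le_compat.
    + eapply Rle_trans; [apply Rabs_triang|]; apply Rplus_le_compat.
      * rewrite Rabs_Ropp; lra.
      * apply Rabs_div_ge_1; lra.
    + rewrite Rabs_Ropp; apply Rabs_div_ge_1; lra.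
  - apply Rabs_div_ge_1; [|exact x3].
    eapply Rle_trans; [apply Rabs_triang|]; apply Rplus_le_compat_r.
    rewrite <- RPow_abs; replace (Rabs b ^ 3) with (Rabs b ^ 2 * Rabs b) by ring.
    apply Rmult_le_compat_r; lra. }
assert (e : Rabs (mu_even b x) <= 9 / 2 * L * Rabs b / x ^ 2).
{ replace (mu_even b x) with ((b ^ 2 - 7 / 2 * b ^ 2 / x) / x ^ 2) by (unfold mu_even; field; lra).
  unfold Rdiv at 1; rewrite Rabs_mult, (Rabs_pos_eq (/ x ^ 2)) by (left; apply Rinv_0_lt_compat; lra).
  apply Rmult_le_compat_r; [left; apply Rinv_0_lt_compat; lra|].
  assert (B : Rabs (b ^ 2) <= L * Rabs b) by (rewrite <- RPow_abs; nra).
  unfold Rminus; eapply Rle_trans; [apply Rabs_triang|]; rewrite Rabs_Ropp.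
  replace (9 / 2 * L * Rabs b) with (L * Rabs b + 7 / 2 * (L * Rabs b)) by field.
  apply Rplus_le_compat; [exact B|].
  apply Rabs_div_ge_1; [|exact hx]; rewrite Rabs_mult, (Rabs_pos_eq (7 / 2)) by lra; lra. }
split; [eapply Rle_trans; [exact o|]; nra|split].
- eapply Rle_trans; [exact e|]; apply (proj2 (Rle_div_l _ _ (x ^ 2) ltac:(lra))).
  assert (0 <= L * Rabs b) by nra.
  apply Rle_trans with ((4 + L ^ 2 + 9 / 2 * L) * Rabs b * 1); [nra|].
  apply Rmult_le_compat_l; [nra|lra].
- eapply Rle_trans; [exact e|]; apply Rmult_le_compat_r; [left; apply Rinv_0_lt_compat; lra|nra].
Qed.

(** The factor [exp (- t * x)] is taken out and kept in the error, because the errors are summed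
    over all modes. *)
Lemma exp_shift_expansion (t x d : R) : 0 < t <= 1 ->
  Rabs (exp (- t * (x + d)) - exp (- t * x) * (1 - t * d + t ^ 2 * d ^ 2 / 2 - t ^ 3 * d ^ 3 / 6))
   <= exp (- t * x) * (t ^ 4 * Rabs d ^ 4 * exp (Rabs d)).
Proof.
intros ht.
replace (- t * (x + d)) with (- t * x + - (t * d)) by ring.
rewrite exp_plus, <- Rmult_minus_distr_l, Rabs_mult, (Rabs_pos_eq (exp _)) by (left; apply exp_pos).
apply Rmult_le_compat_l; [left; apply exp_pos|].
pose proof (exp_taylor (- (t * d)) 4 ltac:(lia)) as T; simpl pred in T; unfold sum_f_R0 in T; simpl in T.
replace (exp (- (t * d)) - (1 - t * d + t ^ 2 * d ^ 2 / 2 - t ^ 3 * d ^ 3 / 6)) with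
  (exp (- (t * d)) -
      (1 / 1 + - (t * d) * 1 / 1 + - (t * d) * (- (t * d) * 1) / (1 + 1) +
       - (t * d) * (- (t * d) * (- (t * d) * 1)) / (1 + 1 + 1 + 1 + 1 + 1))) by field.
eapply Rle_trans; [exact T|].
rewrite Rabs_Ropp, Rabs_mult, (Rabs_pos_eq t) by lra.
pose proof (Rabs_pos d).
replace (t * Rabs d * (t * Rabs d * (t * Rabs d * (t * Rabs d * 1)))) with (t ^ 4 * Rabs d ^ 4) by ring.
apply Rmult_le_compat_l; [apply Rmult_le_pos; apply pow_le; lra|].
apply exp_le_compat; nra.
Qed.

Lemma mu_pair_expansion (L : R) : 0 < L -> exists K, 0 <= K /\ forall (n : nat) (b t : R),
  (1 <= n)%nat -> Rabs b <= L -> 0 < t <= 1 ->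
  let x := INR n in let o := mu_odd b x in let e := mu_even b x in
  Rabs (exp (- t * mu n b) + exp (- t * mu n (- b)) - 2 * exp (- t * x)
    - exp (- t * x) * (- 2 * t * e + t ^ 2 * (o ^ 2 + e ^ 2)))
  <= K * Rabs b * (t ^ 3 * (1 / x ^ 2) + t ^ 4 * exp (- t * x)).
Proof.
intros hL; destruct (mu_odd_even_bound L hL) as [C [hC h]].
set (D := 2 * C).
exists (D ^ 2 * C * L ^ 2 + 2 * (D ^ 4 * L ^ 3 * exp (D * L))).
assert (D0 : 0 <= D) by (unfold D; lra).
assert (p1 : 0 <= D ^ 2 * C * L ^ 2) by (apply Rmult_le_pos; [apply Rmult_le_pos; [apply pow2_ge_0|exact hC]|apply pow2_ge_0]).
assert (p2 : 0 <= D ^ 4 * L ^ 3 * exp (D * L)).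
{ apply Rmult_le_pos; [apply Rmult_le_pos; apply pow_le; lra|left; apply exp_pos]. }
split; [lra|]; intros n b t hn hb ht x o e.
assert (hx : 1 <= x) by (apply (le_INR 1); exact hn).
destruct (h b x hb hx) as [ho [he he2]]; fold o e in ho, he, he2.
destruct (mu_parity n b hn) as [-> ->]; fold x o e.
pose proof (Rabs_pos b) as b0.
assert (x2 : 0 < x ^ 2) by (apply pow_lt; lra).
set (E := exp (- t * x)).
assert (hE : 0 < E) by apply exp_pos.
assert (hE1 : E <= 1).
{ unfold E; rewrite <- Ropp_mult_distr_l; apply exp_neg_le_1; nra. }
assert (rem : forall d, Rabs d <= D * Rabs b ->
  Rabs (exp (- t * (x + d)) - E * (1 - t * d + t ^ 2 * d ^ 2 / 2 - t ^ 3 * d ^ 3 / 6))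
   <= D ^ 4 * L ^ 3 * exp (D * L) * Rabs b * (t ^ 4 * E)).
{ intros d hd; eapply Rle_trans; [apply exp_shift_expansion, ht|]; fold E.
  assert (t4 : 0 <= t ^ 4) by (apply pow_le; lra).
  assert (Rabs d ^ 4 <= D ^ 4 * L ^ 3 * Rabs b).
  { apply Rle_trans with ((D * Rabs b) ^ 4); [apply pow_incr; split; [apply Rabs_pos|exact hd]|].
    rewrite Rpow_mult_distr; replace (Rabs b ^ 4) with (Rabs b ^ 3 * Rabs b) by ring.
    assert (Rabs b ^ 3 <= L ^ 3) by (apply pow_incr; lra).
    assert (0 <= D ^ 4) by (apply pow_le; exact D0).
    rewrite Rmult_assoc; apply Rmult_le_compat_l; [assumption|]; apply Rmult_le_compat_r; lra. }
  assert (exp (Rabs d) <= exp (D * L)) by (apply exp_le_compat; nra).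
  replace (D ^ 4 * L ^ 3 * exp (D * L) * Rabs b * (t ^ 4 * E))
    with (E * (t ^ 4 * (D ^ 4 * L ^ 3 * Rabs b) * exp (D * L))) by ring.
  apply Rmult_le_compat_l; [lra|].
  apply Rmult_le_compat; [apply Rmult_le_pos; [exact t4|apply pow_le, Rabs_pos]|left; apply exp_pos| |assumption].
  apply Rmult_le_compat_l; assumption. }
assert (d1 : Rabs (o + e) <= D * Rabs b).
{ eapply Rle_trans; [apply Rabs_triang|]; unfold D; lra. }
assert (d2 : Rabs (- o + e) <= D * Rabs b).
{ eapply Rle_trans; [apply Rabs_triang|]; rewrite Rabs_Ropp; unfold D; lra. }
pose proof (rem _ d1) as r1; pose proof (rem _ d2) as r2.
set (R1 := exp _ - _) in r1; set (R2 := exp _ - _) in r2.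
(* The cubes of [o + e] and [- o + e] add up to [2 * e * (3 * o ^ 2 + e ^ 2)]: every cubic term has
   a factor [e] and hence the decay [1 / x ^ 2]. *)
replace (exp (- t * (x + (o + e))) + exp (- t * (x + (- o + e))) - 2 * E
  - E * (- 2 * t * e + t ^ 2 * (o ^ 2 + e ^ 2)))
  with (R1 + R2 + - (E * (t ^ 3 * ((3 * o ^ 2 + e ^ 2) * e / 3)))) by (unfold R1, R2; field).
eapply Rle_trans; [apply Rabs_triang|].
eapply Rle_trans; [apply Rplus_le_compat_r, Rabs_triang|].
assert (c3 : Rabs (- (E * (t ^ 3 * ((3 * o ^ 2 + e ^ 2) * e / 3))))
  <= D ^ 2 * C * L ^ 2 * Rabs b * (t ^ 3 * (1 / x ^ 2))).
{ rewrite Rabs_Ropp, !Rabs_mult, (Rabs_pos_eq E) by lra.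
  assert (t3 : 0 <= t ^ 3) by (apply pow_le; lra).
  rewrite (Rabs_pos_eq (t ^ 3)) by exact t3.
  assert (q : Rabs ((3 * o ^ 2 + e ^ 2) * e / 3) <= D ^ 2 * L ^ 2 * (C * Rabs b / x ^ 2)).
  { replace ((3 * o ^ 2 + e ^ 2) * e / 3) with ((o ^ 2 + / 3 * e ^ 2) * e) by field.
    rewrite Rabs_mult; apply Rmult_le_compat; [apply Rabs_pos|apply Rabs_pos| |exact he2].
    assert (o2 : o ^ 2 <= (C * L) ^ 2).
    { rewrite <- (pow2_abs o); apply pow_incr; split; [apply Rabs_pos|nra]. }
    assert (e2 : e ^ 2 <= (C * L) ^ 2).
    { rewrite <- (pow2_abs e); apply pow_incr; split; [apply Rabs_pos|nra]. }
    pose proof (pow2_ge_0 o); pose proof (pow2_ge_0 e).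
    rewrite Rabs_pos_eq by lra.
    replace (D ^ 2 * L ^ 2) with (4 * (C * L) ^ 2) by (unfold D; ring). lra. }
  pose proof (Rabs_pos ((3 * o ^ 2 + e ^ 2) * e / 3)).
  unfold Rdiv in *; rewrite !Rabs_mult in *.
  replace (D ^ 2 * C * L ^ 2 * Rabs b * (t ^ 3 * (1 * / x ^ 2)))
    with (1 * (t ^ 3 * (D ^ 2 * L ^ 2 * (C * Rabs b * / x ^ 2)))) by ring.
  apply Rmult_le_compat; [lra|apply Rmult_le_pos; assumption|exact hE1|].
  apply Rmult_le_compat_l; assumption. }
assert (g1 : 0 <= D ^ 2 * C * L ^ 2 * Rabs b * (t ^ 4 * E)).
{ apply Rmult_le_pos; [nra|]; apply Rmult_le_pos; [apply pow_le; lra|lra]. }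
assert (g2 : 0 <= D ^ 4 * L ^ 3 * exp (D * L) * Rabs b * (t ^ 3 * (1 / x ^ 2))).
{ apply Rmult_le_pos; [nra|]; apply Rmult_le_pos; [apply pow_le; lra|apply Rlt_le, Rdiv_lt_0_compat; lra]. }
set (A := D ^ 2 * C * L ^ 2) in *; set (B := D ^ 4 * L ^ 3 * exp (D * L)) in *.
set (u := t ^ 3 * (1 / x ^ 2)) in *; set (v := t ^ 4 * E) in *.
replace ((A + 2 * B) * Rabs b * (u + v)) with
  (A * Rabs b * u + A * Rabs b * v + 2 * (B * Rabs b * u) + 2 * (B * Rabs b * v)) by ring.
lra.
Qed.

Lemma lambda_mu_range (L : R) : 0 < L -> exists C, 0 <= C /\ forall (n : nat) (b : R),
  (1 <= n)%nat -> Rabs b <= L ->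
  INR n - C <= lambda n b <= INR n + C /\ INR n - C <= mu n b <= INR n + C.
Proof.
intros hL.
destruct (lambda_mu_bound L hL) as [K [hK h]].
destruct (mu_odd_even_bound L hL) as [C [hC hm]].
exists (2 * C * L + K * L); split; [nra|]; intros n b hn hb.
assert (hx : 1 <= INR n) by (apply (le_INR 1); exact hn).
specialize (h n b hn hb); destruct (hm b (INR n) hb hx) as [ho [he _]].
pose proof (Rabs_pos b) as b0.
assert (x4 : 1 <= INR n ^ 4) by (apply pow_R1_Rle, hx).
assert (d : K * Rabs b / INR n ^ 4 <= K * L).
{ apply (proj2 (Rle_div_l _ _ (INR n ^ 4) ltac:(lra))).
  apply Rle_trans with (K * L * 1); [nra|]; apply Rmult_le_compat_l; nra. }
assert (C * Rabs b <= C * L) by nra.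
assert (0 <= K * L) by nra.
destruct (mu_parity n b hn) as [E _]; rewrite E in *.
apply Rabs_le_between in h, ho, he; lra.
Qed.

Lemma lambda_mu_sq_bound (L : R) : 0 < L -> exists K, 0 <= K /\ forall (n : nat) (b : R),
  (1 <= n)%nat -> Rabs b <= L -> Rabs (lambda n b ^ 2 - mu n b ^ 2) <= K * (1 / INR n ^ 3).
Proof.
intros hL.
destruct (lambda_mu_bound L hL) as [K [hK h]].
destruct (lambda_mu_range L hL) as [C [hC hr]].
exists (K * L * (2 + 2 * C)); split; [apply Rmult_le_pos; nra|]; intros n b hn hb.
assert (hx : 1 <= INR n) by (apply (le_INR 1); exact hn).
specialize (h n b hn hb); specialize (hr n b hn hb); pose proof (Rabs_pos b).
replace (lambda n b ^ 2 - mu n b ^ 2) with ((lambda n b - mu n b) * (lambda n b + mu n b)) by ring.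
rewrite Rabs_mult.
assert (x4 : 0 < INR n ^ 4) by (apply pow_lt; lra).
apply Rle_trans with (K * L / INR n ^ 4 * ((2 + 2 * C) * INR n)).
- apply Rmult_le_compat; [apply Rabs_pos|apply Rabs_pos| |].
  + eapply Rle_trans; [exact h|]; apply Rmult_le_compat_r; [left; apply Rinv_0_lt_compat; lra|nra].
  + apply Rabs_le; nra.
- right; field; lra.
Qed.

Lemma ex_series_lambda_mu (L b : R) : 0 < L -> Rabs b <= L ->
  ex_series (fun k => lambda (S k) b - mu (S k) b) /\
  ex_series (fun k => lambda (S k) b ^ 2 - mu (S k) b ^ 2).
Proof.
intros hL hb.
destruct (lambda_mu_bound L hL) as [K [hK h]].
destruct (lambda_mu_sq_bound L hL) as [K2 [hK2 h2]].
split.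
- apply (ex_series_Rle _ (fun k => K * Rabs b * (1 / INR (S k) ^ 4))).
  + intros k; eapply Rle_trans; [apply (h (S k) b ltac:(lia) hb)|right; unfold Rdiv; ring].
  + apply ex_series_Rscal, ex_series_zeta; lia.
- apply (ex_series_Rle _ (fun k => K2 * (1 / INR (S k) ^ 3))).
  + intros k; apply (h2 (S k) b ltac:(lia) hb).
  + apply ex_series_Rscal, ex_series_zeta; lia.
Qed.

(** * The trace as a sum over modes *)

Lemma eigenvalue_nonneg (b : R) (k : nat) : eigenvalue b (Z.of_nat k) = lambda k b.
Proof.
unfold eigenvalue, mode_field; rewrite Zabs2Nat.id.
destruct (Z_le_dec 0 (Z.of_nat k)); [reflexivity|lia].
Qed.

Lemma eigenvalue_neg (b : R) (k : nat) : eigenvalue b (- Z.of_nat (S k))%Z = lambda (S k) (- b).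
Proof.
unfold eigenvalue, mode_field; replace (Z.abs_nat (- Z.of_nat (S k))) with (S k) by lia.
destruct (Z_le_dec 0 (- Z.of_nat (S k))); [lia|reflexivity].
Qed.

Lemma lambda_zero_field (k : nat) : lambda k 0 = INR k.
Proof. unfold lambda; ring. Qed.

Definition heat_diff (t b : R) (n : nat) : R := exp (- t * lambda n b) - exp (- t * INR n).

Lemma op_sub_diag_nonneg (b t : R) (k : nat) : 0 < t ->
  op_sub (exp_op (DN b) t) (exp_op (DN 0) t) (expi (Z.of_nat k)) (Z.of_nat k) = RtoC (heat_diff t b k).
Proof.
intros ht; unfold op_sub; rewrite !exp_op_diag, <- RtoC_minus by exact ht.
rewrite !eigenvalue_nonneg, lambda_zero_field; reflexivity.
Qed.

Lemma op_sub_diag_neg (b t : R) (k : nat) : 0 < t ->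
  op_sub (exp_op (DN b) t) (exp_op (DN 0) t) (expi (- Z.of_nat (S k))%Z) (- Z.of_nat (S k))%Z
  = RtoC (heat_diff t (- b) (S k)).
Proof.
intros ht; unfold op_sub; rewrite !exp_op_diag, <- RtoC_minus by exact ht.
rewrite !eigenvalue_neg, Ropp_0, lambda_zero_field; reflexivity.
Qed.

(** Each eigenvalue is at least [n - C], so the terms are dominated by a multiple of the geometric
    series [polylog 0 t]. *)
Lemma ex_series_heat_diff (L t b : R) : 0 < L -> 0 < t -> Rabs b <= L ->
  ex_series (fun k => Rabs (heat_diff t b (S k))).
Proof.
intros hL ht hb; destruct (lambda_mu_range L hL) as [C [hC h]].
apply (ex_series_Rle _ (fun k => (exp (t * C) + 1) * (exp (- t * INR (S k)) / INR (S k) ^ 0))).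
- intros k; rewrite Rabs_Rabsolu.
  destruct (h (S k) b ltac:(lia) hb) as [[h1 _] _].
  assert (exp (- t * lambda (S k) b) <= exp (t * C) * exp (- t * INR (S k))).
  { rewrite <- exp_plus; apply exp_le_compat; nra. }
  pose proof (exp_pos (- t * lambda (S k) b)); pose proof (exp_pos (- t * INR (S k))).
  unfold heat_diff; rewrite pow_O; apply Rabs_le; split; unfold Rdiv; rewrite Rinv_1; nra.
- apply ex_series_Rscal, polylog_PSeries, ht.
Qed.

Lemma ex_trace_heat_diff (L b t : R) : 0 < L -> Rabs b <= L -> 0 < t ->
  ex_trace (op_sub (exp_op (DN b) t) (exp_op (DN 0) t)).
Proof.
intros hL hb ht; split.
- apply (ex_series_ext (fun k => Rabs (heat_diff t b k))).
  { intros k; rewrite op_sub_diag_nonneg, Cmod_R by exact ht; reflexivity. }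
  apply ex_series_incr_1; apply (ex_series_heat_diff L); assumption.
- apply (ex_series_ext (fun k => Rabs (heat_diff t (- b) (S k)))).
  { intros k; rewrite op_sub_diag_neg, Cmod_R by exact ht; reflexivity. }
  apply (ex_series_heat_diff L); try assumption; rewrite Rabs_Ropp; assumption.
Qed.

Lemma trace_heat_diff (L b t : R) : 0 < L -> Rabs b <= L -> 0 < t ->
  trace (op_sub (exp_op (DN b) t) (exp_op (DN 0) t)) =
  RtoC (heat_diff t b 0 + Series (fun k => heat_diff t b (S k))
        + Series (fun k => heat_diff t (- b) (S k))).
Proof.
intros hL hb ht; unfold trace, sumZ, RtoC; f_equal.
- f_equal.
  + rewrite (Series_ext _ (heat_diff t b)).
    * apply Series_incr_1, ex_series_incr_1, ex_series_Rabs, (ex_series_heat_diff L); assumption.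
    * intros k; rewrite op_sub_diag_nonneg by exact ht; reflexivity.
  + apply Series_ext; intros k; rewrite op_sub_diag_neg by exact ht; reflexivity.
- rewrite (Series_ext _ (fun _ => 0)), (Series_ext (fun k => Im _) (fun _ => 0)).
  + rewrite (is_series_unique _ _ (is_series_zero (fun _ => 0) (fun _ => eq_refl))); ring.
  + intros k; rewrite op_sub_diag_neg by exact ht; reflexivity.
  + intros k; rewrite op_sub_diag_nonneg by exact ht; reflexivity.
Qed.

Lemma is_series_Rplus (a c : nat -> R) (l m : R) : is_series a l -> is_series c m ->
  is_series (fun k => a k + c k) (l + m).
Proof. apply (is_series_plus (V := R_NormedModule) a c l m). Qed.

Lemma Series_close (a c B : nat -> R) (l m s : R) : is_series a l -> is_series c m -> is_series B s ->
  (forall k, Rabs (a k - c k) <= B k) -> Rabs (l - m) <= s.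
Proof.
intros ha hc hB h.
assert (hd : is_series (fun k => a k - c k) (l - m)).
{ apply (is_series_minus (V := R_NormedModule) a c l m ha hc). }
rewrite <- (is_series_unique _ _ hd); apply (Series_Rabs_le _ B s h hB).
Qed.

(** The coefficient of [polylog j t] is that of [1 / x ^ j] in [- 2 * t * mu_even b x + t ^ 2 *
    (mu_odd b x ^ 2 + mu_even b x ^ 2)]. For instance [57 / 4] is 2 from the odd part plus
    [(7 / 2) ^ 2] from the even part. *)
Definition heat_main (t b : R) : R :=
  - t * (sum_diff1 b + sum_diff1 (- b)) + t ^ 2 / 2 * (sum_diff2 b + sum_diff2 (- b))
  + (- 2 * t * b ^ 2 * polylog 2 t + 7 * t * b ^ 2 * polylog 3 t)
  + t ^ 2 * (b ^ 2 * polylog 0 t - 2 * b ^ 2 * polylog 1 t + 3 * b ^ 2 * polylog 2 t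
      - (2 * b ^ 4 + 4 * b ^ 2) * polylog 3 t + (3 * b ^ 4 + 3 * b ^ 2) * polylog 4 t
      - (9 * b ^ 4 + 2 * b ^ 2) * polylog 5 t + (b ^ 6 + 57 / 4 * b ^ 4 + b ^ 2) * polylog 6 t).

Lemma is_series_polylog (j : nat) (t : R) : 0 < t ->
  is_series (fun k => exp (- t * INR (S k)) / INR (S k) ^ j) (polylog j t).
Proof. intros ht; apply Series_correct, polylog_PSeries, ht. Qed.

Lemma is_series_heat_main (L t b : R) : 0 < L -> Rabs b <= L -> 0 < t ->
  is_series (fun k => let x := INR (S k) in
    - t * ((lambda (S k) b - mu (S k) b) + (lambda (S k) (- b) - mu (S k) (- b)))
    + t ^ 2 / 2 * ((lambda (S k) b ^ 2 - mu (S k) b ^ 2) + (lambda (S k) (- b) ^ 2 - mu (S k) (- b) ^ 2))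
    + exp (- t * x) * (- 2 * t * mu_even b x + t ^ 2 * (mu_odd b x ^ 2 + mu_even b x ^ 2)))
  (heat_main t b).
Proof.
intros hL hb ht.
assert (hb' : Rabs (- b) <= L) by (rewrite Rabs_Ropp; exact hb).
destruct (ex_series_lambda_mu L b hL hb) as [e1 e2].
destruct (ex_series_lambda_mu L (- b) hL hb') as [e3 e4].
apply Series_correct in e1, e2, e3, e4.
set (g := fun j k => exp (- t * INR (S k)) / INR (S k) ^ j).
apply (is_series_ext (fun k =>
   - t * ((lambda (S k) b - mu (S k) b) + (lambda (S k) (- b) - mu (S k) (- b)))
    + t ^ 2 / 2 * ((lambda (S k) b ^ 2 - mu (S k) b ^ 2) + (lambda (S k) (- b) ^ 2 - mu (S k) (- b) ^ 2))
    + ((- 2 * t * b ^ 2) * g 2%nat k + (7 * t * b ^ 2) * g 3%nat k)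
    + t ^ 2 * ((((((b ^ 2 * g 0%nat k + (- 2 * b ^ 2) * g 1%nat k) + 3 * b ^ 2 * g 2%nat k)
      + (- (2 * b ^ 4 + 4 * b ^ 2)) * g 3%nat k) + (3 * b ^ 4 + 3 * b ^ 2) * g 4%nat k)
      + (- (9 * b ^ 4 + 2 * b ^ 2)) * g 5%nat k) + (b ^ 6 + 57 / 4 * b ^ 4 + b ^ 2) * g 6%nat k))).
{ intros k; cbv zeta; rewrite !Rplus_assoc; do 2 f_equal.
  pose proof (INR_S_ge_1 k).
  unfold g, mu_even, mu_odd; field; lra. }
evar_last.
- repeat lazymatch goal with
    | |- is_series (fun k => g ?j k) _ => exact (is_series_polylog j t ht)
    | |- is_series (g ?j) _ => exact (is_series_polylog j t ht)
    | |- is_series (fun k => lambda _ _ - mu _ _) _ => first [exact e1|exact e3]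
    | |- is_series (fun k => lambda _ _ ^ 2 - mu _ _ ^ 2) _ => first [exact e2|exact e4]
    | |- is_series (fun k => _ + _) _ => apply is_series_Rplus
    | |- is_series (fun k => _ * _) _ => apply is_series_Rscal
    end.
- apply Rminus_diag_uniq; unfold heat_main, sum_diff1, sum_diff2; ring.
Qed.

Lemma heat_diff_pair_expansion (L : R) : 0 < L -> exists K, 0 <= K /\ forall (n : nat) (b t : R),
  (1 <= n)%nat -> Rabs b <= L -> 0 < t <= 1 -> let x := INR n in
  Rabs (heat_diff t b n + heat_diff t (- b) n -
    (- t * ((lambda n b - mu n b) + (lambda n (- b) - mu n (- b)))
    + t ^ 2 / 2 * ((lambda n b ^ 2 - mu n b ^ 2) + (lambda n (- b) ^ 2 - mu n (- b) ^ 2))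
    + exp (- t * x) * (- 2 * t * mu_even b x + t ^ 2 * (mu_odd b x ^ 2 + mu_even b x ^ 2))))
  <= K * Rabs b * (t ^ 3 * (1 / x ^ 2) + t ^ 4 * exp (- t * x)).
Proof.
intros hL.
destruct (lambda_mu_bound L hL) as [K1 [hK1 h1]].
destruct (lambda_mu_range L hL) as [C [hC hr]].
destruct (mu_pair_expansion L hL) as [K2 [hK2 h2]].
set (K3 := K1 * ((1 + C) ^ 2 * exp C)).
assert (hK3 : 0 <= K3).
{ unfold K3; apply Rmult_le_pos; [exact hK1|]; apply Rmult_le_pos; [apply pow2_ge_0|left; apply exp_pos]. }
exists (2 * K3 + K2); split; [lra|]; intros n b t hn hb ht x.
assert (hx : 1 <= x) by (apply (le_INR 1); exact hn).
assert (E : forall c, Rabs c = Rabs b ->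
  Rabs (exp (- t * lambda n c) - exp (- t * mu n c) + t * (lambda n c - mu n c)
    - t ^ 2 / 2 * (lambda n c ^ 2 - mu n c ^ 2)) <= K3 * Rabs b * (t ^ 3 * (1 / x ^ 2))).
{ intros c hc; rewrite <- hc in hb |- *.
  specialize (h1 n c hn hb); destruct (hr n c hn hb) as [r1 r2]; fold x in h1, r1, r2.
  (* Both eigenvalues lie between [- C] and [x + C <= (1 + C) * x]; squaring this bound against
     [1 / x ^ 4] leaves the summable [1 / x ^ 2]. *)
  eapply Rle_trans; [apply (exp_diff_expansion t _ _ ((1 + C) * x) C); try lra; nra|].
  assert (t3 : 0 < t ^ 3) by (apply pow_lt; lra).
  apply Rle_trans with (K1 * Rabs c / x ^ 4 * (t ^ 3 * ((1 + C) * x) ^ 2 * exp C)).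
  - apply Rmult_le_compat_r; [|exact h1].
    apply Rmult_le_pos; [apply Rmult_le_pos; [lra|apply pow2_ge_0]|left; apply exp_pos].
  - right; unfold K3; field; lra. }
pose proof (E b eq_refl) as E1; pose proof (E (- b) (Rabs_Ropp b)) as E2.
specialize (h2 n b t hn hb ht); cbv zeta in h2; fold x in h2.
unfold heat_diff; fold x.
set (o := mu_odd b x) in *; set (e := mu_even b x) in *.
set (A1 := _ - t ^ 2 / 2 * _) in E1; set (A2 := _ - t ^ 2 / 2 * _) in E2; set (A3 := _ - _ * (_ + _)) in h2.
match goal with |- Rabs ?A <= _ => replace A with (A1 + A2 + A3) by (unfold A1, A2, A3; ring) end.
eapply Rle_trans; [apply Rabs_triang|].
eapply Rle_trans; [apply Rplus_le_compat_r, Rabs_triang|].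
assert (0 <= K3 * Rabs b * (t ^ 4 * exp (- t * x))).
{ apply Rmult_le_pos; [apply Rmult_le_pos; [exact hK3|apply Rabs_pos]|].
  apply Rmult_le_pos; [apply pow_le; lra|left; apply exp_pos]. }
set (u := t ^ 3 * (1 / x ^ 2)) in *; set (v := t ^ 4 * exp (- t * x)) in *.
replace ((2 * K3 + K2) * Rabs b * (u + v))
  with (2 * (K3 * Rabs b * u) + 2 * (K3 * Rabs b * v) + K2 * Rabs b * (u + v)) by ring.
lra.
Qed.

Lemma heat_sum_expansion (L : R) : 0 < L -> exists K, 0 <= K /\ forall b t : R,
  Rabs b <= L -> 0 < t <= 1 ->
  Rabs (Series (fun k => heat_diff t b (S k)) + Series (fun k => heat_diff t (- b) (S k))
    - heat_main t b) <= K * (Rabs b * t ^ 3).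
Proof.
intros hL; destruct (heat_diff_pair_expansion L hL) as [K [hK h]].
assert (z0 : 0 <= PI ^ 2 / 6) by (pose proof (pow2_ge_0 PI); lra).
(* [PI ^ 2 / 6] sums the errors [1 / x ^ 2], and 2 bounds [t * polylog 0 t]. *)
exists (K * (PI ^ 2 / 6 + 2)); split; [apply Rmult_le_pos; lra|]; intros b t hb ht.
assert (hb' : Rabs (- b) <= L) by (rewrite Rabs_Ropp; exact hb).
assert (t3 : 0 < t ^ 3) by (apply pow_lt; lra).
pose proof (Rabs_pos b) as b0.
apply Rle_trans with (K * Rabs b * (t ^ 3 * (PI ^ 2 / 6) + t ^ 4 * polylog 0 t)).
- eapply Series_close.
  + apply is_series_Rplus; apply Series_correct, ex_series_Rabs, (ex_series_heat_diff L); auto; lra.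
  + apply (is_series_heat_main L); auto; lra.
  + apply (is_series_Rscal (K * Rabs b)).
    apply (is_series_Rplus (fun k => t ^ 3 * (1 / INR (S k) ^ 2)) (fun k => t ^ 4 * (exp (- t * INR (S k)) / INR (S k) ^ 0))).
    * apply is_series_Rscal, is_series_zeta_2.
    * apply is_series_Rscal, is_series_polylog; lra.
  + intros k; cbv beta; rewrite pow_O, Rdiv_1_r; apply (h (S k) b t ltac:(lia) hb ht).
- pose proof (polylog_0_expansion t ht) as P; apply Rabs_le_between in P.
  assert (t * polylog 0 t <= 2).
  { apply Rle_trans with (t * (1 / t - 1 / 2 + t)); [apply Rmult_le_compat_l; lra|].
    replace (t * (1 / t - 1 / 2 + t)) with (1 - t / 2 + t * t) by (field; lra). nra. }
  replace (t ^ 4 * polylog 0 t) with (t ^ 3 * (t * polylog 0 t)) by ring.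
  replace (K * (PI ^ 2 / 6 + 2) * (Rabs b * t ^ 3)) with (K * Rabs b * (t ^ 3 * (PI ^ 2 / 6) + t ^ 3 * 2)) by ring.
  apply Rmult_le_compat_l; [apply Rmult_le_pos; lra|].
  apply Rplus_le_compat_l, Rmult_le_compat_l; lra.
Qed.

Lemma zeta_nonneg (j : nat) : (2 <= j)%nat -> 0 <= zeta j.
Proof.
intros hj; eapply Rle_trans; [|apply (term_le_Series _ 0)].
- pose proof (INR_S_pow_ge_1 0 j); apply Rlt_le, Rdiv_lt_0_compat; lra.
- intros k; pose proof (INR_S_pow_ge_1 k j); apply Rlt_le, Rdiv_lt_0_compat; lra.
- apply ex_series_zeta, hj.
Qed.

Lemma heat_main_expansion (L : R) : 0 < L -> exists K, 0 <= K /\ forall b t : R,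
  Rabs b <= L -> 0 < t <= 1 ->
  Rabs (heat_main t b + (- t * lambda 0 b + t ^ 2 / 2 * lambda 0 b ^ 2)
    - (coef_t b * t + coef_t2 b * t ^ 2 - b ^ 2 / 2 * t ^ 3 * ln t)) <= K * (Rabs b * t ^ 3).
Proof.
intros hL.
pose proof (zeta_nonneg 2 ltac:(lia)) as z2; pose proof (zeta_nonneg 3 ltac:(lia)) as z3.
pose proof (zeta_nonneg 4 ltac:(lia)) as z4; pose proof (zeta_nonneg 5 ltac:(lia)) as z5.
(* Here 32 is 23 plus 9: [2 * 1 + 7 * 3] for the errors [e2] and [e3] at order [t], and
   [1 + 2 + 3 * 2] for [e0], [e1] and [e2 - t] at order [t ^ 2]. The zeta values come from the
   linear bounds for orders 3 to 6. *)
set (K := 32 + (2 * L ^ 2 + 4) * zeta 2 + (3 * L ^ 2 + 3) * zeta 3 + (9 * L ^ 2 + 2) * zeta 4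
  + (L ^ 4 + 57 / 4 * L ^ 2 + 1) * zeta 5).
assert (L2 : 0 <= L ^ 2) by apply pow2_ge_0.
assert (L4 : 0 <= L ^ 4) by (apply pow_le; lra).
assert (hK : 0 <= K).
{ unfold K; repeat apply Rplus_le_le_0_compat; try lra; apply Rmult_le_pos; lra. }
exists (K * L); split; [apply Rmult_le_pos; lra|]; intros b t hb ht.
pose proof (polylog_0_expansion t ht) as E0.
pose proof (polylog_1_expansion t ht) as E1.
pose proof (polylog_2_expansion t ht) as E2.
pose proof (polylog_3_expansion t ht) as E3.
pose proof (polylog_zeta 3 t ltac:(lia) ltac:(lra)) as F3.
pose proof (polylog_zeta 4 t ltac:(lia) ltac:(lra)) as F4.
pose proof (polylog_zeta 5 t ltac:(lia) ltac:(lra)) as F5.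
pose proof (polylog_zeta 6 t ltac:(lia) ltac:(lra)) as F6.
simpl pred in F3, F4, F5, F6.
assert (Z2 : zeta 2 = PI ^ 2 / 6) by apply (is_series_unique _ _ is_series_zeta_2).
assert (Z4 : zeta 4 = PI ^ 4 / 90) by apply (is_series_unique _ _ is_series_zeta_4).
assert (Z6 : zeta 6 = PI ^ 6 / 945) by apply (is_series_unique _ _ is_series_zeta_6).
set (e0 := polylog 0 t - _) in E0; set (e1 := - polylog 1 t - _) in E1.
set (e2 := polylog 2 t - _) in E2; set (e3 := polylog 3 t - (zeta 3 - _ - _)) in E3.
set (f3 := polylog 3 t - zeta 3) in F3; set (f4 := polylog 4 t - _) in F4.
set (f5 := polylog 5 t - _) in F5; set (f6 := polylog 6 t - _) in F6.
(* The polylogarithms of orders 2 and 3 are used at two precisions: with errors [e2], [e3] where the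
   prefactor is [t], and with errors [e2 - t], [f3] where it is [t ^ 2]. The [t ^ 2 * ln t] terms
   cancel as -2 + 2, and the [t ^ 3 * ln t] terms combine as -7/2 + 3 = -1/2. The [b ^ 2 * t] in
   [coef_t] is the pole [1 / t] of [polylog 0]. *)
assert (Id : heat_main t b + (- t * lambda 0 b + t ^ 2 / 2 * lambda 0 b ^ 2)
    - (coef_t b * t + coef_t2 b * t ^ 2 - b ^ 2 / 2 * t ^ 3 * ln t)
  = b ^ 2 * (- 2 * t * e2 + 7 * t * e3 + t ^ 2 * (e0 + 2 * e1 + 3 * (e2 - t)
      - (2 * b ^ 2 + 4) * f3 + (3 * b ^ 2 + 3) * f4 - (9 * b ^ 2 + 2) * f5
      + (b ^ 4 + 57 / 4 * b ^ 2 + 1) * f6))).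
{ unfold heat_main, coef_t, coef_t2, e0, e1, e2, e3, f3, f4, f5, f6.
  rewrite Z2, Z4, Z6; field; lra. }
rewrite Id; clear Id.
assert (b2 : 0 <= b ^ 2 <= L * Rabs b).
{ split; [apply pow2_ge_0|]; rewrite <- (pow2_abs b); pose proof (Rabs_pos b); nra. }
assert (b2L : b ^ 2 <= L ^ 2) by (rewrite <- (pow2_abs b); apply pow_incr; split; [apply Rabs_pos|exact hb]).
assert (b4L : 0 <= b ^ 4 <= L ^ 4).
{ replace (b ^ 4) with ((b ^ 2) ^ 2) by ring; replace (L ^ 4) with ((L ^ 2) ^ 2) by ring.
  split; [apply pow2_ge_0|apply pow_incr; lra]. }
rewrite Rabs_mult, (Rabs_pos_eq (b ^ 2)) by lra.
apply Rle_trans with (L * Rabs b * (K * t ^ 3)); [|right; ring].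
apply Rmult_le_compat; [lra|apply Rabs_pos|lra|].
assert (M : forall p P f F, 0 <= p <= P -> Rabs f <= t * F -> 0 <= F -> Rabs (p * f) <= t * (P * F)).
{ intros p P f F hp hf hF; rewrite Rabs_mult, (Rabs_pos_eq p) by lra.
  replace (t * (P * F)) with (P * (t * F)) by ring; apply Rmult_le_compat; try lra; apply Rabs_pos. }
pose proof (M (2 * b ^ 2 + 4) (2 * L ^ 2 + 4) f3 (zeta 2) ltac:(lra) F3 z2) as G3.
pose proof (M (3 * b ^ 2 + 3) (3 * L ^ 2 + 3) f4 (zeta 3) ltac:(lra) F4 z3) as G4.
pose proof (M (9 * b ^ 2 + 2) (9 * L ^ 2 + 2) f5 (zeta 4) ltac:(lra) F5 z4) as G5.
pose proof (M (b ^ 4 + 57 / 4 * b ^ 2 + 1) (L ^ 4 + 57 / 4 * L ^ 2 + 1) f6 (zeta 5) ltac:(lra) F6 z5) as G6.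
set (g3 := (2 * b ^ 2 + 4) * f3) in *; set (g4 := (3 * b ^ 2 + 3) * f4) in *.
set (g5 := (9 * b ^ 2 + 2) * f5) in *; set (g6 := (b ^ 4 + _ + 1) * f6) in *.
set (W3 := (2 * L ^ 2 + 4) * zeta 2) in *; set (W4 := (3 * L ^ 2 + 3) * zeta 3) in *.
set (W5 := (9 * L ^ 2 + 2) * zeta 4) in *; set (W6 := (L ^ 4 + _ + 1) * zeta 5) in *.
replace (- 2 * t * e2 + 7 * t * e3 + t ^ 2 * (e0 + 2 * e1 + 3 * (e2 - t) - g3 + g4 - g5 + g6))
  with (t * (- 2 * e2 + 7 * e3 + t * (e0 + 2 * e1 + 3 * (e2 - t) - g3 + g4 - g5 + g6))) by ring.
rewrite Rabs_mult, (Rabs_pos_eq t) by lra.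
replace (K * t ^ 3) with (t * (23 * t ^ 2 + t * (t * (9 + W3 + W4 + W5 + W6)))) by (unfold K; ring).
apply Rmult_le_compat_l; [lra|].
apply Rabs_le_between in E0, E2, E3, G3, G4, G5, G6.
assert (t ^ 2 <= t) by nra.
assert (Hsum : Rabs (e0 + 2 * e1 + 3 * (e2 - t) - g3 + g4 - g5 + g6) <= t * (9 + W3 + W4 + W5 + W6)).
{ apply Rabs_le; lra. }
eapply Rle_trans; [apply Rabs_triang|]; apply Rplus_le_compat.
- apply Rabs_le; lra.
- rewrite Rabs_mult, (Rabs_pos_eq t) by lra; apply Rmult_le_compat_l; lra.
Qed.

Lemma lambda_0_bound (L : R) : 0 < L -> exists K, 0 <= K /\ forall b, Rabs b <= L ->
  Rabs (lambda 0 b) <= K * Rabs b.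
Proof.
intros hL.
destruct (bounded_segment (fun z => kummer1 (1 / 2) (INR 0 + 1) z / kummer (1 / 2) (INR 0 + 1) z) L
  ltac:(lra)) as [C [hC h]].
{ intros z; pose proof (INR_S_pos 0).
  apply (ex_derive_div (kummer1 (1 / 2) (INR 0 + 1)) (kummer (1 / 2) (INR 0 + 1))).
  - eexists; apply is_derive_kummer1; lra.
  - eexists; apply is_derive_kummer; lra.
  - apply kummer_neq_0. }
exists (1 + 2 * C); split; [lra|]; intros b hb; specialize (h b hb); rewrite lambda_kummer.
set (q := kummer1 _ _ _ / _) in *.
replace (INR 0 - b + 2 * b * q) with (b * (-1 + 2 * q)) by (simpl; ring).
rewrite Rabs_mult, Rmult_comm; apply Rmult_le_compat_r; [apply Rabs_pos|].
apply Rabs_le_between in h; apply Rabs_le; lra.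
Qed.

(** The mode 0 has no partner and no approximation [mu]. Its eigenvalue is of size [Rabs b], so a
    plain third-order Taylor bound already carries the factor [Rabs b]. *)
Lemma heat_diff_0_expansion (L : R) : 0 < L -> exists K, 0 <= K /\ forall b t : R,
  Rabs b <= L -> 0 < t <= 1 ->
  Rabs (heat_diff t b 0 - (- t * lambda 0 b + t ^ 2 / 2 * lambda 0 b ^ 2)) <= K * (Rabs b * t ^ 3).
Proof.
intros hL; destruct (lambda_0_bound L hL) as [C [hC h]].
exists (C ^ 3 * L ^ 2 * exp (C * L)); split.
{ apply Rmult_le_pos; [apply Rmult_le_pos; apply pow_le; lra|left; apply exp_pos]. }
intros b t hb ht; specialize (h b hb); set (l := lambda 0 b) in *.
unfold heat_diff; fold l; simpl (INR 0); rewrite Rmult_0_r, exp_0.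
pose proof (exp_taylor (- t * l) 3 ltac:(lia)) as T; simpl pred in T; unfold sum_f_R0 in T; simpl in T.
replace (exp (- t * l) - 1 - (- t * l + t ^ 2 / 2 * l ^ 2)) with
  (exp (- t * l) - (1 / 1 + - t * l * 1 / 1 + - t * l * (- t * l * 1) / (1 + 1))) by field.
eapply Rle_trans; [exact T|].
rewrite Rabs_mult, Rabs_Ropp, (Rabs_pos_eq t) by lra.
pose proof (Rabs_pos l); pose proof (Rabs_pos b).
assert (hl : Rabs l <= C * L) by nra.
replace (t * Rabs l * (t * Rabs l * (t * Rabs l * 1))) with (t ^ 3 * Rabs l ^ 3) by ring.
apply Rle_trans with (t ^ 3 * (C ^ 3 * (L ^ 2 * Rabs b)) * exp (C * L)); [|right; ring].
apply Rmult_le_compat; [apply Rmult_le_pos; apply pow_le; lra|left; apply exp_pos| |].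
- apply Rmult_le_compat_l; [apply pow_le; lra|].
  apply Rle_trans with ((C * Rabs b) ^ 3); [apply pow_incr; lra|].
  rewrite Rpow_mult_distr; apply Rmult_le_compat_l; [apply pow_le; lra|].
  replace (Rabs b ^ 3) with (Rabs b ^ 2 * Rabs b) by ring.
  apply Rmult_le_compat_r; [lra|apply pow_incr; lra].
- apply exp_le_compat; nra.
Qed.

Theorem theorem6p2 (L : R) (hL : 0 < L) :
  (forall b : R, - L <= b <= L ->
     ex_series (fun k => lambda (S k) b - mu (S k) b) /\
     ex_series (fun k => lambda (S k) b ^ 2 - mu (S k) b ^ 2)) /\
  (forall b t : R, - L <= b <= L -> 0 < t ->
     ex_trace (op_sub (exp_op (DN b) t) (exp_op (DN 0) t))) /\
  exists K delta : R, 0 < delta /\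
    forall b t : R, - L <= b <= L -> 0 < t < delta ->
      Cmod (trace (op_sub (exp_op (DN b) t) (exp_op (DN 0) t))
            - RtoC (coef_t b * t + coef_t2 b * t ^ 2
                    - b ^ 2 / 2 * t ^ 3 * ln t))%C
      <= K * (Rabs b * t ^ 3).
Proof.
split; [|split].
- intros b hb; apply (ex_series_lambda_mu L); [exact hL|apply Rabs_le, hb].
- intros b t hb ht; apply (ex_trace_heat_diff L); [exact hL|apply Rabs_le, hb|exact ht].
- destruct (heat_diff_0_expansion L hL) as [K0 [_ h0]].
  destruct (heat_sum_expansion L hL) as [K1 [_ h1]].
  destruct (heat_main_expansion L hL) as [K2 [_ h2]].
  (* All three expansions hold for [0 < t <= 1] with constants that depend on [L] only. *)
  exists (K0 + K1 + K2), 1; split; [lra|]; intros b t hb ht.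
  apply Rabs_le in hb.
  specialize (h0 b t hb ltac:(lra)); specialize (h1 b t hb ltac:(lra)); specialize (h2 b t hb ltac:(lra)).
  rewrite (trace_heat_diff L) by (auto; lra).
  rewrite <- RtoC_minus, Cmod_R.
  set (T := coef_t b * t + _ - _) in *; set (S1 := Series (fun k => heat_diff t b (S k))) in *.
  set (S2 := Series (fun k => heat_diff t (- b) (S k))) in *.
  set (D := heat_diff t b 0) in *; set (M := heat_main t b) in *.
  set (l := - t * lambda 0 b + _) in *.
  replace (D + S1 + S2 - T) with ((D - l) + (S1 + S2 - M) + (M + l - T)) by ring.
  eapply Rle_trans; [apply Rabs_triang|].
  eapply Rle_trans; [apply Rplus_le_compat_r, Rabs_triang|].
  lra.
Qed.
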